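(* Let $(F,\omega)$ be an ideal Liouville domain. Then the boundary $K := \partial F$ has a positive contact structure $\xi$, uniquely determined by $\omega$, which is left invariant by any diffeomorphism of $F$ preserving $\omega$. Moreover, the positive equations of $\xi$ are in one-to-one correspondence with the negative sections of the conormal bundle of $K$.
   Context: All objects are smooth. A domain is a compact manifold with boundary. An ideal Liouville domain $(F,\omega)$ is a domain $F$ endowed with an ideal Liouville structure $\omega$, that is, an exact symplectic form $\omega$ on $\operatorname{Int} F$ admitting a primitive $\lambda$ (so $d\lambda=\omega$) such that for some (and then any) function $u \colon F \to \mathbb{R}_{\ge 0}$ with regular level set $\partial F = \{u=0\}$, the product $u\lambda$ extends to a smooth $1$-form on $F$ which induces a contact form on $\partial F$. A diffeomorphism of $F$ preserves $\omega$ if its restriction to $\operatorname{Int} F$ does. Contact structures are cooriented. $F$ is oriented by $\omega$ and $K$ as the boundary of $F$; a contact structure on $K$ is positive if its contact forms define this boundary orientation. A positive equation of $\xi$ is a $1$-form on $K$ with cooriented kernel $\xi$. The conormal bundle of $K$ in $F$ is the line bundle over $K$ of covectors in $T^*F|_K$ vanishing on $TK$; a section is negative if it takes negative values on vectors pointing transversely outwards. *)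

(* Defs.v *)
From HB Require Import structures.
From mathcomp Require Import all_boot all_order all_algebra all_fingroup.
From mathcomp Require Import boolp classical_sets functions reals.
From mathcomp Require Import topology normedtype derive.

Set Implicit Arguments.
Unset Strict Implicit.
Unset Printing Implicit Defensive.

Import Order.TTheory GRing.Theory Num.Theory.
Import numFieldNormedType.Exports.

Local Open Scope classical_set_scope.
Local Open Scope ring_scope.

(* MathComp-Analysis. Euclidean space of dimension m + 1 is 'rV[R]_m.+1: this
   is the shape for which row vectors carry their norm. *)

Section Euclidean.
Context {R : realType} {m : nat} {W : normedModType R}.
Implicit Types (U A : set 'rV[R]_m.+1) (f : 'rV[R]_m.+1 -> W).

(* Meant for U open. *)
Fixpoint Ck (k : nat) U f : Prop :=
  if k is k'.+1 then
    (forall x, U x -> differentiable f x) /\ forall v, Ck k' U ('D_v f)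
  else forall x, U x -> {for x, continuous f}.

(* C^oo on an arbitrary subset: locally the restriction of a C^oo map defined
   on an open subset of Euclidean space. *)
Definition smooth_on A f : Prop :=
  forall x, A x -> exists U (g : 'rV[R]_m.+1 -> W),
    [/\ open U, U x, forall k, Ck k U g & forall y, U y -> A y -> f y = g y].

(* Directional derivative along the parameters t for which x + t v stays in A.
   For A relatively open in a half-space and x on the wall, this is the
   one-sided derivative when v is transverse to the wall; it is the derivative
   of any smooth extension of f. *)
Definition deriv_in A f (x v : 'rV[R]_m.+1) : W :=
  lim ((fun t : R => t^-1 *: (f (x + t *: v) - f x))
       @ within [set t : R | A (x + t *: v)] 0^').

End Euclidean.

Definition halfspace (R : realType) m : set 'rV[R]_m.+1 :=
  [set x | 0 <= x ord0 ord0].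

Section Multilinear.
Context {R : realType} {V : Type}.

(* The values of a k-covector on k-tuples of vectors. *)
Definition covec k := ('I_k -> V) -> R.

(* Normalized so that dx1 /\ ... /\ dxk is the determinant. *)
Definition wedge k l (a : covec k) (b : covec l) : covec (k + l) :=
  fun v => ((k`! * l`!)%:R)^-1 *
    \sum_(s : 'S_(k + l)) (-1) ^+ s *
      a (fun i => v (s (lshift l i))) * b (fun j => v (s (rshift k j))).

Definition covec1 (a : V -> R) : covec 1 := fun v => a (v ord0).
Definition covec2 (b : V -> V -> R) : covec 2 :=
  fun v => b (v ord0) (v ord_max).

(* b ^ n, of degree 2n *)
Fixpoint wedge_exp (b : V -> V -> R) (n : nat) : covec n.*2 :=
  if n is n'.+1 then wedge (covec2 b) (@wedge_exp b n') else fun=> 1.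

End Multilinear.

Arguments wedge_exp {R V} b n.

Section Atlas.
Context {R : realType}.

(* Charts on a subset of a space T, in dimension m + 1. Only the values of
   coord c on cdom c, of param c (its inverse) on the image of cdom c, and of
   pref on the subset matter.
   The chart pref p is a chart at p chosen once and for all. The tangent space
   at p is identified with 'rV[R]_m.+1 by means of it; every construction below
   is independent of the choice up to this identification. *)
Record atlas (T : topologicalType) (m : nat) := Atlas {
  chart : Type;
  cdom : chart -> set T;
  coord : chart -> T -> 'rV[R]_m.+1;
  param : chart -> 'rV[R]_m.+1 -> T;
  pref : T -> chart }.

Section Charts.
Context {T : topologicalType} {m : nat} (A : atlas T m).
Local Notation V := 'rV[R]_m.+1.

Definition region (c : chart A) : set V := coord c @` cdom c.

(* The vector of T_p with components v in the chart c. *)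
Definition tvec (c : chart A) (p : T) (v : V) : V :=
  deriv_in (region c) (coord (pref A p) \o param c) (coord c p) v.

Definition smooth_fun (S : set T) (u : T -> R) : Prop :=
  forall c : chart A,
    smooth_on (coord c @` (cdom c `&` S)) (u \o param c).

Definition differential (u : T -> R) (p : T) (v : V) : R :=
  deriv_in (region (pref A p)) (u \o param (pref A p)) (coord (pref A p) p) v.

(* Fields of covectors on S are extended by 0 outside S, so that equality of
   functions is equality of fields. *)
Definition smooth_form1 (S : set T) (a : T -> V -> R) : Prop :=
  [/\ forall p, ~ S p -> a p = fun=> 0,
      forall p, S p -> scalar (a p) &
      forall (c : chart A) (v : V),
        smooth_on (coord c @` (cdom c `&` S))
          (fun x => a (param c x) (tvec c (param c x) v))].

Definition smooth_form2 (S : set T) (w : T -> V -> V -> R) : Prop :=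
  [/\ forall p, ~ S p -> w p = fun _ _ => 0,
      forall p, S p -> (forall v, scalar (w p v)) /\ (forall v, w p v v = 0),
      forall p, S p -> forall v, scalar (w p ^~ v) &
      forall (c : chart A) (v1 v2 : V),
        smooth_on (coord c @` (cdom c `&` S))
          (fun x => w (param c x) (tvec c (param c x) v1)
                                  (tvec c (param c x) v2))].

(* d a (v, w) = D_v (a w) - D_w (a v) for vector fields v, w with constant
   coefficients in the chart pref A p. *)
Definition dform1 (a : T -> V -> R) (p : T) (v w : V) : R :=
  let c := pref A p in
  let rep (z x : V) := a (param c x) (tvec c (param c x) z) in
  deriv_in (region c) (rep w) (coord c p) v
    - deriv_in (region c) (rep v) (coord c p) w.

End Charts.

Section Maps.
Context {T T' : topologicalType} {m m' : nat}.
Context (A : atlas T m) (B : atlas T' m') (f : T -> T').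

Definition tmap (p : T) (v : 'rV[R]_m.+1) : 'rV[R]_m'.+1 :=
  let c := pref A p in
  deriv_in (region c) (coord (pref B (f p)) \o f \o param c) (coord c p) v.

Definition smooth_map : Prop :=
  continuous f /\
  forall (c : chart A) (c' : chart B),
    smooth_on (coord c @` (cdom c `&` f @^-1` cdom c'))
              (coord c' \o f \o param c).

End Maps.

(* Contact forms and cooriented contact structures on a manifold K contained in
   T, of dimension 2n + 1. *)
Section Contact.
Context {T : topologicalType} {n : nat} (K : set T) (A : atlas T n.*2).
Local Notation V := 'rV[R]_(n.*2).+1.

(* a /\ (d a)^n, as an element of top degree *)
Definition contact_vol (a : T -> V -> R) (p : T) : covec (V := V) (n.*2).+1 :=
  wedge (covec1 (a p)) (wedge_exp (dform1 A a p) n).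

(* S is an open subset of K. *)
Definition contact_form (S : set T) (a : T -> V -> R) : Prop :=
  smooth_form1 A S a /\ forall p, S p -> exists v, contact_vol a p v != 0.

(* A hyperplane of each T_p K, together with one of its two sides. *)
Record cohyp := Cohyp { hyper : T -> set V; side : T -> set V }.

Definition cooriented_kernel (S : set T) (a : T -> V -> R) (xi : cohyp) :=
  forall p, S p -> hyper xi p = [set v | a p v = 0]
                   /\ side xi p = [set v | 0 < a p v].

(* The values outside K are irrelevant, and normalized to be empty. *)
Definition contact_structure (xi : cohyp) : Prop :=
  (forall p, ~ K p -> hyper xi p = set0 /\ side xi p = set0) /\
  forall p, K p -> exists (U : set T) a,
    [/\ open U, U p, contact_form (K `&` U) a
      & cooriented_kernel (K `&` U) a xi].

Definition positive_equation (xi : cohyp) (a : T -> V -> R) : Prop :=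
  smooth_form1 A K a /\ cooriented_kernel K a xi.

End Contact.

End Atlas.

Arguments cohyp R T n : clear implicits.

(* Second countability is a consequence of compactness. *)
Record domain (R : realType) (m : nat) := Domain {
  space :> topologicalType;
  charts : @atlas R space m;
  domain_hausdorff : hausdorff_space space;
  domain_compact : compact [set: space];
  cdom_open : forall c : chart charts, open (cdom c);
  region_open : forall c : chart charts,
    exists2 O, open O & region c = O `&` @halfspace R m;
  coordK : forall (c : chart charts) p, cdom c p -> param c (coord c p) = p;
  coord_continuous : forall c : chart charts,
    {within cdom c, continuous (coord c)};
  param_continuous : forall c : chart charts,
    {within region c, continuous (param c)};
  transition_smooth : forall c c' : chart charts,
    smooth_on (coord c @` (cdom c `&` cdom c')) (coord c' \o param c);
  pref_dom : forall p : space, cdom (pref charts p) p }.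

Section Domain.
Context {R : realType} {m : nat} (F : domain R m).

(* The condition does not depend on the chart at p. *)
Definition bd : set F :=
  [set p | coord (pref (charts F) p) p ord0 ord0 = 0].

Definition Int : set F := ~` bd.

Local Notation V := 'rV[R]_m.+1.

Definition boundary_function (u : F -> R) : Prop :=
  [/\ smooth_fun (charts F) setT u, forall p, 0 <= u p,
      forall p, u p = 0 <-> bd p &
      forall p, bd p -> exists v, differential (charts F) u p v != 0].

(* The first coordinate is nonnegative and vanishes on the boundary. *)
Definition outward (v : V) : Prop := v ord0 ord0 < 0.

Definition diffeomorphism (f : F -> F) : Prop :=
  smooth_map (charts F) (charts F) f /\
  exists g : F -> F,
    [/\ smooth_map (charts F) (charts F) g, cancel f g & cancel g f].

Definition preserves (omega : F -> V -> V -> R) (f : F -> F) : Prop :=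
  f @` Int = Int /\
  forall p, Int p -> forall v1 v2,
    omega (f p) (tmap (charts F) (charts F) f p v1)
                (tmap (charts F) (charts F) f p v2) = omega p v1 v2.

End Domain.

Arguments bd {R m} F.
Arguments Int {R m} F.

Section Boundary.
Context {R : realType} {m : nat} (F : domain R m.+1).
Local Notation V := 'rV[R]_m.+2.
Local Notation VK := 'rV[R]_m.+1.

(* The boundary as a manifold, with the charts of F restricted to it, the first
   coordinate (which is 0 there) being dropped. *)
Definition bd_atlas : @atlas R F m := Atlas
  (fun c : chart (charts F) => cdom c `&` bd F)
  (fun c p => \row_j coord c p ord0 (lift ord0 j))
  (fun c (y : VK) =>
     param c (\row_i if unlift ord0 i is Some j then y ord0 j else 0))
  (pref (charts F)).

Definition tincl (p : F) : VK -> V := tmap bd_atlas (charts F) id p.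

Definition restr_form1 (a : F -> V -> R) (p : F) (v : VK) : R :=
  if `[< bd F p >] then a p (tincl p v) else 0.

Definition conormal_section (s : F -> V -> R) : Prop :=
  [/\ forall p, ~ bd F p -> s p = fun=> 0,
      forall p, bd F p -> scalar (s p),
      forall p, bd F p -> forall v, s p (tincl p v) = 0 &
      forall (c : chart (charts F)) (v : V),
        smooth_on (@region R F m bd_atlas c)
          (fun y => let p := @param R F m bd_atlas c y in s p (tvec c p v))].

Definition negative_section (s : F -> V -> R) : Prop :=
  conormal_section s /\ forall p, bd F p -> forall v, outward v -> s p v < 0.

Definition conormal_differential (u : F -> R) (p : F) (v : V) : R :=
  if `[< bd F p >] then differential (charts F) u p v else 0.

End Boundary.

(* F has dimension 2n + 2: a symplectic form forces the dimension to be even,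
   and K has dimension 2n + 1. *)
Section Liouville.
Context {R : realType} {n : nat} (F : domain R (n.*2).+1).
Local Notation V := 'rV[R]_(n.*2).+2.
Local Notation VK := 'rV[R]_(n.*2).+1.
Local Notation K := (bd F).

(* l is a primitive of omega, u a defining function, and b the extension to F of
   u l, whose restriction to K is a contact form. *)
Definition liouville_data (omega : F -> V -> V -> R)
    (l : F -> V -> R) (u : F -> R) (b : F -> V -> R) : Prop :=
  [/\ smooth_form1 (charts F) (Int F) l
        /\ (forall p, Int F p -> dform1 (charts F) l p = omega p),
      boundary_function u,
      smooth_form1 (charts F) setT b,
      forall p, Int F p -> forall v, b p v = u p * l p v &
      contact_form (bd_atlas F) K (restr_form1 b)].

(* Closedness of omega follows from the existence of a primitive. *)
Definition ideal_liouville (omega : F -> V -> V -> R) : Prop :=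
  [/\ smooth_form2 (charts F) (Int F) omega,
      forall p, Int F p -> forall v, v != 0 -> exists v', omega p v v' != 0 &
      exists l u b, liouville_data omega l u b].

(* Positive bases of T_p F for the orientation of F given by omega^(n+1). At a
   boundary point, where omega is not defined, the orientation is determined by
   continuity from the interior, extending the basis with constant coefficients
   in the chart at p. *)
Definition positive_frame (omega : F -> V -> V -> R) (p : F)
    (e : 'I_(n.*2).+2 -> V) : Prop :=
  \forall q \near p, Int F q ->
    0 < wedge_exp (omega q) n.+1 (fun i => tvec (pref (charts F) p) q (e i)).

(* The convention is outward vector first. *)
Definition positive_boundary_frame (omega : F -> V -> V -> R) (p : F)
    (e : 'I_(n.*2).+1 -> VK) : Prop :=
  forall v : V, outward v ->
    positive_frame omega p
      (fun i => if unlift ord0 i is Some j then tincl p (e j) else v).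

Definition positive_contact_structure (omega : F -> V -> V -> R)
    (xi : cohyp R F n) : Prop :=
  contact_structure K (bd_atlas F) xi /\
  forall (U : set F) (a : F -> VK -> R),
    open U -> contact_form (bd_atlas F) (K `&` U) a ->
    cooriented_kernel (K `&` U) a xi ->
    forall p, K p -> U p -> forall e : 'I_(n.*2).+1 -> VK,
      0 < contact_vol (bd_atlas F) a p e <-> positive_boundary_frame omega p e.

Definition leaves_invariant (f : F -> F) (xi : cohyp R F n) : Prop :=
  forall p, K p ->
    [/\ K (f p),
        tmap (bd_atlas F) (bd_atlas F) f p @` hyper xi p = hyper xi (f p) &
        tmap (bd_atlas F) (bd_atlas F) f p @` side xi p = side xi (f p)].

End Liouville.

(* Main.v *)
From HB Require Import structures.
From mathcomp Require Import all_boot all_order all_algebra all_fingroup.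
From mathcomp Require Import boolp classical_sets functions reals.
From mathcomp Require Import topology normedtype landau derive.
From mathcomp Require Import ring lra.
Require Import Defs.

Set Implicit Arguments.
Unset Strict Implicit.
Unset Printing Implicit Defensive.

Import Order.TTheory GRing.Theory Num.Theory.
Import numFieldNormedType.Exports.

Local Open Scope classical_set_scope.
Local Open Scope ring_scope.


(** Let l be a primitive of omega, u a defining function of the boundary K and
    b = u l. On the interior omega = d(b / u), that is
      u^2 omega = u db + b /\ du,
    and the right-hand side is smooth up to K, where it equals b /\ du. Everything
    follows from this remark.

    The contact structure is determined by omega. Let f preserve omega; the case
    f = id is already of interest. Take two choices (u, b) and (u', b'). Then
    u' o f = h u near K with h > 0, hence f^*(b' /\ du') = h^2 b /\ du and
    f^*du' = h du on K, and contracting with a transverse vector leaves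
    f^*b' = h b on TK (comparison). To have only first derivatives at a point of K
    to deal with, h is obtained as the limit of the quotient of u' o f by u along a
    curve entering the interior. For f = id this gives the uniqueness of the
    kernel xi of b on TK, and for a diffeomorphism f the invariance of xi.

    Equations and conormal sections. By the case f = id again, g b |-> g du does
    not depend on the choice of (u, b). It maps the positive equations of xi
    bijectively to the negative sections, because du is a negative section and
    any other one is g du with g > 0 (equation_section).

    Positivity. If Om = u^2 omega and v is outward, the contraction of Om^(n+1)
    with v is (n+1) (Om v) /\ Om^n. On vectors killed by du it is divisible by
    u^n, and the quotient tends to - (n+1) du(v) b /\ db^n on K (volume_limit);
    here - du(v) > 0, so the orientations agree. Another equation of xi is g b, and
    its contact volume is g^(n+1) times that of b (contact_vol_scale).

    These computations are made in charts. The forms being given at each point in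
    a preferred chart, one needs that d commutes with changes of charts at
    interior points (chart_d_change), hence the symmetry of second derivatives
    (derive_symmetric), and that the boundary does not depend on the chart
    (coord0_change). *)

(** * Exterior powers of a bilinear form *)

Section Alternation.
Context {R : realType}.

Section AnyType.
Context {V : Type}.

Definition alternation k (g : @covec R V k) : covec k :=
  fun v => \sum_(s : 'S_k) (-1) ^+ s * g (v \o s).

Definition tensor k l (a : @covec R V k) (b : covec l) : covec (k + l) :=
  fun v => a (v \o @lshift k l) * b (v \o @rshift k l).

Lemma wedgeE k l (a : @covec R V k) (b : covec l) :
  wedge a b = fun v => ((k`! * l`!)%:R)^-1 * alternation (tensor a b) v.
Proof.
apply: funext => v; rewrite /wedge /alternation /tensor; congr (_ * _).
by apply: eq_bigr => s _; rewrite mulrA.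
Qed.

Definition antisymmetric k (f : @covec R V k) :=
  forall (v : 'I_k -> V) (s : 'S_k), f (v \o s) = (-1) ^+ s * f v.

Lemma alternation_antisymmetric k (g : @covec R V k) :
  antisymmetric (alternation g).
Proof.
move=> v s; rewrite /alternation mulr_sumr [RHS](reindex_inj (mulIg s)) /=.
apply: eq_bigr => t _; rewrite odd_permM signr_addb.
rewrite [(-1) ^+ t * _ in RHS]mulrC -mulrA signrMK; congr (_ * g _).
by apply: funext => i /=; rewrite permM.
Qed.

Lemma wedge_antisymmetric k l (a : @covec R V k) (b : covec l) :
  antisymmetric (wedge a b).
Proof.
by move=> v s; rewrite wedgeE alternation_antisymmetric mulrCA.
Qed.

Lemma antisymmetric_eq0 k (f : @covec R V k) (v : 'I_k -> V) i j :
  antisymmetric f -> i != j -> v i = v j -> f v = 0.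
Proof.
move=> fA ij vij; have /esym := fA v (tperm i j).
rewrite (_ : v \o _ = v); last first.
  by apply: funext => k' /=; case: tpermP => [->|->|].
rewrite odd_tperm ij expr1 mulN1r => /eqP.
by rewrite eq_sym -addr_eq0 -mulr2n mulrn_eq0 => /eqP.
Qed.

Lemma perm_extend k l (t : 'S_l) : exists t' : 'S_(k + l),
  [/\ t' = t :> bool, forall i, t' (@lshift k l i) = lshift l i
    & forall j, t' (@rshift k l j) = rshift k (t j)].
Proof.
elim: k => [|k [t' [t'o t'l t'r]]].
  exists t; split=> // [[]//|j]; rewrite (_ : rshift 0 j = j); last exact: val_inj.
  exact/val_inj.
exists (lift_perm ord0 ord0 t' : 'S_(k.+1 + l)); split=> [|i|j].
- by rewrite odd_lift_perm t'o.
- have [i'|] := unliftP ord0 i => ->.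
    have -> : lshift l (lift ord0 i') = lift ord0 (lshift l i') :> 'I_(k + l).+1.
      exact: val_inj.
    by rewrite lift_perm_lift t'l.
  have -> : lshift l (ord0 : 'I_k.+1) = ord0 :> 'I_(k + l).+1 by exact: val_inj.
  by rewrite lift_perm_id.
- have -> : rshift k.+1 j = lift ord0 (rshift k j) :> 'I_(k + l).+1.
    exact: val_inj.
  rewrite lift_perm_lift t'r; exact: val_inj.
Qed.

(** A permutation of the last l slots extends to all slots with the same sign,
    and is absorbed by the outer alternation. *)
Lemma alternation_tensorr k l (a : @covec R V k) (g : covec l) v :
  alternation (tensor a (alternation g)) v = l`!%:R * alternation (tensor a g) v.
Proof.
rewrite /alternation /tensor.
under eq_bigr do rewrite !mulr_sumr.
rewrite exchange_big /= (eq_bigr (fun=> alternation (tensor a g) v)); last first.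
  move=> t _; have [t' [t'o t'l t'r]] := @perm_extend k l t.
  rewrite /alternation [RHS](reindex_inj (mulgI t')) /=.
  apply: eq_bigr => s _; rewrite odd_permM t'o signr_addb /tensor.
  have -> : (v \o (t' * s)%g) \o @lshift k l = (v \o s) \o @lshift k l.
    by apply: funext => i /=; rewrite permM t'l.
  have -> : (v \o (t' * s)%g) \o @rshift k l = ((v \o s) \o @rshift k l) \o t.
    by apply: funext => i /=; rewrite permM t'r.
  by rewrite -mulrA [RHS]mulrCA; congr (_ * _); exact: mulrCA.
by rewrite sumr_const card_Sn mulr_natl.
Qed.

Fixpoint pair_product (b : V -> V -> R) (n : nat) : @covec R V n.*2 :=
  if n is n'.+1 then tensor (covec2 b) (@pair_product b n') else fun=> 1.
Arguments pair_product b n : clear implicits.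

Lemma pair_productS b n w : pair_product b n.+1 w =
  covec2 b (w \o @lshift 2 n.*2) * pair_product b n (w \o @rshift 2 n.*2).
Proof. by []. Qed.

(** All the alternations of the iterated wedge product collapse into one. For b
    antisymmetric the right-hand side is n! times the Pfaffian of b on v. *)
Lemma wedge_expE (b : V -> V -> R) n v :
  wedge_exp b n v = 2^-1 ^+ n * alternation (pair_product b n) v.
Proof.
elim: n v => [|n IH] v.
  rewrite expr0 mul1r /= /alternation.
  rewrite (eq_bigr (fun=> 1)) ?sumr_const ?card_Sn// => s _.
  have -> : s = 1%g by apply/permP => -[].
  by rewrite odd_perm1 mulr1.
rewrite /= wedgeE.
have -> : tensor (covec2 b) (wedge_exp b n) =
    fun v => 2^-1 ^+ n * tensor (covec2 b) (alternation (pair_product b n)) v.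
  by apply: funext => w; rewrite /tensor IH mulrCA.
have -> : alternation (fun v => 2^-1 ^+ n *
      tensor (covec2 b) (alternation (pair_product b n)) v) v =
    2^-1 ^+ n * alternation (tensor (covec2 b) (alternation (pair_product b n))) v.
  by rewrite /alternation mulr_sumr; apply: eq_bigr => s _; rewrite mulrCA.
rewrite alternation_tensorr natrM (_ : 2`! = 2)%N// invfM.
have : (n.*2)`!%:R != 0 :> R by rewrite pnatr_eq0 -lt0n fact_gt0.
by move=> h; rewrite exprS; field.
Qed.

Lemma wedge1_expE (a : V -> R) (b : V -> V -> R) n v :
  wedge (covec1 a) (wedge_exp b n) v =
  2^-1 ^+ n * alternation (tensor (covec1 a) (pair_product b n)) v.
Proof.
rewrite wedgeE.
have -> : tensor (covec1 a) (wedge_exp b n) =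
    fun v => 2^-1 ^+ n * tensor (covec1 a) (alternation (pair_product b n)) v.
  by apply: funext => w; rewrite /tensor wedge_expE mulrCA.
have -> : alternation (fun v => 2^-1 ^+ n *
      tensor (covec1 a) (alternation (pair_product b n)) v) v =
    2^-1 ^+ n * alternation (tensor (covec1 a) (alternation (pair_product b n))) v.
  by rewrite /alternation mulr_sumr; apply: eq_bigr => s _; rewrite mulrCA.
rewrite alternation_tensorr (_ : 1`! = 1)%N// mul1n.
have : (n.*2)`!%:R != 0 :> R by rewrite pnatr_eq0 -lt0n fact_gt0.
by move=> h; field.
Qed.

Definition vcons k (v0 : V) (e : 'I_k -> V) : 'I_k.+1 -> V :=
  fun i => if unlift ord0 i is Some j then e j else v0.

Lemma vcons0 k v0 (e : 'I_k -> V) : vcons v0 e ord0 = v0.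
Proof. by rewrite /vcons unlift_none. Qed.

Lemma vconsS k v0 (e : 'I_k -> V) j : vcons v0 e (lift ord0 j) = e j.
Proof. by rewrite /vcons liftK. Qed.

(** The place 0 is moved to k by permuting the pairs, which is even and keeps
    the product, and possibly by an exchange inside a pair, which is odd and
    changes its sign. *)
Lemma pair_product_perm (b : V -> V -> R) n (k : 'I_(n.+1).*2) :
  (forall x y, b x y = - b y x) ->
  exists2 s : 'S_(n.+1).*2, s ord0 = k &
    forall w, pair_product b n.+1 (w \o s) = (-1) ^+ s * pair_product b n.+1 w.
Proof.
move=> bA; elim: n k => [|n IH] k.
  have [->|->] : k = ord0 \/ k = lift ord0 ord0.
  - by case: k => [[|[|//]] i]; [left|right]; exact: val_inj.
  - exists 1%g; first by rewrite perm1.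
    move=> w; rewrite odd_perm1 mul1r; congr (pair_product _ _ _).
    by apply: funext => i /=; rewrite perm1.
  - exists (tperm ord0 (lift ord0 ord0)); first by rewrite tpermL.
    move=> w; rewrite odd_tperm expr1 /= /tensor /covec2 /= !mulr1 mulN1r bA.
    by congr (- b (w _) (w _)); apply: val_inj; rewrite permE.
pose i0 : 'I_(n.+2).*2 := ord0.
pose i1 : 'I_(n.+2).*2 := lift ord0 ord0.
pose i2 : 'I_(n.+2).*2 := @rshift 2 (n.+1).*2 ord0.
pose i3 : 'I_(n.+2).*2 := @rshift 2 (n.+1).*2 (lift ord0 ord0).
have pairE w : pair_product b n.+2 w = b (w i0) (w i1) * (b (w i2) (w i3) *
    pair_product b n (w \o @rshift 2 (n.+1).*2 \o @rshift 2 n.*2)).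
  rewrite /= /tensor /covec2 /=.
  by congr (b (w _) (w _) * (b (w _) (w _) * _)); exact: val_inj.
have [[k' kE]|[->|->]] : (exists k' : 'I_(n.+1).*2, k = @rshift 2 (n.+1).*2 k') \/
    (k = i0 \/ k = i1).
(* A place outside the first pair is reached by induction, after exchanging
   the first two pairs. *)
- case: (ltnP k 2) => [k2|k2].
    by right; case: k k2 => [[|[|//]] i] _; [left|right]; exact: val_inj.
  left; have kn : (k - 2 < (n.+1).*2)%N by rewrite ltn_subLR// -doubleS.
  by exists (Ordinal kn); apply: val_inj; rewrite /= subnKC.
- have [s' s'0 s'P] := IH k'.
  have [s [so sl sr]] := @perm_extend 2 (n.+1).*2 s'.
  have sP w : pair_product b n.+2 (w \o s) = (-1) ^+ s * pair_product b n.+2 w.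
    rewrite so !(@pair_productS b n.+1).
    have -> : (w \o s) \o @lshift 2 (n.+1).*2 = w \o @lshift 2 (n.+1).*2.
      by apply: funext => i /=; rewrite sl.
    have -> : (w \o s) \o @rshift 2 (n.+1).*2 = (w \o @rshift 2 (n.+1).*2) \o s'.
      by apply: funext => i /=; rewrite sr.
    by rewrite s'P mulrCA.
  exists (tperm i0 i2 * tperm i1 i3 * s)%g.
    by rewrite !permM tpermL (tpermD _ _ : tperm i1 i3 i2 = i2)// sr s'0 kE.
  move=> w; rewrite odd_permM odd_mul_tperm odd_tperm addFb.
  have -> : w \o (tperm i0 i2 * tperm i1 i3 * s)%g =
      (w \o s) \o (tperm i0 i2 * tperm i1 i3)%g.
    by apply: funext => i /=; rewrite permM.
  rewrite -sP pairE /= !permM tpermL tpermR (tpermD _ _ : tperm i1 i3 i2 = i2)//.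
  rewrite (tpermD _ _ : tperm i1 i3 i0 = i0)// (tpermD _ _ : tperm i0 i2 i1 = i1)//.
  rewrite (tpermD _ _ : tperm i0 i2 i3 = i3)// tpermL tpermR.
  rewrite [RHS]pairE /= [LHS]mulrCA; congr (_ * (_ * pair_product _ _ _)).
  apply: funext => i /=; rewrite permM !tpermD//.
- exists 1%g; first by rewrite perm1.
  move=> w; rewrite odd_perm1 mul1r; congr (pair_product _ _ _).
  by apply: funext => i; rewrite /= perm1.
- exists (tperm i0 i1); first by rewrite tpermL.
  move=> w; rewrite odd_tperm expr1 !pairE /= tpermL tpermR bA mulN1r !mulNr.
  by rewrite !(tpermD _ _)//; congr (- (_ * (_ * pair_product _ _ _)));
    apply: funext => i /=; rewrite tpermD.
Qed.

Lemma sum_perm_fix0 k (g : 'S_k.+1 -> R) :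
  \sum_(s : 'S_k.+1 | s ord0 == ord0) g s = \sum_(t : 'S_k) g (lift_perm ord0 ord0 t).
Proof.
rewrite (reindex (fun t => lift_perm ord0 ord0 t)); last first.
  pose lower (s : 'S_k.+1) i := odflt i (unlift (s ord0) (s (lift ord0 i))).
  have lowerK (s : 'S_k.+1) i : lift (s ord0) (lower s i) = s (lift ord0 i).
    rewrite /lower; have := neq_lift ord0 i.
    by rewrite -(can_eq (permK s)) => /unlift_some[] ? ? ->.
  have lower_inj (s : 'S_k.+1) : injective (lower s).
    move=> i j /(congr1 (lift (s ord0))); rewrite !lowerK.
    by move=> /perm_inj/lift_inj.
  exists (fun s => perm (lower_inj s)) => [t _|s].
    by apply/permP => i; rewrite permE /lower lift_perm_lift lift_perm_id liftK.
  move=> /eqP s0; apply/permP => i.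
  have [j|] := unliftP ord0 i => ->; rewrite ?lift_perm_id//.
  by rewrite lift_perm_lift permE -{1}s0 lowerK.
by apply: eq_bigl => t; rewrite lift_perm_id eqxx.
Qed.

(** The contraction of b^(n+1) with v0 is (n+1) (b v0) /\ b^n: in the sum over
    permutations the 2(n+1) possible places of v0 contribute equally. *)
Lemma wedge_exp_cons (b : V -> V -> R) n v0 (e : 'I_(n.*2).+1 -> V) :
  (forall x y, b x y = - b y x) ->
  wedge_exp b n.+1 (vcons v0 e) =
    n.+1%:R * wedge (covec1 (b v0)) (wedge_exp b n) e.
Proof.
move=> bA; rewrite wedge_expE wedge1_expE.
set g := pair_product b n.+1.
pose F (s : 'S_(n.+1).*2) := (-1) ^+ s * g (vcons v0 e \o s).
have Fk k : \sum_(s : 'S_(n.+1).*2 | s k == ord0) F s =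
    \sum_(s : 'S_(n.+1).*2 | s ord0 == ord0) F s.
  have [t t0 tP] := pair_product_perm k bA.
  rewrite [RHS](reindex_inj (mulgI t)); apply: eq_big => [s|s _].
    by rewrite permM t0.
  rewrite /F odd_permM signr_addb -mulrA.
  have -> : vcons v0 e \o (t * s)%g = (vcons v0 e \o s) \o t.
    by apply: funext => i /=; rewrite permM.
  by rewrite [g (_ \o t)]tP [X in _ = _ * X]mulrCA signrMK.
have -> : alternation g (vcons v0 e) =
    (n.+1).*2%:R * alternation (tensor (covec1 (b v0)) (pair_product b n)) e.
  rewrite /alternation -/F (partition_big (fun s : 'S_(n.+1).*2 => (s^-1)%g ord0) xpredT)//=.
  rewrite (eq_bigr (fun=> \sum_(s : 'S_(n.+1).*2 | s ord0 == ord0) F s)); last first.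
    move=> k _; rewrite -(Fk k); apply: eq_bigl => s.
    by apply/eqP/eqP => [<-|<-]; rewrite ?permKV ?permK.
  rewrite sumr_const card_ord sum_perm_fix0 -[LHS]mulr_natl; congr (_ * _).
  apply: eq_bigr => t _; rewrite /F odd_lift_perm /=; congr (_ * _).
  rewrite /g /= /tensor /covec1 /covec2 /=; congr (b _ _ * _).
  - have -> : @lshift 2 n.*2 ord0 = ord0 :> 'I_(n.+1).*2 by exact: val_inj.
    by rewrite lift_perm_id vcons0.
  - have -> : @lshift 2 n.*2 ord_max = lift ord0 ord0 :> 'I_(n.+1).*2 by exact: val_inj.
    rewrite lift_perm_lift vconsS; congr (e (t _)); exact: val_inj.
  - congr (pair_product _ _ _); apply: funext => i /=.
    have -> : @rshift 2 n.*2 i = lift ord0 (@rshift 1 n.*2 i) :> 'I_(n.+1).*2.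
      exact: val_inj.
    by rewrite lift_perm_lift vconsS.
rewrite exprS -muln2 natrM; set A := alternation _ _; set p := _ ^+ n.
have h2 : (2 : R) != 0 by rewrite pnatr_eq0.
by field.
Qed.

End AnyType.
End Alternation.

(** * Alternating multilinear forms *)

Section Multilinear.
Context {R : realType}.

Lemma wedge_exp_congr (V V' : Type) (b : V -> V -> R) (b' : V' -> V' -> R)
    n (v : 'I_n.*2 -> V) (v' : 'I_n.*2 -> V') :
  (forall i j, b (v i) (v j) = b' (v' i) (v' j)) ->
  wedge_exp b n v = wedge_exp b' n v'.
Proof.
elim: n v v' => [//|n IH] v v' h; rewrite /= /wedge; congr (_ * _).
apply: eq_bigr => s _; congr (_ * _ * _); first exact: h.
exact: IH.
Qed.

Lemma wedge_expZ (V : Type) (c : R) (b : V -> V -> R) n v :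
  wedge_exp (fun x y => c * b x y) n v = c ^+ n * wedge_exp b n v.
Proof.
elim: n v => [|n IH] v /=; first by rewrite mul1r.
rewrite /wedge [RHS]mulrCA; congr (_ * _); rewrite mulr_sumr; apply: eq_bigr => s _.
rewrite IH /covec2 exprS; set x := b _ _; set y := wedge_exp _ _ _.
set z := c ^+ n; set t := (-1) ^+ _; by ring.
Qed.

Lemma wedge1_exp_congr (V V' : Type) (a : V -> R) (b : V -> V -> R)
    (a' : V' -> R) (b' : V' -> V' -> R)
    n (v : 'I_(n.*2).+1 -> V) (v' : 'I_(n.*2).+1 -> V') :
  (forall i, a (v i) = a' (v' i)) ->
  (forall i j, b (v i) (v j) = b' (v' i) (v' j)) ->
  wedge (covec1 a) (wedge_exp b n) v = wedge (covec1 a') (wedge_exp b' n) v'.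
Proof.
move=> ha hb; rewrite /wedge; congr (_ * _).
apply: eq_bigr => s _; congr (_ * _ * _); first exact: ha.
by apply: wedge_exp_congr => i j; apply: hb.
Qed.

Lemma wedge1_expZ (V : Type) (a : V -> R) c (b : V -> V -> R) n v :
  wedge (covec1 a) (wedge_exp (fun x y => c * b x y) n) v =
  c ^+ n * wedge (covec1 a) (wedge_exp b n) v.
Proof.
rewrite /wedge [RHS]mulrCA; congr (_ * _); rewrite mulr_sumr; apply: eq_bigr => s _.
by rewrite wedge_expZ mulrCA.
Qed.

Lemma wedge1Z (V : Type) (a : V -> R) c l (B : covec l) v :
  wedge (covec1 (fun x => c * a x)) B v = c * wedge (covec1 a) B v.
Proof.
rewrite /wedge [RHS]mulrCA; congr (_ * _); rewrite mulr_sumr; apply: eq_bigr => s _.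
by rewrite /covec1 mulrCA !mulrA.
Qed.

Section Limits.
Context {T : Type} {F : set_system T} {FF : Filter F} {V V' : Type}.

Lemma wedge_cvg k l (a : T -> @covec R V k) (b : T -> covec l)
    (w : T -> 'I_(k + l) -> V) (A : @covec R V' k) (B : covec l)
    (v : 'I_(k + l) -> V') :
  (forall s : 'S_(k + l), a t (fun i => w t (s (lshift l i))) @[t --> F]
     --> A (fun i => v (s (lshift l i)))) ->
  (forall s : 'S_(k + l), b t (fun i => w t (s (rshift k i))) @[t --> F]
     --> B (fun i => v (s (rshift k i)))) ->
  wedge (a t) (b t) (w t) @[t --> F] --> wedge A B v.
Proof.
move=> ha hb; rewrite /wedge; apply: cvgM; first exact: cvg_cst.
apply: cvg_big => [|s _]; first exact: add_continuous.
by apply: cvgM; [apply: cvgM; [exact: cvg_cst|exact: ha]|exact: hb].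
Qed.

Lemma wedge_exp_cvg (b : T -> V -> V -> R) (B : V' -> V' -> R) n
    (w : T -> 'I_n.*2 -> V) (v : 'I_n.*2 -> V') :
  (forall i j, b t (w t i) (w t j) @[t --> F] --> B (v i) (v j)) ->
  wedge_exp (b t) n (w t) @[t --> F] --> wedge_exp B n v.
Proof.
elim: n w v => [|n IH] w v h; first exact: cvg_cst.
apply: wedge_cvg => s; first exact: h.
exact: IH.
Qed.

Lemma wedge1_exp_cvg (a : T -> V -> R) (b : T -> V -> V -> R) (A : V' -> R)
    (B : V' -> V' -> R) n
    (w : T -> 'I_(n.*2).+1 -> V) (v : 'I_(n.*2).+1 -> V') :
  (forall i, a t (w t i) @[t --> F] --> A (v i)) ->
  (forall i j, b t (w t i) (w t j) @[t --> F] --> B (v i) (v j)) ->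
  wedge (covec1 (a t)) (wedge_exp (b t) n) (w t) @[t --> F] -->
    wedge (covec1 A) (wedge_exp B n) v.
Proof.
move=> ha hb; apply: wedge_cvg => s; first exact: ha.
by apply: wedge_exp_cvg => i j; exact: hb.
Qed.

End Limits.

Section Lmodule.
Context {V : lmodType R}.

Definition update k (v : 'I_k -> V) i x : 'I_k -> V :=
  fun j => if j == i then x else v j.

Definition multilinear k (f : @covec R V k) :=
  forall v i, scalar (fun x => f (update v i x)).

Lemma update_id k (v : 'I_k -> V) i : update v i (v i) = v.
Proof. by apply: funext => j; rewrite /update; case: eqP => // ->. Qed.

Lemma scalar0 (U : lmodType R) (f : U -> R) : scalar f -> f 0 = 0.
Proof.
by move=> fl; have := fl (-1) 0 0; rewrite scaler0 addr0 mulN1r addNr.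
Qed.

Lemma scalarZ (U : lmodType R) (f : U -> R) c x : scalar f -> f (c *: x) = c * f x.
Proof. by move=> fl; rewrite -[c *: x]addr0 fl scalar0// addr0. Qed.

Lemma scalarD (U : lmodType R) (f : U -> R) x y : scalar f -> f (x + y) = f x + f y.
Proof. by move=> fl; rewrite -[x]scale1r fl mul1r scale1r. Qed.

Lemma scalar_sum (U : lmodType R) (f : U -> R) (I : Type) (r : seq I) (P : pred I)
    (c : I -> R) (e : I -> U) : scalar f ->
  f (\sum_(i <- r | P i) c i *: e i) = \sum_(i <- r | P i) c i * f (e i).
Proof.
move=> fl; elim/big_rec2 : _ => [|i y x _ <-]; first exact: scalar0.
by rewrite fl.
Qed.

Lemma tensor_multilinear k l (a : @covec R V k) (b : covec l) :
  multilinear a -> multilinear b -> multilinear (tensor a b).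
Proof.
move=> ha hb v i c x y; rewrite /tensor.
have [i'|i'] := fintype.splitP i => iE.
  have iE' : i = lshift l i' by exact: val_inj.
  have ul z : update v i z \o @lshift k l = update (v \o @lshift k l) i' z.
    by apply: funext => j; rewrite /update /= iE' (inj_eq (@lshift_inj _ _)).
  have ur z : update v i z \o @rshift k l = v \o @rshift k l.
    by apply: funext => j; rewrite /update /= iE' eq_rlshift.
  by rewrite !ul !ur ha mulrDl mulrA.
have iE' : i = rshift k i' by exact: val_inj.
have ul z : update v i z \o @rshift k l = update (v \o @rshift k l) i' z.
  by apply: funext => j; rewrite /update /= iE' (inj_eq (@rshift_inj _ _)).
have ur z : update v i z \o @lshift k l = v \o @lshift k l.
  by apply: funext => j; rewrite /update /= iE' eq_lrshift.
by rewrite !ul !ur hb mulrDr mulrCA.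
Qed.

Lemma alternation_multilinear k (g : @covec R V k) :
  multilinear g -> multilinear (alternation g).
Proof.
move=> hg v i c x y; rewrite /alternation mulr_sumr -big_split /=.
apply: eq_bigr => s _.
have us z : update v i z \o s = update (v \o s) (s^-1%g i) z.
  apply: funext => j; rewrite /update /=.
  by rewrite -(inj_eq (@perm_inj _ s^-1%g)) permK.
by rewrite !us hg mulrDr mulrCA.
Qed.

Lemma wedge_multilinear k l (a : @covec R V k) (b : covec l) :
  multilinear a -> multilinear b -> multilinear (wedge a b).
Proof.
move=> ha hb v i c x y; rewrite wedgeE.
have /alternation_multilinear -> := tensor_multilinear ha hb.
by rewrite mulrDr mulrCA.
Qed.

Lemma covec1_multilinear (a : V -> R) : scalar a -> multilinear (covec1 a).
Proof. by move=> al v i c x y; rewrite /covec1 /update !ord1 eqxx al. Qed.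

Definition bilinear (b : V -> V -> R) :=
  (forall x, scalar (b x)) /\ (forall y, scalar (b^~ y)).

Lemma wedge_exp_multilinear (b : V -> V -> R) n :
  bilinear b -> multilinear (wedge_exp b n).
Proof.
move=> [bl br]; elim: n => [|n IH]; first by move=> v [].
apply: (@wedge_multilinear 2 n.*2 (covec2 b)) => // v i c x y; rewrite /covec2 /update.
have [->|->] : i = ord0 \/ i = ord_max.
  by case: i => [[|[|//]] i]; [left|right]; exact: val_inj.
- by rewrite /= br.
- by rewrite /= bl.
Qed.

Lemma dependent_eq0 k (f : @covec R V k) (e : 'I_k -> V) (c : 'I_k -> R) i0 :
  multilinear f -> antisymmetric f ->
  c i0 != 0 -> \sum_i c i *: e i = 0 -> f e = 0.
Proof.
move=> fm fa ci0 ce0.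
have ei0 : e i0 = \sum_(j | j != i0) (- (c i0)^-1 * c j) *: e j.
  move: ce0; rewrite (bigD1 i0)//= => /eqP; rewrite addr_eq0 => /eqP ce0.
  rewrite -[LHS]scale1r -(mulVf ci0) -scalerA ce0 scalerN -scaleNr scaler_sumr.
  by apply: eq_bigr => j _; rewrite scalerA.
rewrite -(update_id e i0) ei0 (scalar_sum _ _ _ _ (fm e i0)) big1// => j ji0.
rewrite (antisymmetric_eq0 (i := i0) (j := j)) ?mulr0//; first by rewrite eq_sym.
by rewrite /update eqxx (negbTE ji0).
Qed.

(** Expanding the vectors of w in e, one slot after the other, leaves the values
    of f on rearrangements of e. *)
Lemma top_form_eq0 k (f : @covec R V k) (e : 'I_k -> V) :
  multilinear f -> antisymmetric f ->
  (forall x, exists c : 'I_k -> R, x = \sum_j c j *: e j) ->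
  f e = 0 -> forall w, f w = 0.
Proof.
move=> fm fa espan fe0 w.
suff H m : (m <= k)%N -> forall w, (forall i : 'I_k, (m <= i)%N -> exists j, w i = e j) ->
    f w = 0.
  by apply: (H k) => // i; rewrite leqNgt ltn_ord.
elim: m => [_ {}w wE|m IH mk {}w wE].
  have {}wE i : exists j, w i = e j by exact: wE.
  have [s sE] := choice wE.
  have [s_inj|] := pselect (injective s).
    rewrite (_ : w = e \o perm s_inj); last by apply: funext => i; rewrite /= permE.
    by rewrite fa fe0 mulr0.
  move/existsNP => [i /existsNP[j /not_implyP[sij /eqP ij]]].
  by rewrite (antisymmetric_eq0 fa ij)// !sE sij.
pose i := Ordinal mk; have [c wi] := espan (w i).
rewrite -(update_id w i) wi (scalar_sum _ _ _ _ (fm w i)) big1// => j _.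
rewrite IH ?mulr0//; first exact: ltnW.
move=> i'; rewrite leq_eqVlt /update => /predU1P[ii'|mi'].
  by exists j; case: eqP => // /eqP; rewrite -val_eqE /= ii' eqxx.
by case: eqP => [_|_]; [exists j|exact: wE].
Qed.

(** Each vector added puts v i0 in two different slots. *)
Lemma transvection k (f : @covec R V k) (v : 'I_k -> V) (c : 'I_k -> R) i0 :
  multilinear f -> antisymmetric f -> c i0 = 0 ->
  f (fun i => v i + c i *: v i0) = f v.
Proof.
move=> fm fa ci0; pose w m (i : 'I_k) := if (i < m)%N then v i + c i *: v i0 else v i.
have wi0 m : w m i0 = v i0 by rewrite /w ci0 scale0r addr0 if_same.
suff H m : (m <= k)%N -> f (w m) = f v.
  by rewrite -(H k)//; congr f; apply: funext => i; rewrite /w ltn_ord.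
elim: m => [_|m IH mk]; first by congr f; apply: funext.
rewrite -IH ?(ltnW mk)//; pose i := Ordinal mk.
have -> : w m.+1 = update (w m) i (c i *: v i0 + w m i).
  apply: funext => j; rewrite /update /w.
  case: eqP => [->|/eqP]; first by rewrite ltnSn ltnn addrC.
  by rewrite -val_eqE /= ltnS leq_eqVlt => /negbTE ->.
rewrite (fm (w m) i) update_id.
have [->|ii0] := eqVneq i i0; first by rewrite ci0 mul0r add0r.
rewrite (antisymmetric_eq0 (i := i) (j := i0)) ?mulr0 ?add0r//.
by rewrite /update eqxx eq_sym (negbTE ii0) wi0.
Qed.

(** Up to transvections, a vanishes on all the vectors of the frame but one, and
    then b enters only through its restriction to the kernel of a. Hence the
    volume a /\ (da)^n of a contact form is multiplied by g^(n+1) when a is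
    multiplied by a function g, without any knowledge of dg. *)
Lemma wedge1_exp_scale (a a' : V -> R) (b b' : V -> V -> R) n (g : R) e :
  scalar a -> bilinear b -> bilinear b' ->
  (forall x, a' x = g * a x) ->
  (forall x y, a x = 0 -> a y = 0 -> b' x y = g * b x y) ->
  wedge (covec1 a') (wedge_exp b' n) e =
    g ^+ n.+1 * wedge (covec1 a) (wedge_exp b n) e.
Proof.
move=> al bl bl' aE bE.
have al' : scalar a' by move=> c x y; rewrite !aE al mulrDr mulrCA.
have fm := wedge_multilinear (covec1_multilinear al) (wedge_exp_multilinear (n := n) bl).
have fm' := wedge_multilinear (covec1_multilinear al') (wedge_exp_multilinear (n := n) bl').
have [|/existsNP[k /eqP ak]] := pselect (forall i, a (e i) = 0).
  move=> a0; rewrite /wedge !big1 ?mulr0// => s _.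
    by rewrite {1}/covec1 a0 mulr0 mul0r.
  by rewrite {1}/covec1 aE a0 mulr0 mulr0 mul0r.
pose c i := if i == k then 0 else - (a (e i) / a (e k)).
have ck : c k = 0 by rewrite /c eqxx.
rewrite -(transvection e fm' (wedge_antisymmetric _ _) ck).
rewrite -(transvection e fm (wedge_antisymmetric _ _) ck).
set e' := fun i => _.
have ae' i : i != k -> a (e' i) = 0.
  move=> /negbTE ik; rewrite /e' /c ik scalarD// scalarZ// mulNr divfK//.
  exact: subrr.
rewrite /wedge [RHS]mulrCA; congr (_ * _); rewrite mulr_sumr; apply: eq_bigr => s _.
rewrite /covec1 aE; set i := s _; have [ik|ik] := eqVneq i k; last first.
  by rewrite ae'// !(mulr0, mul0r).
have -> : wedge_exp b' n (fun j => e' (s (rshift 1 j))) =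
    g ^+ n * wedge_exp b n (fun j => e' (s (rshift 1 j))).
  rewrite -wedge_expZ; apply: wedge_exp_congr => i' j'.
  by apply: bE; apply: ae'; rewrite -ik /i (inj_eq perm_inj) eq_rlshift.
by rewrite exprS; set p := g ^+ n; set q := (-1) ^+ _; set r := wedge_exp _ _ _;
  set t := a _; ring.
Qed.

End Lmodule.

Lemma span_or_dependent k (e : 'I_k -> 'rV[R]_k) :
  (forall x, exists c : 'I_k -> R, x = \sum_j c j *: e j) \/
  (exists2 c : 'I_k -> R, (exists i, c i != 0) & \sum_i c i *: e i = 0).
Proof.
pose E := \matrix_i e i.
have sumE (c : 'rV_k) : \sum_j c ord0 j *: e j = c *m E.
  by rewrite mulmx_sum_row; apply: eq_bigr => j _; rewrite rowK.
have [Eu|] := boolP (E \in unitmx).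
  left=> x; exists (fun j => (x *m invmx E) ord0 j).
  by rewrite sumE mulmxKV.
rewrite -row_free_unit -kermx_eq0 => kE; right.
have /rowV0Pn[c cE c0] := kE; exists (fun i => c ord0 i).
  by have /rV0Pn[i ci0] := c0; exists i.
by rewrite sumE; apply/sub_kermxP.
Qed.

End Multilinear.

(** * One-sided derivatives on subsets of Euclidean space *)

Section OneSided.
Context {R : realType} {m : nat}.
Local Notation V := 'rV[R]_m.+1.

Lemma line_cvg (x v : V) : x + t *: v @[t --> (0 : R)] --> x.
Proof.
rewrite -[X in _ --> X]addr0 -(scale0r v).
by apply: cvgD; [exact: cvg_cst|apply: cvgZ; [exact: cvg_id|exact: cvg_cst]].
Qed.

Lemma near_line (P : set V) (x v : V) :
  (\forall y \near x, P y) -> \forall t \near (0 : R)^', P (x + t *: v).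
Proof.
move=> Px; have Px0 : \forall t \near (0 : R), P (x + t *: v).
  exact: line_cvg.
by apply: (nbhs_dnbhs Px0).
Qed.

Lemma near_line_right (P : set V) (x v : V) :
  (\forall y \near x, P y) -> \forall t \near (0 : R)^'+, P (x + t *: v).
Proof.
move=> Px; have Px0 : \forall t \near (0 : R), P (x + t *: v).
  exact: line_cvg.
by apply: (cvg_at_right_filter (f := id) _ Px0); exact: cvg_id.
Qed.

(** The set A is approached from x in the direction v or in the opposite
    one, so that the derivative along v is determined by the values on A. *)
Definition thick (A : set V) (x : V) := A x /\ forall v : V,
  (\forall t \near (0 : R)^'+, A (x + t *: v)) \/
  (\forall t \near (0 : R)^'+, A (x + t *: (- v))).

Definition along (A : set V) (x v : V) : set_system R :=
  within [set t : R | A (x + t *: v)] 0^'.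

Lemma along_filter A x v : Filter (along A x v).
Proof. exact: within_filter. Qed.

Lemma along_proper A x v : thick A x -> ProperFilter (along A x v).
Proof.
move=> [_ /(_ v) Av]; split; last exact: along_filter.
rewrite /along /within /= => A0.
have {}A0 : \forall t \near (0 : R), t != 0 -> A (x + t *: v) -> False := A0.
suff : \forall t \near (0 : R)^'+, False by exact: filter_not_empty.
case: Av => Av.
  have {}Av : \forall t \near (0 : R), 0 < t -> A (x + t *: v) := Av.
  suff : \forall t \near (0 : R), 0 < t -> False by [].
  apply: filterS2 Av A0 => t At A0t t0.
  by apply: A0t; rewrite ?gt_eqF//; exact: At.
have {}Av : \forall t \near (0 : R), 0 < t -> A (x + t *: - v) := Av.
have {}A0 : \forall t \near (0 : R), - t != 0 -> A (x + (- t) *: v) -> False.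
  have oppc : - t @[t --> (0 : R)] --> (0 : R).
    by rewrite -[X in _ --> X]oppr0; apply: cvgN; exact: cvg_id.
  exact: (oppc _ A0).
suff : \forall t \near (0 : R), 0 < t -> False by [].
apply: filterS2 Av A0 => t At A0t t0.
by apply: A0t; rewrite ?oppr_eq0 ?gt_eqF// scaleNr -scalerN; exact: At.
Qed.


Section Extension.
Context {W : normedModType R}.
Implicit Types (A : set V) (f g : V -> W).

(** Near x, the map f defined on A is the restriction of the map g defined in
    the ambient space. *)
Definition extends_at A f x g :=
  [/\ A x, \forall y \near x, A y -> f y = g y & differentiable g x].

Lemma derive_quotient_cvg g x v : differentiable g x ->
  t^-1 *: (g (x + t *: v) - g x) @[t --> (0 : R)^'] --> ('d g x v : W).
Proof.
move=> dg; have gd : derivable g x v by exact: diff_derivable.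
rewrite -deriveE//; apply: cvg_trans gd.
apply: near_eq_cvg; near=> t.
by rewrite /= [x + _]addrC.
Unshelve. all: by end_near. Qed.

Lemma extends_at_along A f x g v : extends_at A f x g ->
  (fun t : R => t^-1 *: (f (x + t *: v) - f x)) @ along A x v --> ('d g x v : W).
Proof.
move=> [Ax fg dg]; have := along_filter A x v => FF.
have gc : t^-1 *: (g (x + t *: v) - g x) @[t --> along A x v] --> ('d g x v : W).
  apply: cvg_trans (derive_quotient_cvg (v := v) dg).
  by apply: cvg_app; exact: cvg_within.
apply: cvg_trans gc; apply: near_eq_cvg.
have fgl := near_line v fg.
apply: filterS fgl => t h At.
by rewrite h// (nbhs_singleton fg).
Qed.

Lemma deriv_inE A f x g v : thick A x -> extends_at A f x g ->
  deriv_in A f x v = 'd g x v.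
Proof.
move=> tA fg; have := along_proper v tA => FF.
apply: cvg_lim; first exact: norm_hausdorff.
exact: extends_at_along fg.
Qed.

Lemma deriv_in_right A f x g v : (\forall t \near (0 : R)^'+, A (x + t *: v)) ->
  extends_at A f x g ->
  t^-1 *: (f (x + t *: v) - f x) @[t --> (0 : R)^'+] --> ('d g x v : W).
Proof.
move=> Av [Ax fg dg].
apply: cvg_trans (cvg_dnbhs_at_right (derive_quotient_cvg (v := v) dg)).
apply: near_eq_cvg; have fgl := near_line_right v fg.
by apply: filterS2 Av fgl => t At -> //; rewrite (nbhs_singleton fg).
Qed.

Lemma extends_at_subset A B f f' x g : A x ->
  (\forall y \near x, A y -> B y /\ f y = f' y) ->
  extends_at B f' x g -> extends_at A f x g.
Proof.
move=> Ax AB [Bx fg dg]; split => //.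
apply: filterS2 AB fg => y AB fg Ay.
by have [By ->] := AB Ay; exact: fg.
Qed.

Lemma extends_at_continuous A f x g : extends_at A f x g ->
  f @ within A (nbhs x) --> f x.
Proof.
move=> [Ax fg dg].
have gc : g @ within A (nbhs x) --> f x.
  rewrite (nbhs_singleton fg)//.
  apply: cvg_trans (differentiable_continuous dg).
  by apply: cvg_app; exact: cvg_within.
apply: cvg_trans gc; apply: near_eq_cvg.
by apply: filterS fg => y h Ay; rewrite h.
Qed.

(** On the line through x along v, which lies in P, the function is 0. *)
Lemma deriv_in_tangent A f x (P : set V) v : thick A x ->
  (forall t : R, P (x + t *: v)) ->
  (\forall y \near x, A y -> P y -> f y = 0) ->
  deriv_in A f x v = 0.
Proof.
move=> tA Pv f0; have := along_proper v tA => FF.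
apply: cvg_lim; first exact: norm_hausdorff.
have fx : f x = 0.
  by apply: (nbhs_singleton f0); [exact: tA.1|rewrite -[x]addr0 -(scale0r v)].
apply: (@cvg_trans _ ((fun=> 0 : W) @ along A x v)); last exact: cvg_cst.
apply: near_eq_cvg; have f0l := near_line v f0.
apply: filterS f0l => t h At.
by rewrite h// fx subr0 scaler0.
Qed.

End Extension.

Lemma deriv_in_scalar (A : set V) (f : V -> R) x g :
  thick A x -> extends_at A f x g -> scalar (deriv_in A f x).
Proof. by move=> tA fg a v w; rewrite !(deriv_inE _ tA fg) linearP. Qed.

End OneSided.

Lemma open_near (T : topologicalType) (U : set T) x : open U -> U x ->
  \forall y \near x, U y.
Proof. by move=> oU Ux; exact: open_nbhs_nbhs. Qed.

Section DifferentialCalculus.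
Context {R : realType}.

Lemma near_eq_differentiable (U W : normedModType R) (f g : U -> W) x :
  (\forall y \near x, f y = g y) -> differentiable g x ->
  differentiable f x /\ 'd f x = 'd g x :> (U -> W).
Proof.
move=> fg dg; have /diff_locallyP[dgc gE] := dg.
have fE : f \o shift x = cst (f x) + 'd g x +o_ 0 id.
  apply/eqaddoP => e e0.
  have /eqaddoP/(_ e e0) := gE.
  rewrite (nbhs_singleton fg); have fgs : \forall h \near (0 : U), f (h + x) = g (h + x).
    have shc : (h + x) @[h --> (0 : U)] --> x.
      by rewrite -[X in _ --> X]add0r; apply: cvgD; [exact: cvg_id|exact: cvg_cst].
    exact: (shc _ fg).
  apply: filterS2 fgs => h hE.
  by rewrite -![(_ - _) h]/(_ h - _ h) /= hE.
have dE : 'd f x = 'd g x :> (U -> W) by exact: diff_unique.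
split; last exact: dE.
apply/(diff_locallyP x f); rewrite dE; split; [exact: dgc|exact: fE].
Qed.

Lemma extends_at_comp m k (W : normedModType R)
    (A : set 'rV[R]_m.+1) (B : set 'rV[R]_k.+1) (f : 'rV[R]_m.+1 -> 'rV[R]_k.+1)
    (h : 'rV[R]_k.+1 -> W) x g l :
  extends_at A f x g -> extends_at B h (f x) l ->
  (\forall y \near x, A y -> B (f y)) ->
  extends_at A (h \o f) x (l \o g).
Proof.
move=> [Ax fg dg] [Bfx hl dl] AB; have fgx := nbhs_singleton fg Ax.
split=> //; last by apply: differentiable_comp => //; rewrite -fgx.
have hlg : \forall y \near x, B (g y) -> h (g y) = l (g y).
  have gc : g @ x --> g x by exact: differentiable_continuous.
  by move: hl; rewrite fgx => hl; exact: (gc _ hl).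
apply: filterS3 fg AB hlg => y fgy ABy hly Ay /=.
by rewrite fgy// hly// -fgy//; exact: ABy.
Qed.

Lemma deriv_in_comp m k (W : normedModType R)
    (A : set 'rV[R]_m.+1) (B : set 'rV[R]_k.+1) (f : 'rV[R]_m.+1 -> 'rV[R]_k.+1)
    (h : 'rV[R]_k.+1 -> W) x g l v :
  thick A x -> thick B (f x) -> extends_at A f x g -> extends_at B h (f x) l ->
  (\forall y \near x, A y -> B (f y)) ->
  deriv_in A (h \o f) x v = deriv_in B h (f x) (deriv_in A f x v).
Proof.
move=> tA tB fg hl AB.
rewrite (deriv_inE v tA (extends_at_comp fg hl AB)) (deriv_inE v tA fg).
have fgx : f x = g x by case: fg => Ax /nbhs_singleton/(_ Ax).
rewrite (deriv_inE _ tB hl) diff_comp ?fgx//; first by case: fg.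
by rewrite -fgx; case: hl.
Qed.

Lemma open_thick m (A : set 'rV[R]_m.+1) x : (\forall y \near x, A y) -> thick A x.
Proof.
by move=> Ax; split=> [|v]; [exact: nbhs_singleton Ax|left; exact: near_line_right].
Qed.

Lemma halfspace_right m (A : set 'rV[R]_m.+1) (x v : 'rV[R]_m.+1) :
  halfspace x -> (\forall y \near x, halfspace y -> A y) ->
  0 <= v ord0 ord0 -> \forall t \near (0 : R)^'+, A (x + t *: v).
Proof.
move=> x0 Ax v0; have Al := near_line_right v Ax.
near=> t; have : halfspace (x + t *: v).
  by rewrite /halfspace /= !mxE addr_ge0// mulr_ge0.
by near: t.
Unshelve. all: by end_near. Qed.

Lemma halfspace_thick m (A : set 'rV[R]_m.+1) x :
  A x -> A `<=` @halfspace R m -> (\forall y \near x, halfspace y -> A y) -> thick A x.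
Proof.
move=> Ax Ah Anx; split=> // v; have [v0|v0] := leP 0 (v ord0 ord0).
  by left; apply: halfspace_right => //; exact: Ah.
right; apply: halfspace_right => //; first exact: Ah.
by rewrite mxE oppr_ge0 ltW.
Qed.

(** One-sided Fermat rule. *)
Lemma deriv_in_ge0 m (A : set 'rV[R]_m.+1) (f : 'rV[R]_m.+1 -> R) x g v :
  extends_at A f x g -> (\forall t \near (0 : R)^'+, A (x + t *: v)) ->
  (\forall y \near x, A y -> f x <= f y) -> 0 <= 'd g x v.
Proof.
move=> fg Av fmin; have gc := deriv_in_right Av fg.
rewrite -(cvg_lim (@norm_hausdorff _ _) gc).
apply: limr_ge; first by apply/cvg_ex; exists ('d g x v).
have fl := near_line_right v fmin.
near=> t; rewrite /=.
have At : A (x + t *: v) by near: t.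
have ft : f x <= f (x + t *: v) by move: At; near: t.
by rewrite -[_ *: _]/(_ * _) mulr_ge0 ?subr_ge0// invr_ge0 ltW.
Unshelve. all: by end_near. Qed.

End DifferentialCalculus.

(** * Smooth maps between open subsets of Euclidean spaces *)

Section Smooth.
Context {R : realType} {m : nat}.
Local Notation V := 'rV[R]_m.+1.

Lemma Ck_eq (W : normedModType R) k (U : set V) (f g : V -> W) :
  open U -> (forall x, U x -> f x = g x) -> Ck k U g -> Ck k U f.
Proof.
move=> oU; elim: k f g => [|k IH] f g fg /=.
  move=> gc x Ux; have gcx : g @ x --> g x by exact: gc.
  have gf : {near nbhs x, g =1 f}.
    by apply: filterS (open_near oU Ux) => y /fg/esym.
  rewrite /prop_for /continuous_at fg//.
  exact: cvg_trans (near_eq_cvg gf) gcx.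
move=> [gd gC]; have fgx x : U x -> \forall y \near x, f y = g y.
  by move=> Ux; exact: filterS fg (open_near oU Ux).
split=> [x Ux|v]; first by have [] := near_eq_differentiable (fgx x Ux) (gd x Ux).
by apply: IH (gC v) => x Ux; apply: near_eq_derive; exact: fgx.
Qed.

Lemma Ck_subset (W : normedModType R) k (U U' : set V) (f : V -> W) :
  U' `<=` U -> Ck k U f -> Ck k U' f.
Proof.
move=> UU'; elim: k f => [|k IH] f /=; first by move=> fc x /UU'; exact: fc.
by move=> [fd fC]; split=> [x /UU'/fd//|v]; exact: IH.
Qed.

Lemma CkS (W : normedModType R) k (U : set V) (f : V -> W) : Ck k.+1 U f -> Ck k U f.
Proof.
elim: k f => [|k IH] f [fd fC].
  by move=> x /fd; exact: differentiable_continuous.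
by split=> // v; exact: IH.
Qed.

Lemma Ck_cst (W : normedModType R) k (U : set V) (w : W) : Ck k U (fun=> w).
Proof.
elim: k w => [|k IH] w; first by move=> x _; exact: cst_continuous.
split=> [x _|v]; first exact: differentiable_cst.
rewrite (_ : 'D_v _ = fun=> 0)//; apply: funext => x; exact: derive_cst.
Qed.

Lemma CkD (W : normedModType R) k (U : set V) (f g : V -> W) : open U ->
  Ck k U f -> Ck k U g -> Ck k U (fun x => f x + g x).
Proof.
move=> oU; elim: k f g => [|k IH] f g.
  by move=> fc gc x Ux; apply: continuousD; [exact: fc|exact: gc].
move=> [fd fC] [gd gC]; split=> [x Ux|v].
  by apply: differentiableD; [exact: fd|exact: gd].
apply: (Ck_eq (g := fun x => 'D_v f x + 'D_v g x) oU); last exact: IH (fC v) (gC v).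
by move=> x Ux; rewrite -[LHS]/('D_v (f + g) x) deriveD//; apply: diff_derivable; [exact: fd|exact: gd].
Qed.

Lemma CkM k (U : set V) (f g : V -> R) : open U ->
  Ck k U f -> Ck k U g -> Ck k U (fun x => f x * g x).
Proof.
move=> oU; elim: k f g => [|k IH] f g.
  by move=> fc gc x Ux; apply: continuousM; [exact: fc|exact: gc].
move=> fS gS; have [fd fC] := fS; have [gd gC] := gS; split=> [x Ux|v].
  by apply: differentiableM; [exact: fd|exact: gd].
apply: (Ck_eq (g := fun x => f x * 'D_v g x + g x * 'D_v f x) oU); last first.
  by apply: CkD oU (IH _ _ (CkS fS) (gC v)) (IH _ _ (CkS gS) (fC v)).
move=> x Ux; rewrite -[LHS]/('D_v (f * g) x) deriveM//; apply: diff_derivable;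
  [exact: fd|exact: gd].
Qed.

Lemma CkV k (U : set V) (f : V -> R) : open U -> (forall x, U x -> f x != 0) ->
  Ck k U f -> Ck k U (fun x => (f x)^-1).
Proof.
move=> oU f0; elim: k => [|k IH].
  by move=> fc x Ux; apply: continuousV; [exact: f0|exact: fc].
move=> fS; have [fd fC] := fS; split=> [x Ux|v].
  by apply: differentiableV; [exact: fd|exact: f0].
have fV := IH (CkS fS).
apply: (Ck_eq (g := fun x => -1 * ((f x)^-1 * (f x)^-1) * 'D_v f x) oU); last first.
  by apply: CkM oU (CkM oU (Ck_cst _ _ _) (CkM oU fV fV)) (fC v).
move=> x Ux; rewrite deriveV//; [|exact: f0|by apply: diff_derivable; exact: fd].
by rewrite mulN1r -invfM -expr2.
Qed.

Lemma Ck_linear_comp (W W' : normedModType R) k (U : set V) (f : V -> W)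
    (h : {linear W -> W'}) : open U -> continuous h -> Ck k U f ->
  Ck k U (h \o f) /\ (forall x v, (0 < k)%N -> U x ->
    'D_v (h \o f) x = h ('D_v f x)).
Proof.
move=> oU hc; have hd w : differentiable h w by exact: linear_differentiable.
have hD f' x v : differentiable f' x -> 'D_v (h \o f') x = h ('D_v f' x).
  move=> fd; rewrite deriveE; last exact: differentiable_comp.
  by rewrite diff_comp// /= diff_lin// -deriveE.
move=> fC; split; last first.
  by case: k fC => // k [fd _] x v _ Ux; apply: hD; exact: fd.
elim: k f fC => [|k IH] f.
  by move=> fc x Ux; apply: continuous_comp; [exact: fc|exact: hc].
move=> [fd fC]; split=> [x Ux|v].
  by apply: differentiable_comp => //; exact: fd.
apply: (Ck_eq (g := h \o 'D_v f) oU) => [x Ux|]; last exact: IH (fC v).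
by apply: hD; exact: fd.
Qed.

End Smooth.

Section SmoothLine.
Context {R : realType} {m : nat}.
Local Notation V := 'rV[R]_m.+1.

Lemma Ck_comp_linear (W : normedModType R) p k (U : set V) (f : V -> W)
    (h : {linear 'rV[R]_p.+1 -> V}) : open U -> continuous h -> Ck k U f ->
  Ck k (h @^-1` U) (f \o h).
Proof.
move=> oU hc; have hd w : differentiable h w by exact: linear_differentiable.
have oU' : open (h @^-1` U) by apply: open_comp => // x _; exact: hc.
elim: k f => [|k IH] f.
  by move=> fc x Ux; apply: continuous_comp; [exact: hc|exact: fc].
move=> [fd fC]; split=> [x Ux|v].
  by apply: differentiable_comp => //; exact: fd.
apply: (Ck_eq (g := 'D_(h v) f \o h) oU') => [x Ux|]; last exact: IH (fC (h v)).
rewrite deriveE; last by apply: differentiable_comp => //; exact: fd.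
by rewrite diff_comp//= ?diff_lin// -?deriveE//; exact: fd.
Qed.

Lemma line_is_derive (f : V -> R) (x v : V) (t : R) : differentiable f (x + t *: v) ->
  is_derive t 1 (fun s : R => f (x + s *: v)) ('D_v f (x + t *: v)).
Proof.
move=> fd; pose l (s : R) := x + s *: v.
have ld : is_diff t l (fun s : R => s *: v).
  have -> : l = cst x + *:%R ^~ v by [].
  have := is_diffD (is_diff_cst x t) (is_diff_scalel t v).
  by rewrite add0r.
have -> : (fun s : R => f (x + s *: v)) = f \o l by [].
have fld : differentiable (f \o l) t by apply: differentiable_comp; [case: ld|].
apply: DeriveDef; first exact: diff_derivable.
rewrite deriveE// diff_comp /=; [|by case: ld|exact: fd].
by have -> : 'd l t = *:%R ^~ v :> (R -> V) by [case: ld]; rewrite scale1r -deriveE.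
Qed.

(** The mean value theorem is applied to r |-> f(x + r v + t w) - f(x + r v),
    then to 'D_v f along w. The left-hand side is symmetric in v and w. *)
Lemma second_difference (U : set V) (f : V -> R) (x v w : V) (N : set V) :
  open U -> U x -> Ck 2 U f -> (\forall y \near x, N y) ->
  \forall t \near (0 : R)^'+, exists2 y, N y &
    f (x + t *: v + t *: w) - f (x + t *: v) - (f (x + t *: w) - f x) =
    t * t * 'D_w ('D_v f) y.
Proof.
move=> oU Ux [fd fC] Nx.
have : \forall y \near x, N y /\ U y by exact: filterI Nx (open_near oU Ux).
move=> /nbhs_ballP[e /= e0 NU].
have NUb y : `|x - y| < e -> N y /\ U y by move=> xy; apply: NU; rewrite -ball_normE.
(* All the points involved are at distance at most t M of x. *)
pose M := `|v| + `|w| + 1.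
have M0 : 0 < M by rewrite ltr_wpDl// addr_ge0.
near=> t; have t0 : 0 < t by [].
have te : t * M < e.
  by rewrite -ltr_pdivlMr//; near: t; apply: nbhs_right_lt; rewrite divr_gt0.
have box r s : 0 <= r <= t -> 0 <= s <= t ->
    N (x + r *: v + s *: w) /\ U (x + r *: v + s *: w).
  move=> /andP[r0 rt] /andP[s0 st]; apply: NUb; apply: le_lt_trans te.
  rewrite -addrA opprD addNKr normrN (le_trans (ler_normD _ _))// !normrZ.
  rewrite (ger0_norm r0) (ger0_norm s0) /M.
  have h1 : r * `|v| <= t * `|v| by rewrite ler_wpM2r.
  have h2 : s * `|w| <= t * `|w| by rewrite ler_wpM2r.
  by move: h1 h2 t0; lra.
have t01 r : r \in `]0, t[ -> 0 <= r <= t.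
  by rewrite in_itv /= => /andP[/ltW -> /ltW ->].
pose phi r := f (x + r *: v + t *: w) - f (x + r *: v).
have tt : 0 <= t <= t by rewrite lexx ltW.
have z0t : (0 : R) <= 0 <= t by rewrite lexx ltW.
have phiD r : 0 <= r <= t -> is_derive r 1 phi
    ('D_v f (x + r *: v + t *: w) - 'D_v f (x + r *: v)).
  move=> rt; have U1 := (box _ _ rt tt).2; have U2 := (box _ _ rt z0t).2.
  rewrite scale0r addr0 in U2.
  have D1 := line_is_derive (x := x + t *: w) (v := v) (t := r).
  have D2 := line_is_derive (fd _ U2).
  rewrite [x + t *: w + _]addrAC in D1; have {}D1 := D1 _ (fd _ U1).
  rewrite (_ : phi = (fun s => f (x + t *: w + s *: v)) - (fun s => f (x + s *: v))).
    exact: is_deriveB.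
  by apply: funext => s; rewrite /phi addrAC.
have [r rI phiE] : exists2 r, r \in `]0, t[ & phi t - phi 0 =
    ('D_v f (x + r *: v + t *: w) - 'D_v f (x + r *: v)) * (t - 0).
  apply: (@MVT _ phi (fun r => 'D_v f (x + r *: v + t *: w) - 'D_v f (x + r *: v))); first exact: t0.
    by move=> r rI; apply: phiD; exact: t01.
  apply: derivable_within_continuous => r; rewrite in_itv /= => rI.
  by have [] := phiD _ rI.
have [_ fvd] := fC v; have {}fvd : forall y, U y -> differentiable ('D_v f) y.
  by have [] := fC v.
have [s sI psiE] : exists2 s, s \in `]0, t[ &
    'D_v f (x + r *: v + t *: w) - 'D_v f (x + r *: v + 0 *: w) =
    'D_w ('D_v f) (x + r *: v + s *: w) * (t - 0).
  apply: (@MVT _ (fun s => 'D_v f (x + r *: v + s *: w))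
    (fun s => 'D_w ('D_v f) (x + r *: v + s *: w))); first exact: t0.
    move=> s sI; apply: line_is_derive; apply: fvd.
    by apply: (box _ _ _ _).2; exact: t01.
  apply: derivable_within_continuous => s; rewrite in_itv /= => sI.
  have Us : U (x + r *: v + s *: w) by apply: (box _ _ _ _).2 => //; exact: t01.
  by have [] := line_is_derive (fvd _ Us).
exists (x + r *: v + s *: w); first by apply: (box _ _ _ _).1; exact: t01.
move: phiE; rewrite /phi scale0r addr0 => ->.
by move: psiE; rewrite scale0r addr0 subr0 => ->; ring.
Unshelve. all: by end_near. Qed.

Lemma mean_values_close (a b p q e t A B C D : R) :
  0 < t -> `|a - p| < e / 2 -> `|b - q| < e / 2 ->
  A - B - (C - D) = t * t * p -> A - C - (B - D) = t * t * q -> `|a - b| <= e.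
Proof.
move=> t0 ap bq Ep Eq; have pq : p = q.
  apply: (@mulfI _ (t * t)); first by rewrite mulf_neq0 ?gt_eqF.
  by rewrite -Ep -Eq; ring.
rewrite (_ : a - b = (a - p) - (b - q)); last by rewrite pq; ring.
by rewrite (le_trans (ler_normB _ _))// [e]splitr lerD// ltW.
Qed.

(** Both second derivatives are close to the same quotient of a second
    difference. *)
Lemma derive_symmetric (U : set V) (f : V -> R) (x v w : V) :
  open U -> U x -> Ck 2 U f -> 'D_w ('D_v f) x = 'D_v ('D_w f) x.
Proof.
move=> oU Ux fC; set a := LHS; set b := RHS.
have [fd fC'] := fC.
apply/eqP; rewrite -subr_eq0 -normr_le0; apply/ler_addgt0Pr => e e0; rewrite add0r.
have e2 : 0 < e / 2 by rewrite divr_gt0.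
have cvw : 'D_w ('D_v f) @ x --> a by exact: (fC' v).2.
have cwv : 'D_v ('D_w f) @ x --> b by exact: (fC' w).2.
have N1 : \forall y \near x, `|a - 'D_w ('D_v f) y| < e / 2 by move/cvgrPdist_lt : cvw; apply.
have N2 : \forall y \near x, `|b - 'D_v ('D_w f) y| < e / 2 by move/cvgrPdist_lt : cwv; apply.
have S1 := second_difference v w oU Ux fC N1.
have S2 := second_difference w v oU Ux fC N2.
have [t [t0 [y1 ay1 E1] [y2 by2 E2]]] : exists t : R, [/\ 0 < t,
    exists2 y, `|a - 'D_w ('D_v f) y| < e / 2 &
      f (x + t *: v + t *: w) - f (x + t *: v) - (f (x + t *: w) - f x) =
      t * t * 'D_w ('D_v f) y &
    exists2 y, `|b - 'D_v ('D_w f) y| < e / 2 &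
      f (x + t *: w + t *: v) - f (x + t *: w) - (f (x + t *: v) - f x) =
      t * t * 'D_v ('D_w f) y].
  have t0 : \forall t \near (0 : R)^'+, 0 < t by exact: nbhs_right_gt.
  have [t [[pt S1t] S2t]] := filter_ex (filterI (filterI t0 S1) S2).
  by exists t; split; [exact: pt|exact: S1t|exact: S2t].
move: E2; rewrite [x + t *: w + t *: v]addrAC => E2.
exact: (mean_values_close t0 ay1 by2 E1 E2).
Qed.

End SmoothLine.

(** * Charts of a manifold with boundary *)

Section LinearRow.
Context {R : realType}.

Lemma linear_rV_sum m (W : lmodType R) (f : {linear 'rV[R]_m -> W}) x :
  f x = \sum_j x ord0 j *: f (delta_mx ord0 j).
Proof.
rewrite [in LHS](row_sum_delta x) linear_sum.
by apply: eq_bigr => j _; rewrite linearZ.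
Qed.

Lemma linear_rV_continuous m (W : normedModType R) (f : {linear 'rV[R]_m.+1 -> W}) :
  continuous f.
Proof.
have -> : (f : 'rV[R]_m.+1 -> W) =
    fun x => \sum_j x ord0 j *: f (delta_mx ord0 j).
  by apply: funext => x; exact: linear_rV_sum.
apply: continuous_big => [|j _ x]; first exact: add_continuous.
have xc := @matrix_normedtype.coord_continuous R 1 m.+1 ord0 j x.
exact: cvgZ xc (cvg_cst _).
Qed.

Definition row_coord m (j : 'I_m) (x : 'rV[R]_m) : R := x ord0 j.

Fact row_coord_is_linear m (j : 'I_m) : linear (@row_coord m j).
Proof. by move=> a x y; rewrite /row_coord !mxE. Qed.

HB.instance Definition _ m j := GRing.isLinear.Build R 'rV[R]_m R *%R
  (@row_coord m j) (@row_coord_is_linear m j).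

(** The inclusion of the boundary of a half-space; the formula is the one by
    which a chart of a manifold induces a chart of its boundary. *)
Definition wall m (y : 'rV[R]_m) : 'rV[R]_m.+1 :=
  \row_i if unlift ord0 i is Some j then y ord0 j else 0.

Definition unwall m (x : 'rV[R]_m.+1) : 'rV[R]_m :=
  \row_j x ord0 (lift ord0 j).

Fact wall_is_linear m : linear (@wall m).
Proof.
move=> a x y; apply/rowP => i; rewrite !mxE.
by case: unlift => [j|]; rewrite ?mxE ?mulr0 ?addr0.
Qed.

HB.instance Definition _ m := GRing.isLinear.Build R 'rV[R]_m 'rV[R]_m.+1 *:%R
  (@wall m) (@wall_is_linear m).

Fact unwall_is_linear m : linear (@unwall m).
Proof. by move=> a x y; apply/rowP => i; rewrite !mxE. Qed.

HB.instance Definition _ m := GRing.isLinear.Build R 'rV[R]_m.+1 'rV[R]_m *:%R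
  (@unwall m) (@unwall_is_linear m).

Lemma wall0 m (y : 'rV[R]_m) : wall y ord0 ord0 = 0.
Proof. by rewrite mxE unlift_none. Qed.

Lemma wallK m : cancel (@wall m) (@unwall m).
Proof. by move=> y; apply/rowP => j; rewrite !mxE liftK. Qed.

Lemma unwallK m (x : 'rV[R]_m.+1) : x ord0 ord0 = 0 -> wall (unwall x) = x.
Proof.
move=> x0; apply/rowP => i; rewrite !mxE.
by have [j|] := unliftP ord0 i => ->; rewrite ?liftK ?mxE ?unlift_none ?x0.
Qed.

Lemma linear_extends m (W : normedModType R) (A : set 'rV[R]_m.+1)
    (h : {linear 'rV[R]_m.+1 -> W}) x : A x -> extends_at A h x h.
Proof.
move=> Ax; split=> //; first by near do by [].
by apply: linear_differentiable; exact: linear_rV_continuous.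
Unshelve. all: by end_near. Qed.

Lemma deriv_in_linear m (W : normedModType R) (A : set 'rV[R]_m.+1)
    (h : {linear 'rV[R]_m.+1 -> W}) x v : thick A x -> deriv_in A h x v = h v.
Proof.
move=> tA; rewrite (deriv_inE v tA (linear_extends _ tA.1)) diff_lin//.
exact: linear_rV_continuous.
Qed.

Lemma deriv_in_linear_comp m k (W : normedModType R) (A : set 'rV[R]_m.+1)
    (f : 'rV[R]_m.+1 -> 'rV[R]_k.+1) (h : {linear 'rV[R]_k.+1 -> W}) x g v :
  thick A x -> extends_at A f x g ->
  deriv_in A (h \o f) x v = h (deriv_in A f x v).
Proof.
move=> tA fg; have tT : thick [set: 'rV[R]_k.+1] (f x).
  by apply: open_thick; near do by [].
rewrite (deriv_in_comp (g := g) (l := h) v tA tT fg) ?deriv_in_linear//.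
- exact: linear_extends.
- by near do by [].
Unshelve. all: by end_near. Qed.

End LinearRow.

Section Manifold.
Context {R : realType} {m : nat} {F : domain R m}.
Local Notation V := 'rV[R]_m.+1.
Local Notation chartF := (chart (charts F)).
Implicit Types (c : chartF) (p q : F).

Lemma region_coord c p : cdom c p -> region c (coord c p).
Proof. by move=> cp; exists p. Qed.

Lemma param_cdom c y : region c y -> cdom c (param c y).
Proof. by move=> [q cq <-]; rewrite coordK. Qed.

Lemma paramK c y : region c y -> coord c (param c y) = y.
Proof. by move=> [q cq <-]; rewrite coordK. Qed.

Lemma coord_image c (S : set F) y :
  (coord c @` (cdom c `&` S)) y <-> region c y /\ S (param c y).
Proof.
split=> [[q [cq Sq] <-]|[ry Sy]].
  by rewrite coordK//; split=> //; exact: region_coord.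
by exists (param c y); [split=> //; exact: param_cdom|exact: paramK].
Qed.

Lemma region_halfspace c : region c `<=` @halfspace R m.
Proof. by have [B _ ->] := region_open c; move=> x []. Qed.

Lemma near_region c x : region c x -> \forall y \near x, halfspace y -> region c y.
Proof.
have [B oB ->] := region_open c; move=> [Bx _].
by apply: filterS (open_near oB Bx) => y By hy.
Qed.

Lemma region_thick c x : region c x -> thick (region c) x.
Proof.
move=> rx; apply: halfspace_thick => //; first exact: region_halfspace.
exact: near_region.
Qed.

Lemma param_cvg c p : cdom c p ->
  param c @ within (region c) (nbhs (coord c p)) --> p.
Proof.
move=> cp; rewrite -[X in _ --> X](coordK cp).
have /subspace_continuousP := @param_continuous _ _ F c.
by apply; exact: region_coord.
Qed.

Lemma near_param c p (P : set F) : cdom c p -> (\forall q \near p, P q) ->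
  \forall y \near coord c p, region c y -> P (param c y).
Proof. by move=> cp Pp; exact: (param_cvg cp Pp). Qed.

Lemma coord_cvg c p : cdom c p -> coord c @ p --> coord c p.
Proof.
move=> cp; have /subspace_continuousP/(_ p cp) := @coord_continuous _ _ F c.
by rewrite within_interior//; apply: open_near => //; exact: cdom_open.
Qed.

Lemma near_cdom c p : cdom c p -> \forall q \near p, cdom c q.
Proof. by move=> cp; apply: open_near => //; exact: cdom_open. Qed.

Lemma smooth_on_shrink (W : normedModType R) (A P : set V) (f : V -> W) x :
  smooth_on A f -> A x -> (\forall y \near x, P y) ->
  exists U g, [/\ open U, U x, forall k, Ck k U g &
    forall y, U y -> P y /\ (A y -> f y = g y)].
Proof.
move=> fS Ax Px; have [U [g [oU Ux gC fg]]] := fS x Ax.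
exists (U `&` P^°), g; split.
- by apply: openI => //; exact: open_interior.
- by split.
- by move=> k; apply: Ck_subset (gC k) => y [].
- by move=> y [Uy /nbhs_singleton Py]; split=> // Ay; exact: fg.
Qed.

Section MapDeriv.
Implicit Types f g : F -> F.

(** The differential of f at p read in the charts c and c'. As tangent spaces
    are read in the charts pref, tvec c p is the case f = id and c' = pref p, and
    tmap f p is the case c = pref p and c' = pref (f p). *)
Definition map_deriv f c c' p (v : V) : V :=
  deriv_in (region c) (coord c' \o f \o param c) (coord c p) v.

Lemma map_smooth f c c' p : smooth_map (charts F) (charts F) f ->
  cdom c p -> cdom c' (f p) -> exists U (g : V -> V),
  [/\ open U, U (coord c p), forall k, Ck k U g & forall y, U y -> region c y ->
    cdom c' (f (param c y)) /\ coord c' (f (param c y)) = g y].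
Proof.
move=> [fc fS] cp cfp.
have near_c : \forall q \near p, cdom c' (f q).
  exact: (fc p _ (near_cdom cfp)).
have ximg : (coord c @` (cdom c `&` f @^-1` cdom c')) (coord c p).
  by exists p.
have [U [g [oU Ux gC fg]]] := smooth_on_shrink (fS c c') ximg (near_param cp near_c).
exists U, g; split=> // y Uy ry; have [/(_ ry) cy fgy] := fg y Uy.
by split=> //; apply: fgy; apply/coord_image.
Qed.

Lemma map_extends f c c' p : smooth_map (charts F) (charts F) f ->
  cdom c p -> cdom c' (f p) ->
  exists g : V -> V, extends_at (region c) (coord c' \o f \o param c) (coord c p) g.
Proof.
move=> fS cp cfp; have [U [g [oU Ux gC fg]]] := map_smooth fS cp cfp.
exists g; split; first exact: region_coord.
  by apply: filterS (open_near oU Ux) => y Uy ry; exact: (fg y Uy ry).2.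
by have [gd _] := gC 1; exact: gd.
Qed.

Lemma near_map_dom f c c' p : smooth_map (charts F) (charts F) f ->
  cdom c p -> cdom c' (f p) ->
  \forall y \near coord c p, region c y -> cdom c' (f (param c y)).
Proof.
move=> [fc _] cp cfp; apply: (@near_param c p (fun q => cdom c' (f q)) cp).
exact: (fc p _ (near_cdom cfp)).
Qed.

Lemma map_comp_extends (W : normedModType R) f (h : F -> W) c c' p (g : V -> V) l :
  smooth_map (charts F) (charts F) f -> cdom c p -> cdom c' (f p) ->
  extends_at (region c) (coord c' \o f \o param c) (coord c p) g ->
  extends_at (region c') (h \o param c') (coord c' (f p)) l ->
  extends_at (region c) (h \o f \o param c) (coord c p) (l \o g).
Proof.
move=> fS cp cfp fg hl; have dom := near_map_dom fS cp cfp.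
have xE : (coord c' \o f \o param c) (coord c p) = coord c' (f p).
  by rewrite /= coordK.
have ext : extends_at (region c) ((h \o param c') \o (coord c' \o f \o param c))
    (coord c p) (l \o g).
  apply: extends_at_comp fg _ _; first by rewrite xE; exact: hl.
  by apply: filterS dom => y dy ry; apply: region_coord; exact: dy.
apply: extends_at_subset ext; first exact: region_coord.
apply: filterS dom => y dy ry; split=> //=.
by rewrite coordK//; exact: dy.
Qed.

(** Chain rule at a point which may be on the boundary. *)
Lemma map_deriv_comp_gen (W : normedModType R) f (h : F -> W) c c' p l v :
  smooth_map (charts F) (charts F) f -> cdom c p -> cdom c' (f p) ->
  extends_at (region c') (h \o param c') (coord c' (f p)) l ->
  deriv_in (region c) (h \o f \o param c) (coord c p) v =
  deriv_in (region c') (h \o param c') (coord c' (f p)) (map_deriv f c c' p v).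
Proof.
move=> fS cp cfp hl; have [g fg] := map_extends fS cp cfp.
have tc := region_thick (region_coord cp).
have tc' := region_thick (region_coord cfp).
have gx : g (coord c p) = coord c' (f p).
  by have [rx /nbhs_singleton/(_ rx) <- _] := fg; rewrite /= coordK.
rewrite (deriv_inE v tc (map_comp_extends fS cp cfp fg hl)).
rewrite (deriv_inE _ tc' hl) /map_deriv (deriv_inE v tc fg).
have gd : differentiable g (coord c p) by case: fg.
have ld : differentiable l (g (coord c p)) by rewrite gx; case: hl.
have e := congr1 (fun d : V -> W => d v) (diff_comp gd ld).
by rewrite -gx; exact: etrans e _.
Qed.

Lemma map_deriv_comp f g c c' c'' p v :
  smooth_map (charts F) (charts F) f -> smooth_map (charts F) (charts F) g ->
  cdom c p -> cdom c' (f p) -> cdom c'' (g (f p)) ->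
  map_deriv (g \o f) c c'' p v = map_deriv g c' c'' (f p) (map_deriv f c c' p v).
Proof.
move=> fS gS cp cfp cgfp; have [l gl] := map_extends gS cfp cgfp.
exact: (map_deriv_comp_gen v fS cp cfp gl).
Qed.

Lemma smooth_id : smooth_map (charts F) (charts F) id.
Proof.
by split=> [p|c c']; [exact: cvg_id|exact: transition_smooth].
Qed.

Lemma map_deriv_id c p v : cdom c p -> map_deriv id c c p v = v.
Proof.
move=> cp; have tc := region_thick (region_coord cp).
have ext : extends_at (region c) (coord c \o id \o param c) (coord c p) idfun.
  apply: (@extends_at_subset _ _ _ _ (region c) _ idfun).
  - exact: region_coord.
  - by near do by move=> ry; split=> //=; exact: paramK.
  - by apply: linear_extends; exact: region_coord.
rewrite /map_deriv (deriv_inE v tc ext) diff_lin//.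
exact: linear_rV_continuous.
Unshelve. all: by end_near. Qed.

Lemma map_deriv_linear f c c' p : smooth_map (charts F) (charts F) f ->
  cdom c p -> cdom c' (f p) -> linear (map_deriv f c c' p).
Proof.
move=> fS cp cfp a v w; have [g fg] := map_extends fS cp cfp.
have tc := region_thick (region_coord cp).
by rewrite /map_deriv !(deriv_inE _ tc fg) linearP.
Qed.

End MapDeriv.

Lemma pref_cdom p : cdom (pref (charts F) p) p.
Proof. exact: pref_dom. Qed.

Lemma tvecE c p v : tvec c p v = map_deriv id c (pref (charts F) p) p v.
Proof. by []. Qed.

Lemma tvec_pref p v : tvec (pref (charts F) p) p v = v.
Proof. by rewrite tvecE map_deriv_id//; exact: pref_cdom. Qed.

Lemma tvec_change c c' p v : cdom c p -> cdom c' p ->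
  tvec c p v = tvec c' p (map_deriv id c c' p v).
Proof.
move=> cp cp'; rewrite !tvecE.
by rewrite -(map_deriv_comp v smooth_id smooth_id cp cp')//; exact: pref_cdom.
Qed.

Lemma change_chartK c c' p v : cdom c p -> cdom c' p ->
  map_deriv id c' c p (map_deriv id c c' p v) = v.
Proof.
move=> cp cp'; rewrite -(map_deriv_comp v smooth_id smooth_id cp cp')//.
exact: map_deriv_id.
Qed.

Lemma tvec_linear c p : cdom c p -> linear (tvec c p).
Proof. by move=> cp; apply: map_deriv_linear smooth_id cp _; exact: pref_cdom. Qed.

Lemma tmapE f p v : tmap (charts F) (charts F) f p v =
  map_deriv f (pref (charts F) p) (pref (charts F) (f p)) p v.
Proof. by []. Qed.

Lemma tmap_tvec f c c' p v : smooth_map (charts F) (charts F) f ->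
  cdom c p -> cdom c' (f p) ->
  tmap (charts F) (charts F) f p (tvec c p v) = tvec c' (f p) (map_deriv f c c' p v).
Proof.
move=> fS cp cfp; rewrite tmapE !tvecE.
rewrite -(map_deriv_comp v fS smooth_id cp cfp); last exact: pref_cdom.
by rewrite -(map_deriv_comp v smooth_id fS cp); [|exact: pref_cdom..].
Qed.

Lemma interior_region c x : region c x -> 0 < x ord0 ord0 ->
  \forall y \near x, region c y /\ 0 < y ord0 ord0.
Proof.
move=> rx x0; have y0 : \forall y \near x, 0 < (y : V) ord0 ord0.
  have cc := @matrix_normedtype.coord_continuous R 1 m.+1 ord0 ord0 x.
  exact: (cvgr_gt _ cc _ x0).
by apply: filterS2 (near_region rx) y0 => y ry y0; split=> //; apply: ry; exact: ltW.
Qed.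

(** If p were interior for c, the first coordinate of the change of charts would
    be minimal at p, hence critical, but a change of charts has an onto
    differential. *)
Lemma coord0_change c c' p : cdom c p -> cdom c' p ->
  coord c' p ord0 ord0 = 0 -> coord c p ord0 ord0 = 0.
Proof.
move=> cp cp' p0'; apply/eqP/negPn/negP => p0.
have rx := region_coord cp; have tc := region_thick rx.
have x0 : 0 < coord c p ord0 ord0.
  by rewrite lt_neqAle eq_sym p0; exact: (region_halfspace rx).
have [g fg] := map_extends smooth_id cp cp'.
have near_x : \forall y \near coord c p, region c y.
  by apply: filterS (interior_region rx x0) => y [].
have hg : extends_at (region c) (row_coord ord0 \o (coord c' \o id \o param c))
    (coord c p) (row_coord ord0 \o g).
  apply: (@extends_at_comp _ _ _ _ _ setT) fg _ _; first exact: linear_extends.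
  by near do by [].
have dhg v : 'd (row_coord ord0 \o g) (coord c p) v =
    map_deriv id c c' p v ord0 ord0.
  by rewrite -(deriv_inE v tc hg) (deriv_in_linear_comp _ v tc fg).
have ge0 v : 0 <= map_deriv id c c' p v ord0 ord0.
  rewrite -dhg; apply: deriv_in_ge0 hg _ _; first exact: near_line_right.
  apply: filterS (near_map_dom smooth_id cp cp') => y cy ry.
  rewrite /= coordK// /row_coord p0'.
  by apply: (@region_halfspace c'); apply: region_coord; exact: cy.
have := ge0 (map_deriv id c' c p (- delta_mx ord0 ord0)).
by rewrite change_chartK// !mxE/= oppr_ge0 ler10.
Unshelve. all: by end_near. Qed.

Lemma bd_coord c p : cdom c p -> bd F p <-> coord c p ord0 ord0 = 0.
Proof.
by move=> cp; split; apply: coord0_change => //; exact: pref_cdom.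
Qed.

Lemma Int_coord c p : cdom c p -> Int F p <-> 0 < coord c p ord0 ord0.
Proof.
move=> cp; rewrite /Int /setC /= (bd_coord cp).
have := region_halfspace (region_coord cp); rewrite /halfspace /= => x0.
by rewrite lt_neqAle x0 andbT eq_sym; split=> [/eqP|/eqP].
Qed.

Lemma fun_smooth (u : F -> R) c p : smooth_fun (charts F) setT u -> cdom c p ->
  exists U (g : V -> R), [/\ open U, U (coord c p), forall k, Ck k U g &
    forall y, U y -> region c y -> u (param c y) = g y].
Proof.
move=> us cp; have ximg : (coord c @` (cdom c `&` setT)) (coord c p) by exists p.
have [U [g [oU Ux gC ug]]] := us c _ ximg; exists U, g; split=> // y Uy ry.
by apply: ug => //; apply/coord_image.
Qed.

Lemma smooth_extends (W : normedModType R) (A U : set V) (f g : V -> W) x :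
  A x -> open U -> U x -> (forall k, Ck k U g) -> (forall y, U y -> A y -> f y = g y) ->
  extends_at A f x g.
Proof.
move=> Ax oU Ux gC fg; split=> //; last by have [gd _] := gC 1; exact: gd.
by apply: filterS (open_near oU Ux) => y Uy; exact: fg.
Qed.

Lemma fun_extends (u : F -> R) c p : smooth_fun (charts F) setT u -> cdom c p ->
  exists g, extends_at (region c) (u \o param c) (coord c p) g.
Proof.
move=> us cp; have [U [g [oU Ux gC ug]]] := fun_smooth us cp; exists g.
by apply: smooth_extends oU Ux gC ug; exact: region_coord.
Qed.

Lemma differential_tvec (u : F -> R) c p v : smooth_fun (charts F) setT u ->
  cdom c p ->
  differential (charts F) u p (tvec c p v) =
  deriv_in (region c) (u \o param c) (coord c p) v.
Proof.
move=> us cp; have [l ul] := fun_extends us (pref_cdom p).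
by rewrite tvecE /differential -(map_deriv_comp_gen v smooth_id cp (pref_cdom p) ul).
Qed.

Lemma differential_scalar (u : F -> R) p : smooth_fun (charts F) setT u ->
  scalar (differential (charts F) u p).
Proof.
move=> us; have [l ul] := fun_extends us (pref_cdom p).
exact: deriv_in_scalar (region_thick (region_coord (pref_cdom p))) ul.
Qed.

Lemma differential_comp (u : F -> R) f c p v : smooth_fun (charts F) setT u ->
  smooth_map (charts F) (charts F) f -> cdom c p ->
  deriv_in (region c) (u \o f \o param c) (coord c p) v =
  differential (charts F) u (f p) (tmap (charts F) (charts F) f p (tvec c p v)).
Proof.
move=> us fS cp; have cfp := pref_cdom (f p); have [l ul] := fun_extends us cfp.
rewrite (map_deriv_comp_gen v fS cp cfp ul) (tmap_tvec v fS cp cfp) tvec_pref.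
by [].
Qed.

(** A vector whose first component is 0 is tangent to the boundary, along which
    g vanishes. *)
Lemma tangent_deriv0 (W : normedModType R) (g : V -> W) c p (v : V) : cdom c p -> bd F p ->
  v ord0 ord0 = 0 ->
  (\forall y \near coord c p, region c y -> bd F (param c y) -> g y = 0) ->
  deriv_in (region c) g (coord c p) v = 0.
Proof.
move=> cp /(bd_coord cp) p0 v0 g0.
apply: (@deriv_in_tangent _ _ _ _ _ _ [set y : V | y ord0 ord0 = 0]).
- exact: region_thick (region_coord cp).
- by move=> t /=; rewrite !mxE p0 v0 mulr0 addr0.
apply: filterS g0 => y gy ry y0; apply: gy => //.
by apply/(bd_coord (param_cdom ry)); rewrite paramK.
Qed.

Lemma map_deriv_tangent (f : F -> F) c c' p (v : V) : smooth_map (charts F) (charts F) f ->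
  (forall q, bd F q -> bd F (f q)) -> cdom c p -> cdom c' (f p) -> bd F p ->
  v ord0 ord0 = 0 -> map_deriv f c c' p v ord0 ord0 = 0.
Proof.
move=> fS fb cp cfp pb v0; have [g fg] := map_extends fS cp cfp.
have tc := region_thick (region_coord cp).
rewrite -[LHS]/(row_coord ord0 _) -(deriv_in_linear_comp _ _ tc fg).
apply: tangent_deriv0 => //; apply: filterS (near_map_dom fS cp cfp) => y cy ry yb.
by apply/(bd_coord (cy ry)); exact: fb.
Qed.

End Manifold.

(** * A Liouville form near the boundary *)

Section Forms.
Context {R : realType} {m : nat} {F : domain R m}.
Local Notation V := 'rV[R]_m.+1.
Local Notation chartF := (chart (charts F)).
Implicit Types (c : chartF) (p q : F) (a : F -> V -> R).

(** The component of a along the vector field with constant coefficients w in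
    the chart c. *)
Definition rep a c (w : V) (y : V) : R := a (param c y) (tvec c (param c y) w).

Definition chart_d a c q (v w : V) : R :=
  deriv_in (region c) (rep a c w) (coord c q) v
    - deriv_in (region c) (rep a c v) (coord c q) w.

Lemma rep_scalar (S : set F) a c y : smooth_form1 (charts F) S a ->
  region c y -> S (param c y) -> scalar (fun w => rep a c w y).
Proof.
move=> [_ al _] ry Sy k v w; rewrite /rep tvec_linear; last exact: param_cdom.
exact: al.
Qed.

Lemma rep_sum (S : set F) a c y w : smooth_form1 (charts F) S a ->
  region c y -> S (param c y) ->
  rep a c w y = \sum_i w ord0 i * rep a c (delta_mx ord0 i) y.
Proof.
move=> aS ry Sy; rewrite [in LHS](row_sum_delta w).
exact: (scalar_sum _ _ _ _ (rep_scalar aS ry Sy)).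
Qed.

Lemma near_Int c y : region c y -> Int F (param c y) ->
  \forall z \near y, region c z /\ Int F (param c z).
Proof.
move=> ry /(Int_coord (param_cdom ry)); rewrite paramK// => y0.
apply: filterS (interior_region ry y0) => z [rz z0]; split=> //.
by apply/(Int_coord (param_cdom rz)); rewrite paramK.
Qed.

Lemma rep_differentiable a c q w : smooth_form1 (charts F) (Int F) a ->
  Int F q -> cdom c q ->
  differentiable (rep a c w) (coord c q) /\
  forall v, deriv_in (region c) (rep a c w) (coord c q) v = 'D_v (rep a c w) (coord c q).
Proof.
move=> [_ _ aS] Iq cq; have rx := region_coord cq.
have Ix : Int F (param c (coord c q)) by rewrite coordK.
have ximg : (coord c @` (cdom c `&` Int F)) (coord c q) by exists q.
have [U [g [oU Ux gC ag]]] := aS c w _ ximg.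
have ext : extends_at setT (rep a c w) (coord c q) g.
  split=> //; last by have [gd _] := gC 1; exact: gd.
  apply: filterS2 (open_near oU Ux) (near_Int rx Ix) => y Uy [ry Iy] _.
  by apply: ag => //; exact/coord_image.
have [dr dE] : differentiable (rep a c w) (coord c q) /\
    'd (rep a c w) (coord c q) = 'd g (coord c q) :> (V -> R).
  have [_ nE gd] := ext; apply: near_eq_differentiable gd.
  by apply: filterS nE => y; apply.
split; first exact: dr.
move=> v; rewrite deriveE//; apply: deriv_inE; first exact: region_thick.
split=> //; first by near do by [].
Unshelve. all: by end_near. Qed.

Lemma derive_sumM k (f h : 'I_k -> V -> R) x v :
  (forall i, differentiable (f i) x) -> (forall i, differentiable (h i) x) ->
  'D_v (fun y => \sum_i f i y * h i y) x =
  \sum_i ('D_v (f i) x * h i x + f i x * 'd (h i) x v).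
Proof.
move=> fd hd.
have -> : (fun y => \sum_i f i y * h i y) = \sum_i (f i * h i : V -> R).
  by apply: funext => y; rewrite fct_sumE.
rewrite derive_sum; last first.
  by move=> i; apply: derivableM; apply: diff_derivable; [exact: fd|exact: hd].
apply: eq_bigr => i _; rewrite deriveM; [|exact: diff_derivable (fd i)|exact: diff_derivable (hd i)].
by rewrite addrC -(deriveE _ (hd i)) [h i x *: _]mulrC.
Qed.

(** The exterior derivative does not depend on the chart: the second derivatives
    of the change of charts g cancel, being symmetric. *)
Lemma chart_d_change a c c' q v w : smooth_form1 (charts F) (Int F) a ->
  Int F q -> cdom c q -> cdom c' q ->
  chart_d a c q v w =
  chart_d a c' q (map_deriv id c c' q v) (map_deriv id c c' q w).
Proof.
move=> aS Iq cq cq'; set x := coord c q; set x' := coord c' q.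
have rx := region_coord cq; have rx' := region_coord cq'.
have [U [g [oU Ux gC cg]]] := map_smooth smooth_id cq cq'.
have gx : g x = x' by have [_] := cg x Ux rx; rewrite /= coordK.
have gd y : U y -> differentiable g y by have [gd _] := gC 1; exact: gd.
pose gi i := row_coord i \o g.
have giC i k : Ck k U (gi i).
  by have [] := Ck_linear_comp oU (linear_rV_continuous (f := row_coord i)) (gC k).
have giD i y z : U y -> 'D_z (gi i) y = ('D_z g y) ord0 i.
  have [_] := Ck_linear_comp oU (linear_rV_continuous (f := row_coord i)) (gC 1).
  by move=> h Uy; rewrite h.
pose r i := rep a c' (delta_mx ord0 i).
have rd i : differentiable (r i) x' by have [] := rep_differentiable (delta_mx ord0 i) aS Iq cq'.
have Ix : Int F (param c x) by rewrite coordK.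
have Ix' : Int F (param c' x') by rewrite coordK.
have mdE y z : U y -> region c y -> map_deriv id c c' (param c y) z = 'D_z g y.
  move=> Uy ry; rewrite /map_deriv paramK// deriveE; last exact: gd.
  apply: deriv_inE; first exact: region_thick.
  apply: smooth_extends oU Uy gC _ => // z' Uz rz.
  exact: (cg z' Uz rz).2.
(* The components of a in the two charts are related by the derivative of g. *)
have repE z : \forall y \near x, rep a c z y = \sum_i 'D_z (gi i) y * (r i \o g) y.
  apply: filterS2 (open_near oU Ux) (near_Int rx Ix) => y Uy [ry Iy].
  have [cy' gy] := cg y Uy ry.
  have ry' : region c' (g y) by rewrite -gy; exact: region_coord.
  have pE : param c' (g y) = param c y by rewrite -gy coordK.
  have -> : rep a c z y = rep a c' ('D_z g y) (g y).
    by rewrite /rep pE (tvec_change z (param_cdom ry) cy') mdE.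
  rewrite (rep_sum _ aS ry'); last by rewrite pE.
  by apply: eq_bigr => i _; rewrite giD.
have rgd i : differentiable (r i \o g) x.
  by apply: differentiable_comp; [exact: gd|rewrite gx; exact: rd].
have gid i z : differentiable ('D_z (gi i)) x.
  by have [_ /(_ z)[h _]] := giC i 2; exact: h.
have DrepE z t : deriv_in (region c) (rep a c z) x t =
    \sum_i ('D_t ('D_z (gi i)) x * r i x' +
            'D_z (gi i) x * 'd (r i) x' ('D_t g x)).
  have [_ ->] := rep_differentiable z aS Iq cq.
  rewrite (near_eq_derive _ (repE z)) derive_sumM//.
  apply: eq_bigr => i _.
  have rd' : differentiable (r i) (g x) by rewrite gx; exact: rd.
  have dE : 'd (r i \o g) x t = 'd (r i) x' ('D_t g x).
    rewrite (deriveE t (gd x Ux)) -gx.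
    have e := congr1 (fun h : V -> R => h t) (diff_comp (gd x Ux) rd').
    exact: etrans e _.
  have rE : (r i \o g) x = r i x' by rewrite -gx.
  have congrDM (A B B' C D D' : R) : B = B' -> D = D' -> A * B + C * D = A * B' + C * D'.
    by move=> -> ->.
  exact: congrDM rE dE.
have DrepE' z t : deriv_in (region c') (rep a c' z) x' t =
    \sum_i z ord0 i * 'd (r i) x' t.
  have [_ ->] := rep_differentiable z aS Iq cq'.
  rewrite (@near_eq_derive _ _ _ _ (fun y => \sum_i cst (z ord0 i) y * r i y)).
    rewrite (derive_sumM _ (fun i => differentiable_cst _ _) rd).
    apply: eq_bigr => i _; rewrite -[RHS]add0r -[X in _ = X + _](mul0r (r i x')).
    congr (_ * _ + _); exact: derive_cst.
  apply: filterS (near_Int rx' Ix') => y [ry Iy].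
  exact: rep_sum aS ry Iy.
have mE z : map_deriv id c c' q z = 'D_z g x by rewrite -(mdE x z Ux rx) coordK.
have subE (A A' B B' : R) : A = A' -> B = B' -> A - B = A' - B' by move=> -> ->.
apply: etrans (subE _ _ _ _ (DrepE w v) (DrepE v w)) _.
apply: etrans (esym (subE _ _ _ _ (DrepE' _ _) (DrepE' _ _))).
rewrite !mE -!sumrB; apply: eq_bigr => i _.
rewrite (derive_symmetric v w oU Ux (giC i 2)) !(giD _ _ _ Ux).
by rewrite opprD addrACA subrr add0r.
Qed.

End Forms.

Section Expansion.
Context {R : realType} {m : nat} {F : domain R m}.
Local Notation V := 'rV[R]_m.+1.
Local Notation chartF := (chart (charts F)).
Implicit Types (c : chartF) (p q : F).

(** In the chart c, u^2 omega = u mu + al /\ nu near p, where al, nu and mu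
    represent b, du and db and make sense on a neighborhood of coord c p. *)
Record expansion (omega : F -> V -> V -> R) (u : F -> R) (b : F -> V -> R) c p
    (gu : V -> R) (al nu : V -> V -> R) (mu : V -> V -> V -> R) : Prop := {
  exp_u : \forall y \near coord c p, region c y -> u (param c y) = gu y;
  exp_omega : \forall y \near coord c p, region c y -> Int F (param c y) ->
    forall v w,
    gu y ^+ 2 * omega (param c y) (tvec c (param c y) v) (tvec c (param c y) w) =
    gu y * mu y v w + (al y v * nu y w - al y w * nu y v);
  exp_u_cvg : gu @ coord c p --> gu (coord c p);
  exp_al_cvg : forall v, al ^~ v @ coord c p --> al (coord c p) v;
  exp_nu_cvg : forall v, nu ^~ v @ coord c p --> nu (coord c p) v;
  exp_mu_cvg : forall v w, (fun y => mu y v w) @ coord c p --> mu (coord c p) v w;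
  exp_al_scalar : forall y, scalar (al y);
  exp_nu_scalar : forall y, scalar (nu y);
  exp_mu_bilinear : forall y, bilinear (mu y);
  exp_mu_anti : forall y v w, mu y v w = - mu y w v;
  exp_al : forall v, al (coord c p) v = b p (tvec c p v);
  exp_nu : forall v, nu (coord c p) v = differential (charts F) u p (tvec c p v);
  exp_mu : forall v w, mu (coord c p) v w = chart_d b c p v w }.

Lemma form_smooth (b : F -> V -> R) c p w : smooth_form1 (charts F) setT b ->
  cdom c p -> exists U (g : V -> R), [/\ open U, U (coord c p), forall k, Ck k U g &
    forall y, U y -> region c y -> rep b c w y = g y].
Proof.
move=> [_ _ bS] cp; have ximg : (coord c @` (cdom c `&` setT)) (coord c p) by exists p.
have [U [g [oU Ux gC bg]]] := bS c w _ ximg; exists U, g; split=> // y Uy ry.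
by apply: bg => //; apply/coord_image.
Qed.

Lemma near_Ck (U : set V) (g : V -> R) x v : open U -> U x -> (forall k, Ck k U g) ->
  (fun y => 'd g y v : R) @ x --> ('d g x v : R).
Proof.
move=> oU Ux gC; have [gd gC'] := gC 1.
have Dc : 'D_v g @ x --> 'D_v g x by exact: gC'.
have DE : {near nbhs x, 'D_v g =1 fun y => 'd g y v}.
  by apply: filterS (open_near oU Ux) => y Uy; exact: deriveE (gd y Uy).
have cv : (fun y => 'd g y v : R) @ x --> 'D_v g x.
  exact: cvg_trans (near_eq_cvg DE) Dc.
have e : 'D_v g x = 'd g x v by exact: deriveE (gd x Ux).
exact: (ecast z ((fun y => 'd g y v : R) @ x --> z) e cv).
Qed.

Lemma derive_sum_cst k (z : 'I_k -> R) (h : 'I_k -> V -> R) x v :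
  (forall i, differentiable (h i) x) ->
  'D_v (fun y => \sum_i z i * h i y) x = \sum_i z i * 'd (h i) x v.
Proof.
move=> hd; apply: etrans (derive_sumM v (fun i => differentiable_cst (z i) x) hd) _.
apply: eq_bigr => i _; rewrite -[RHS]add0r -[X in _ = X + _](mul0r (h i x)).
congr (_ * _ + _); exact: derive_cst.
Qed.

Lemma cvg_sum_cst (T : Type) (G : set_system T) (FG : Filter G) k (z : 'I_k -> R)
    (h : 'I_k -> T -> R) (a : 'I_k -> R) : (forall i, h i @ G --> a i) ->
  (fun y => \sum_i z i * h i y) @ G --> \sum_i z i * a i.
Proof.
move=> ha; apply: cvg_big => [|i _]; first exact: add_continuous.
exact: cvgM (cvg_cst _) (ha i).
Qed.

Lemma derive_quotient (f g : V -> R) x v : differentiable f x -> differentiable g x ->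
  g x != 0 ->
  'D_v (fun y => f y / g y) x = ('D_v f x * g x - f x * 'D_v g x) / g x ^+ 2.
Proof.
move=> fd gd g0; have gVd : derivable (fun y => (g y)^-1) x v.
  by apply: derivableV => //; exact: diff_derivable.
have fd' : derivable f x v by exact: diff_derivable.
have -> : (fun y => f y / g y) = f * (fun y => (g y)^-1) by [].
have gd' : derivable g x v by exact: diff_derivable.
rewrite (deriveM fd' gVd) (deriveV g0 gd').
rewrite -[_ *: ('D_v f x)]/(_ * _) -[_ *: (_ *: _)]/(_ * (_ * _)).
by move: ('D_v f x) ('D_v g x) (f x) (g x) g0 => A B C D D0; field.
Qed.

(** On the interior l = b / u, so that u^2 dl = u db + b /\ du. The components of
    b on the basis fields extend smoothly across the boundary. *)
Lemma liouville_expansion omega l u b c p :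
  smooth_form1 (charts F) (Int F) l ->
  (forall q, Int F q -> dform1 (charts F) l q = omega q) ->
  boundary_function u -> smooth_form1 (charts F) setT b ->
  (forall q, Int F q -> forall v, b q v = u q * l q v) ->
  cdom c p -> exists gu al nu mu, expansion omega u b c p gu al nu mu.
Proof.
move=> lS lw uB bS bul cp; have [uS u0 ubd _] := uB.
have rx := region_coord cp; set x := coord c p.
have [Uu [gu [oUu Uux guC guE]]] := fun_smooth uS cp.
have [Ub UbP] := choice (fun i : 'I_m.+1 => form_smooth (delta_mx ord0 i) bS cp).
have {UbP} [gb gbP] := choice UbP.
pose P y := Uu y /\ forall i, Ub i y.
have Pnear y : P y -> \forall z \near y, P z.
  move=> [Uy Uby].
  have Pb : \forall z \near y, forall i, Ub i z.
    have h i : \forall z \near y, Ub i z.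
      by have [oU _ _ _] := gbP i; exact: open_near oU (Uby i).
    exact: (filter_forall _ h).
  exact: filterI (open_near oUu Uy) Pb.
have Px : P x by split=> // i; have [] := gbP i.
have gud y : P y -> differentiable gu y.
  by move=> [Uy _]; have [gd _] := guC 1; exact: gd.
have gbd i y : P y -> differentiable (gb i) y.
  by move=> [_ /(_ i) Uy]; have [_ _ /(_ 1)[gd _] _] := gbP i; exact: gd.
pose al (y w : V) : R := \sum_i w ord0 i * gb i y.
pose nu (y v : V) : R := 'd gu y v.
pose be (y w v : V) : R := \sum_i w ord0 i * 'd (gb i) y v.
have alE y w : P y -> region c y -> rep b c w y = al y w.
  move=> [_ Uy] ry; rewrite (rep_sum w bS ry)//; apply: eq_bigr => i _.
  by have [_ _ _ h] := gbP i; rewrite h.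
have beE y w v : P y -> 'D_v (al ^~ w) y = be y w v.
  by move=> Py; apply: derive_sum_cst => i; exact: gbd.
have ald y w : P y -> differentiable (al ^~ w) y.
  move=> Py; have -> : al ^~ w = \sum_i (cst (w ord0 i) * gb i : V -> R).
    by apply: funext => z; rewrite fct_sumE.
  by apply: differentiable_sum => i; apply: differentiableM; [exact: differentiable_cst|exact: gbd].
have alx w : al x w = b p (tvec c p w).
  by rewrite -(alE _ _ Px rx) /rep coordK.
have be_scalar y w : scalar (be y w).
  move=> k v1 v2; rewrite /be mulr_sumr -big_split /=; apply: eq_bigr => i _.
  by rewrite linearP mulrDr [in LHS]mulrCA.
have be_scalar' y v : scalar (be y ^~ v).
  move=> k v1 v2; rewrite /be mulr_sumr -big_split /=; apply: eq_bigr => i _.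
  by rewrite !mxE mulrDl mulrA.
exists gu, al, nu, (fun y v w => be y w v - be y v w); split.
- by apply: filterS (Pnear x Px) => y [Uy _]; exact: guE.
- apply: filterS (Pnear x Px) => y Py ry Iy v w; set q := param c y.
  have cq := param_cdom ry; have guq : u q = gu y by exact: guE Py.1 ry.
  have u_neq0 q' : Int F q' -> u q' != 0 by move=> Iq'; apply/eqP => /ubd.
  have gu_neq0 : gu y != 0 by rewrite -guq; exact: u_neq0.
  have -> : omega q (tvec c q v) (tvec c q w) = chart_d l c q v w.
    apply: etrans (esym (chart_d_change v w lS Iy cq (pref_cdom q))).
    have e : omega q = dform1 (charts F) l q by rewrite lw.
    by rewrite e; reflexivity.
  have DE z t : deriv_in (region c) (rep l c z) (coord c q) t =
      (be y z t * gu y - al y z * nu y t) / gu y ^+ 2.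
    have [_ ->] := rep_differentiable z lS Iy cq; rewrite (paramK ry).
    have lE : \forall z' \near y, rep l c z z' = al z' z / gu z'.
      apply: filterS2 (Pnear y Py) (near_Int ry Iy) => z' Pz' [rz' Iz'].
      rewrite -(alE _ _ Pz' rz') -(guE _ Pz'.1 rz') /rep (bul _ Iz').
      by rewrite mulrC mulKf//; exact: u_neq0.
    rewrite (near_eq_derive t lE).
    rewrite (derive_quotient t (ald y z Py) (gud y Py) gu_neq0).
    by rewrite (beE y z t Py) (deriveE t (gud y Py)).
  rewrite /chart_d !DE.
  move: (be y w v) (be y v w) (al y v) (al y w) (nu y v) (nu y w) (gu y) gu_neq0.
  by move=> B1 B2 A1 A2 N1 N2 G G0; field.
- exact: differentiable_continuous (gud x Px).
- by move=> v; exact: differentiable_continuous (ald x v Px).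
- by move=> v; exact: near_Ck oUu Uux guC.
- have bec w v : (fun y => be y w v) @ x --> be x w v.
    have gbc i : (fun y => 'd (gb i) y v : R) @ x --> ('d (gb i) x v : R).
      by have [oU Ux gC _] := gbP i; exact: near_Ck oU Ux gC.
    exact: cvg_sum_cst gbc.
  by move=> v w; exact: cvgB (bec w v) (bec v w).
- move=> y k v1 v2; rewrite /al mulr_sumr -big_split /=; apply: eq_bigr => i _.
  by rewrite !mxE mulrDl mulrA.
- by move=> y k v1 v2; rewrite /nu linearP.
- move=> y; split=> v k v1 v2.
    by rewrite (be_scalar' y v k v1 v2) (be_scalar y v k v1 v2) mulrBr opprD addrACA.
  by rewrite (be_scalar' y v k v1 v2) (be_scalar y v k v1 v2) mulrBr opprD addrACA.
- by move=> y v w; rewrite opprB.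
- exact: alx.
- move=> v; rewrite (differential_tvec v uS cp) /nu.
  apply/esym; apply: deriv_inE; first exact: region_thick.
  exact: smooth_extends rx oUu Uux guC guE.
- move=> v w; rewrite /chart_d.
  have E z t : deriv_in (region c) (rep b c z) (coord c p) t = be x z t.
    rewrite -(beE x z t Px) (deriveE t (ald x z Px)).
    apply: deriv_inE; first exact: region_thick.
    split=> //; last exact: ald.
    by apply: filterS (Pnear x Px) => y Py; exact: alE.
  by rewrite !E.
Qed.

End Expansion.

(** * The contact structure is determined by the Liouville structure *)

Section JointLimits.
Context {R : realType} {m : nat} {T : Type} {G : set_system T} {FG : Filter G}.
Local Notation V := 'rV[R]_m.

Lemma scalar_cvg (a : T -> V -> R) (A : V -> R) (z : T -> V) (Z : V) :
  (forall t, scalar (a t)) -> scalar A ->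
  (forall v, a ^~ v @ G --> A v) -> (forall i, (fun t => z t ord0 i) @ G --> Z ord0 i) ->
  (fun t => a t (z t)) @ G --> A Z.
Proof.
move=> al Al aA zZ.
have sumE (c : V -> R) v : scalar c -> c v = \sum_i v ord0 i * c (delta_mx ord0 i).
  by move=> cl; rewrite [in LHS](row_sum_delta v) (scalar_sum _ _ _ _ cl).
rewrite (sumE A)// (_ : (fun t => a t (z t)) =
    fun t => \sum_i z t ord0 i * a t (delta_mx ord0 i)); last first.
  by apply: funext => t; exact: sumE.
apply: cvg_big => [|i _]; first exact: add_continuous.
exact: cvgM (zZ i) (aA _).
Qed.

Lemma bilinear_cvg (b : T -> V -> V -> R) (B : V -> V -> R) (y z : T -> V) (Y Z : V) :
  (forall t, bilinear (b t)) -> bilinear B ->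
  (forall v w, (fun t => b t v w) @ G --> B v w) ->
  (forall i, (fun t => y t ord0 i) @ G --> Y ord0 i) ->
  (forall i, (fun t => z t ord0 i) @ G --> Z ord0 i) ->
  (fun t => b t (y t) (z t)) @ G --> B Y Z.
Proof.
move=> bl Bl bB yY zZ.
apply: (@scalar_cvg (fun t v => b t v (z t)) (B ^~ Z)) => //.
- by move=> t; exact: (bl t).2.
- exact: Bl.2.
move=> v; apply: (@scalar_cvg (fun t => b t v) (B v)) => //.
- by move=> t; exact: (bl t).1.
- exact: Bl.1.
Qed.

End JointLimits.

Section Comparison.
Context {R : realType} {m : nat} {F : domain R m}.
Local Notation V := 'rV[R]_m.+1.
Local Notation chartF := (chart (charts F)).
Local Notation At := (charts F).
Implicit Types (c : chartF) (p q : F).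
Local Notation e0 := (delta_mx ord0 ord0 : V).

(** The primitive is hidden: two such pairs for the same omega may come from
    primitives that are not related. *)
Definition liouville_pair (omega : F -> V -> V -> R) (u : F -> R) (b : F -> V -> R) :=
  boundary_function u /\ smooth_form1 At setT b /\ exists l : F -> V -> R,
  [/\ smooth_form1 At (Int F) l,
      forall q, Int F q -> dform1 At l q = omega q &
      forall q, Int F q -> forall v, b q v = u q * l q v].

Lemma liouville_pair_expansion omega u b c p : liouville_pair omega u b ->
  cdom c p -> exists gu al nu mu, expansion omega u b c p gu al nu mu.
Proof.
by move=> [uB [bS [l [lS lw bul]]]] cp; exact: liouville_expansion lS lw uB bS bul cp.
Qed.

(** A curve entering the interior transversely. *)
Lemma inward_path c x : region c x ->
  (fun t : R => x + t *: e0) @ (0 : R)^'+ --> within (region c) (nbhs x) /\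
  \forall t \near (0 : R)^'+, region c (x + t *: e0) /\ Int F (param c (x + t *: e0)).
Proof.
move=> rx; have x0 := region_halfspace rx; rewrite /halfspace /= in x0.
have reg : \forall t \near (0 : R)^'+, region c (x + t *: e0).
  apply: halfspace_right => //; first exact: near_region.
  by rewrite mxE !eqxx.
split.
  move=> A /= xA; have := near_line_right e0 xA.
  by move=> Al; apply: filterS2 reg Al => t rt; apply.
have pos : \forall t \near (0 : R)^'+, 0 < t by exact: nbhs_right_gt.
apply: filterS2 reg pos => t rt t0; split=> //.
apply/(Int_coord (param_cdom rt)); rewrite paramK// !mxE !eqxx mulr1.
exact: ltr_wpDl.
Qed.

(** As u vanishes on the boundary, du vanishes on tangent vectors. *)
Lemma differential_boundary (u : F -> R) p v : boundary_function u -> bd F p ->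
  differential At u p v = v ord0 ord0 * differential At u p e0.
Proof.
move=> [uS _ ubd _] pb; have dl := differential_scalar p uS.
rewrite -(scalarZ _ _ dl); apply/eqP; rewrite -subr_eq0.
have -> : differential At u p v - differential At u p (v ord0 ord0 *: e0) =
    differential At u p (v - v ord0 ord0 *: e0).
  by rewrite addrC -mulN1r -dl scaleN1r addrC.
apply/eqP; apply: tangent_deriv0 => //; first exact: pref_cdom.
  by rewrite !mxE !eqxx mulr1 subrr.
by near do by move=> _ /ubd.
Unshelve. all: by end_near. Qed.

(** Regularity of u makes du nonzero on a transverse vector, and its sign is that
    of u. *)
Lemma differential_inward (u : F -> R) p : boundary_function u -> bd F p ->
  0 < differential At u p e0.
Proof.
move=> uB pb; have [uS u0 ubd /(_ p pb)[v dv]] := uB.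
rewrite lt_neqAle eq_sym; apply/andP; split.
  by move: dv; rewrite (differential_boundary _ uB pb) mulf_eq0 negb_or => /andP[].
have cp := pref_cdom p; have [g ug] := fun_extends uS cp.
rewrite /differential (deriv_inE _ (region_thick (region_coord cp)) ug).
apply: deriv_in_ge0 ug _ _.
  by have [_ h] := inward_path (region_coord cp); apply: filterS h => t [].
by near do by move=> _; rewrite /= coordK// (ubd p).2.
Unshelve. all: by end_near. Qed.

Lemma preserves_Int (omega : F -> V -> V -> R) f q : preserves omega f ->
  Int F q -> Int F (f q).
Proof. by move=> [fI _] Iq; rewrite -fI; exists q. Qed.

Lemma preserves_bd (omega : F -> V -> V -> R) f q : diffeomorphism f ->
  preserves omega f -> bd F q -> bd F (f q).
Proof.
move=> [_ [g [_ fK _]]] [fI _] qb; apply: contrapT => Ifq.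
have : Int F (f q) by [].
rewrite -fI => -[q' Iq' fq].
by move/(congr1 g): fq; rewrite !fK => qq; move: Iq'; rewrite qq; apply.
Qed.

Lemma tmapK f g p v : smooth_map At At f -> smooth_map At At g -> cancel g f ->
  tmap At At f (g p) (tmap At At g p v) = v.
Proof.
move=> fS gS gK; rewrite !tmapE -map_deriv_comp//; [|exact: pref_cdom..].
have -> : f \o g = id by apply: funext => q; exact: gK.
by rewrite gK; exact: map_deriv_id (pref_cdom p).
Qed.

End Comparison.

Section Compare.
Context {R : realType} {m : nat} {F : domain R m}.
Local Notation V := 'rV[R]_m.+1.
Local Notation At := (charts F).
Implicit Types (p q : F).
Local Notation e0 := (delta_mx ord0 ord0 : V).

(** The form u^2 omega = u db + b /\ du extends to the boundary, where it is
    b /\ du. *)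
Lemma rescaled_limit omega u b p (T : Type) (G : set_system T) {FG : Filter G}
    c gu al nu mu (y : T -> V) (Y Z : V) (z z' : T -> V) :
  expansion omega u b c p gu al nu mu -> gu (coord c p) = 0 ->
  y @ G --> coord c p ->
  (forall i, (fun t => z t ord0 i) @ G --> Y ord0 i) ->
  (forall i, (fun t => z' t ord0 i) @ G --> Z ord0 i) ->
  (\forall t \near G, region c (y t) /\ Int F (param c (y t))) ->
  (fun t => u (param c (y t)) ^+ 2 * omega (param c (y t))
     (tvec c (param c (y t)) (z t)) (tvec c (param c (y t)) (z' t))) @ G -->
  al (coord c p) Y * nu (coord c p) Z - al (coord c p) Z * nu (coord c p) Y.
Proof.
move=> E gu0 yc zY zZ yI; set x := coord c p in gu0 yc *.
have al_c (w : T -> V) (W : V) : (forall i, (fun t => w t ord0 i) @ G --> W ord0 i) ->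
    (fun t => al (y t) (w t)) @ G --> al x W.
  move=> wW; apply: (scalar_cvg (a := fun t => al (y t))) => //.
  - by move=> t; exact: exp_al_scalar E _.
  - exact: exp_al_scalar E _.
  - by move=> v; exact: (@cvg_comp _ _ _ y (al ^~ v) _ _ _ yc (exp_al_cvg E (v := v))).
have nu_c (w : T -> V) (W : V) : (forall i, (fun t => w t ord0 i) @ G --> W ord0 i) ->
    (fun t => nu (y t) (w t)) @ G --> nu x W.
  move=> wW; apply: (scalar_cvg (a := fun t => nu (y t))) => //.
  - by move=> t; exact: exp_nu_scalar E _.
  - exact: exp_nu_scalar E _.
  - by move=> v; exact: (@cvg_comp _ _ _ y (nu ^~ v) _ _ _ yc (exp_nu_cvg E (v := v))).
have mu_c : (fun t => mu (y t) (z t) (z' t)) @ G --> mu x Y Z.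
  apply: (bilinear_cvg (b := fun t => mu (y t))) => //.
  - by move=> t; exact: exp_mu_bilinear E _.
  - exact: exp_mu_bilinear E _.
  - by move=> v w; exact: (cvg_comp _ _ yc (exp_mu_cvg E (v := v) (w := w))).
have gu_c : (fun t => gu (y t)) @ G --> 0.
  by rewrite -gu0; exact: (cvg_comp _ _ yc (exp_u_cvg E)).
have lim : (fun t => gu (y t) * mu (y t) (z t) (z' t) +
      (al (y t) (z t) * nu (y t) (z' t) - al (y t) (z' t) * nu (y t) (z t))) @ G -->
    0 * mu x Y Z + (al x Y * nu x Z - al x Z * nu x Y).
  apply: cvgD; first exact: cvgM gu_c mu_c.
  apply: cvgB; first exact: cvgM (al_c _ _ zY) (nu_c _ _ zZ).
  exact: cvgM (al_c _ _ zZ) (nu_c _ _ zY).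
rewrite mul0r add0r in lim; apply: cvg_trans lim; apply: near_eq_cvg.
have uE := yc _ (exp_u E); have oE := yc _ (exp_omega E).
apply: filterS3 yI uE oE => t [ry Iy] ut ot.
by rewrite ut// ot.
Qed.

Lemma map_deriv_cvg f c c' p v i : smooth_map At At f -> cdom c p -> cdom c' (f p) ->
  (fun y => map_deriv f c c' (param c y) v ord0 i) @ within (region c) (nbhs (coord c p))
  --> map_deriv f c c' p v ord0 i.
Proof.
move=> fS cp cfp; have [U [g [oU Ux gC gE]]] := map_smooth fS cp cfp.
have mE y : U y -> region c y -> 'D_v g y = map_deriv f c c' (param c y) v.
  move=> Uy ry; have [gd _] := gC 1; rewrite (deriveE v (gd y Uy)) /map_deriv paramK//.
  apply/esym; apply: deriv_inE; first exact: region_thick.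
  by apply: smooth_extends ry oU Uy gC _ => z Uz rz; have [] := gE z Uz rz.
have rx := region_coord cp.
have Dc : 'D_v g @ coord c p --> 'D_v g (coord c p).
  by have [_ /(_ v)] := gC 1; apply.
have := cvg_comp _ _ Dc (@matrix_normedtype.coord_continuous R 1 m.+1 ord0 i _).
rewrite (mE _ Ux rx) coordK// => lim.
apply: (@cvg_trans _ ((fun y => 'D_v g y ord0 i) @ within (region c) (nbhs (coord c p)))).
  apply: near_eq_cvg; apply: filterS (open_near oU Ux) => y Uy ry.
  by rewrite mE.
by apply: cvg_trans lim; apply: cvg_app; exact: cvg_within.
Qed.

(** Along a curve entering the interior, u' o f and u are equivalent to k' t and
    k t, with k, k' > 0, and f preserves omega. So the extensions of u^2 omega and
    u'^2 omega satisfy f^*(b' /\ du') = h^2 b /\ du for h = k' / k. Since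
    f^*(du') = h du, contracting with a vector on which du is not 0 gives
    f^*b' = h b on vectors tangent to the boundary. *)
Lemma comparison (omega : F -> V -> V -> R) u b u' b' f p :
  liouville_pair omega u b -> liouville_pair omega u' b' ->
  diffeomorphism f -> preserves omega f -> bd F p ->
  exists2 h : R, 0 < h &
    (forall w : V, w ord0 ord0 = 0 -> b' (f p) (tmap At At f p w) = h * b p w) /\
    (forall v, differential At u' (f p) (tmap At At f p v) =
               h * differential At u p v).
Proof.
move=> P P' fD fP pb; have fpb := preserves_bd fD fP pb.
have [uB _] := P; have [uB' _] := P'; have [fS [g [gS fK gK]]] := fD.
have [uS u0 ubd _] := uB; have [uS' u0' ubd' ud'] := uB'.
pose c := pref At p; pose c' := pref At (f p).
have cp : cdom c p := pref_cdom p; have cfp : cdom c' (f p) := pref_cdom (f p).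
have rx := region_coord cp.
have [gu [al [nu [mu E]]]] := liouville_pair_expansion P cp.
have [gu' [al' [nu' [mu' E']]]] := liouville_pair_expansion P' cfp.
have gux : gu (coord c p) = 0.
  by rewrite -(nbhs_singleton (exp_u E) rx) coordK//; exact/ubd.
have gux' : gu' (coord c' (f p)) = 0.
  by rewrite -(nbhs_singleton (exp_u E') (region_coord cfp)) coordK//; exact/ubd'.
have [yc yI] := inward_path rx.
pose y (t : R) := coord c p + t *: e0; pose q t := param c (y t).
have yc0 : y @ (0 : R)^'+ --> coord c p by exact: cvg_trans yc (cvg_within _).
pose k := differential At u p e0.
pose k' := differential At u' (f p) (tmap At At f p e0).
have k0 : 0 < k by exact: differential_inward.
(* f preserves the boundary, so f_* keeps tangent vectors tangent; hence
   du' (f_* v) depends only on the transverse component of v. *)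
have tang (v : V) : v ord0 ord0 = 0 -> tmap At At f p v ord0 ord0 = 0.
  move=> v0; rewrite tmapE; apply: map_deriv_tangent => // q' qb.
  exact: preserves_bd fD fP qb.
have du'E (v : V) : differential At u' (f p) (tmap At At f p v) = v ord0 ord0 * k'.
  have dl := differential_scalar (f p) uS'.
  have tl : linear (tmap At At f p) by exact: map_deriv_linear.
  have -> : v = v ord0 ord0 *: e0 + (v - v ord0 ord0 *: e0) by rewrite addrC subrK.
  rewrite tl dl -/k' [X in _ + X = _](differential_boundary _ uB' fpb) tang.
    by rewrite mul0r addr0 !mxE !eqxx mulr1 addrC subrK.
  by rewrite !mxE !eqxx mulr1 subrr.
have [gf gfE] := map_extends fS cp cfp.
have [l lE] := fun_extends uS' cfp.
have ufE := map_comp_extends fS cp cfp gfE lE.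
have k'E : 'd (l \o gf) (coord c p) e0 = k'.
  rewrite -(deriv_inE _ (region_thick rx) ufE) (differential_comp _ uS' fS cp).
  by rewrite tvec_pref.
have reg : \forall t \near (0 : R)^'+, region c (coord c p + t *: e0).
  by apply: filterS yI => t [].
have k'0 : 0 < k'.
  rewrite lt_neqAle eq_sym; apply/andP; split.
    have [z] := ud' _ fpb; apply: contraNN => /eqP kz.
    by rewrite -(tmapK (f p) z fS gS gK) fK du'E kz mulr0.
  rewrite -k'E; apply: deriv_in_ge0 ufE reg _.
  by near do by move=> _; rewrite /= coordK// (ubd' (f p)).2.
have uq : (fun t => t^-1 * u (q t)) @ (0 : R)^'+ --> k.
  have [g1 ug1] := fun_extends uS cp.
  have := deriv_in_right reg ug1.
  rewrite -(deriv_inE _ (region_thick rx) ug1) -/(differential At u p e0).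
  apply: cvg_trans; apply: near_eq_cvg; near=> t.
  by rewrite /= coordK// (ubd p).2// subr0.
have uq' : (fun t => t^-1 * u' (f (q t))) @ (0 : R)^'+ --> k'.
  have := deriv_in_right reg ufE; rewrite k'E.
  apply: cvg_trans; apply: near_eq_cvg; near=> t.
  by rewrite /= coordK// (ubd' (f p)).2// subr0.
pose y' t := coord c' (f (q t)).
have yc' : y' @ (0 : R)^'+ --> coord c' (f p).
  have gfc := extends_at_continuous gfE.
  have e : (coord c' \o f \o param c) (coord c p) = coord c' (f p).
    by rewrite /= coordK.
  by rewrite -e; exact: (cvg_comp _ _ yc gfc).
pose z (v : V) t := map_deriv f c c' (q t) v.
have zc v i : (fun t => z v t ord0 i) @ (0 : R)^'+ --> map_deriv f c c' p v ord0 i.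
  exact: (cvg_comp _ _ yc (map_deriv_cvg (v := v) (i := i) fS cp cfp)).
have fq_dom : \forall t \near (0 : R)^'+, cdom c' (f (q t)).
  have dom : \forall t \near (0 : R)^'+, region c (y t) -> cdom c' (f (q t)).
    exact: (yc0 _ (near_map_dom fS cp cfp)).
  by apply: filterS2 dom reg => t dt rt; exact: dt.
have yI' : \forall t \near (0 : R)^'+, region c' (y' t) /\ Int F (param c' (y' t)).
  apply: filterS2 fq_dom yI => t dt [rt It]; rewrite /y' coordK//.
  by split; [exact: region_coord|exact: preserves_Int fP It].
pose B v w := al (coord c p) v * nu (coord c p) w - al (coord c p) w * nu (coord c p) v.
pose B' v w := al' (coord c' (f p)) v * nu' (coord c' (f p)) w -
  al' (coord c' (f p)) w * nu' (coord c' (f p)) v.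
(* Two computations of the limit of (u' o f)^2 u^2 omega / t^2 along the curve. *)
have BB' v w : k' ^+ 2 * B v w =
    k ^+ 2 * B' (map_deriv f c c' p v) (map_deriv f c c' p w).
  have cst_c (v' : V) i : (fun _ : R => v' ord0 i) @ (0 : R)^'+ --> v' ord0 i.
    exact: cvg_cst.
  have FG : Filter ((0 : R)^'+) by exact: filter_filter.
  have L1 := rescaled_limit (FG := FG) (z := fun=> v) (z' := fun=> w) E gux yc0
    (cst_c v) (cst_c w) yI.
  have L2 := rescaled_limit (FG := FG) E' gux' yc' (zc v) (zc w) yI'.
  have M1 := cvgM (cvgM uq' uq') L1; have M2 := cvgM (cvgM uq uq) L2.
  pose X t := t^-1 * u' (f (q t)) * (t^-1 * u' (f (q t))) *
    (u (q t) ^+ 2 * omega (q t) (tvec c (q t) v) (tvec c (q t) w)).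
  pose Y t := t^-1 * u (q t) * (t^-1 * u (q t)) * (u' (param c' (y' t)) ^+ 2 *
    omega (param c' (y' t)) (tvec c' (param c' (y' t)) (z v t))
      (tvec c' (param c' (y' t)) (z w t))).
  rewrite !expr2.
  have XY : {near (0 : R)^'+, Y =1 X}.
    apply: filterS2 fq_dom yI => t dt [rt It].
    have cqt : cdom c (q t) by exact: param_cdom.
    rewrite /X /Y (_ : param c' (y' t) = f (q t)); last by rewrite /y' coordK.
    rewrite -(fP.2 (q t) It) !(tmap_tvec _ fS cqt dt) -/(z v t) -/(z w t).
    by move: (omega _ _ _) (u _) (u' _) (t^-1) => W1 W2 W3 s; ring.
  have M3 : X @ (0 : R)^'+ --> k * k * B' (map_deriv f c c' p v) (map_deriv f c c' p w).
    have M2' : Y @ (0 : R)^'+ --> k * k * B' (map_deriv f c c' p v) (map_deriv f c c' p w).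
      exact: M2.
    exact: cvg_trans (@near_eq_cvg _ _ _ FG _ _ XY) M2'.
  have M1' : X @ (0 : R)^'+ --> k' * k' * B v w by exact: M1.
  by rewrite -(cvg_lim (@norm_hausdorff _ _) M1') (cvg_lim (@norm_hausdorff _ _) M3).
exists (k' / k); first exact: divr_gt0.
split=> [w w0|v]; last first.
  by rewrite du'E (differential_boundary v uB pb) -/k mulrCA divfK ?gt_eqF.
have := BB' w e0.
rewrite /B /B' !(exp_al E) !(exp_nu E) !(exp_al E') !(exp_nu E') !tvec_pref.
rewrite -!tmapE (differential_boundary w uB pb) w0 mul0r mulr0 subr0 -/k.
rewrite !du'E w0 mul0r mulr0 subr0 mxE !eqxx mul1r.
move: (b p w) (b' (f p) _) => x1 x2 xE.
apply: (@mulfI _ (k ^+ 2 * k')).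
  by rewrite mulf_neq0 ?expf_neq0 ?gt_eqF.
have k_neq0 : k != 0 by rewrite gt_eqF.
move: k k' x1 x2 xE k_neq0 {k0 k'0 k'E uq uq' du'E BB'} => K K' X1 X2 XE K0.
rewrite (_ : K ^+ 2 * K' * X2 = K' ^+ 2 * (X1 * K)); first by field.
by rewrite XE; ring.
Unshelve. all: by end_near. Qed.

End Compare.

(** * The boundary as a manifold *)

Section BoundaryAtlas.
Context {R : realType} {m : nat} {F : domain R m.+1}.
Local Notation V := 'rV[R]_m.+2.
Local Notation VK := 'rV[R]_m.+1.
Local Notation At := (charts F).
Local Notation AtK := (bd_atlas F).
Implicit Types (c : chart (charts F)) (p q : F).

Definition bd_region c : set VK := @region R F m AtK c.

Lemma bd_regionE c (y : VK) : bd_region c y <-> region c (wall y).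
Proof.
split=> [[q [cq qb] <-]|ry].
  rewrite (unwallK (x := coord c q)); first exact: region_coord.
  by apply/(bd_coord cq).
exists (param c (wall y)); last by rewrite /= paramK//; exact: wallK.
split; first exact: param_cdom.
by apply/(bd_coord (param_cdom ry)); rewrite paramK// wall0.
Qed.

Lemma bd_param c (y : VK) : bd_region c y ->
  cdom c (param c (wall y)) /\ bd F (param c (wall y)).
Proof.
move=> /bd_regionE ry; split; first exact: param_cdom.
by apply/(bd_coord (param_cdom ry)); rewrite paramK// wall0.
Qed.

Lemma wall_cvg (y : VK) : (@wall R m.+1) @ y --> wall y.
Proof. exact: linear_rV_continuous. Qed.

Lemma near_bd_region c y : bd_region c y -> \forall z \near y, bd_region c z.
Proof.
move=> /bd_regionE ry; 
have nr : \forall z \near y, halfspace (wall z) -> region c (wall z).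
  exact: wall_cvg (near_region ry).
by apply: filterS nr => z h; apply/bd_regionE; apply: h; rewrite /halfspace /= wall0.
Qed.

Lemma bd_region_thick c y : bd_region c y -> thick (bd_region c) y.
Proof. by move=> ry; apply: open_thick; exact: near_bd_region. Qed.

Lemma wall_coord c p : cdom c p -> bd F p -> wall (unwall (coord c p)) = coord c p.
Proof. by move=> cp pb; apply: unwallK; apply/(bd_coord cp). Qed.

Lemma bd_region_coord c p : cdom c p -> bd F p -> bd_region c (unwall (coord c p)).
Proof.
by move=> cp pb; apply/bd_regionE; rewrite wall_coord//; exact: region_coord.
Qed.

(** Functions on the boundary are handled as restrictions g o wall of functions
    on F read in a chart. *)
Lemma extends_wall (W : normedModType R) (f : VK -> W) (g : V -> W) c y l :
  (forall z, bd_region c z -> f z = g (wall z)) -> bd_region c y ->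
  extends_at (region c) g (wall y) l ->
  extends_at (bd_region c) f y (l \o @wall R m.+1).
Proof.
move=> fg ry gl.
have ext : extends_at (bd_region c) (g \o @wall R m.+1) y (l \o @wall R m.+1).
  apply: extends_at_comp (linear_extends _ ry) gl _.
  by near do by move/bd_regionE.
apply: extends_at_subset ext; first by [].
by near do by move=> rz; split => //; exact: fg.
Unshelve. all: by end_near. Qed.

Lemma deriv_in_wall (W : normedModType R) (f : VK -> W) (g : V -> W) c y l v :
  (forall z, bd_region c z -> f z = g (wall z)) -> bd_region c y ->
  extends_at (region c) g (wall y) l ->
  deriv_in (bd_region c) f y v = deriv_in (region c) g (wall y) (wall v).
Proof.
move=> fg ry gl; have ry' : region c (wall y) by apply/bd_regionE.
rewrite (deriv_inE _ (bd_region_thick ry) (extends_wall fg ry gl)).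
rewrite (deriv_inE _ (region_thick ry') gl).
have wd : differentiable (@wall R m.+1) y.
  by apply: linear_differentiable; exact: linear_rV_continuous.
have ld : differentiable l (wall y) by case: gl.
have e := congr1 (fun d : VK -> W => d v) (diff_comp wd ld).
apply: etrans e _; rewrite /= diff_lin//.
exact: linear_rV_continuous.
Qed.

Lemma bd_map_deriv (f : F -> F) c c' p v : smooth_map At At f -> cdom c p ->
  cdom c' (f p) -> bd F p ->
  deriv_in (bd_region c) (@coord R F m AtK c' \o f \o @param R F m AtK c)
    (unwall (coord c p)) v = unwall (map_deriv f c c' p (wall v)).
Proof.
move=> fS cp cfp pb; have [g fg] := map_extends fS cp cfp.
have ext : extends_at (region c) (@unwall R m.+1 \o (coord c' \o f \o param c))
    (coord c p) (@unwall R m.+1 \o g).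
  apply: (@extends_at_comp _ _ _ _ _ setT) fg _ _; first exact: linear_extends.
  by near do by [].
have rK := bd_region_coord cp pb.
rewrite (deriv_in_wall (g := @unwall R m.+1 \o (coord c' \o f \o param c))
  (l := @unwall R m.+1 \o g))// wall_coord//.
by rewrite (deriv_in_linear_comp _ _ (region_thick (region_coord cp)) fg).
Unshelve. all: by end_near. Qed.

Lemma bd_tvecE c p v : cdom c p -> bd F p ->
  @tvec R F m AtK c p v = unwall (tvec c p (wall v)).
Proof.
by move=> cp pb; exact: bd_map_deriv smooth_id cp (pref_cdom p) pb.
Qed.

Lemma bd_tmapE (f : F -> F) p v : smooth_map At At f -> bd F p ->
  tmap AtK AtK f p v = unwall (tmap At At f p (wall v)).
Proof.
by move=> fS pb; exact: bd_map_deriv fS (pref_cdom p) (pref_cdom (f p)) pb.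
Qed.

Lemma wall_bd_tvec c p v : cdom c p -> bd F p ->
  wall (@tvec R F m AtK c p v) = tvec c p (wall v).
Proof.
move=> cp pb; rewrite bd_tvecE// unwallK// tvecE.
by apply: map_deriv_tangent smooth_id _ cp (pref_cdom p) pb _ => //; exact: wall0.
Qed.

Lemma wall_bd_tmap (f : F -> F) p v : smooth_map At At f ->
  (forall q, bd F q -> bd F (f q)) -> bd F p ->
  wall (tmap AtK AtK f p v) = tmap At At f p (wall v).
Proof.
move=> fS fb pb; rewrite bd_tmapE// unwallK// tmapE.
by apply: map_deriv_tangent fS fb (pref_cdom p) (pref_cdom (f p)) pb _; exact: wall0.
Qed.

Lemma tinclE p v : bd F p -> tincl p v = wall v.
Proof.
move=> pb; have cp := pref_cdom p.
have [g fg] := map_extends smooth_id cp cp.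
have rK := bd_region_coord cp pb.
have gE : extends_at (region (pref At p)) (coord (pref At p) \o id \o param (pref At p))
    (wall (unwall (coord (pref At p) p))) g by rewrite wall_coord.
have E : deriv_in (bd_region (pref At p))
    (coord (pref At p) \o id \o @param R F m AtK (pref At p))
    (unwall (coord (pref At p) p)) v =
  deriv_in (region (pref At p)) (coord (pref At p) \o id \o param (pref At p))
    (wall (unwall (coord (pref At p) p))) (wall v).
  exact: deriv_in_wall (fun z _ => erefl _) rK gE.
rewrite (wall_coord cp pb) in E.
exact: etrans E (map_deriv_id (wall v) cp).
Qed.

Lemma restr_form1E (b : F -> V -> R) p v : bd F p -> restr_form1 b p v = b p (wall v).
Proof.
by move=> pb; rewrite /restr_form1; case: asboolP => // _; rewrite tinclE.
Qed.

Lemma form_extends (b : F -> V -> R) c p w : smooth_form1 At setT b -> cdom c p ->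
  exists g, extends_at (region c) (rep b c w) (coord c p) g.
Proof.
move=> bS cp; have [U [g [oU Ux gC gE]]] := form_smooth w bS cp.
by exists g; exact: smooth_extends (region_coord cp) oU Ux gC gE.
Qed.

Definition bd_rep (a : F -> VK -> R) c (w : VK) (y : VK) : R :=
  a (param c (wall y)) (@tvec R F m AtK c (param c (wall y)) w).

Lemma bd_dform1E (a : F -> VK -> R) p v w : let c := pref At p in
  dform1 AtK a p v w =
  deriv_in (bd_region c) (bd_rep a c w) (unwall (coord c p)) v
  - deriv_in (bd_region c) (bd_rep a c v) (unwall (coord c p)) w.
Proof. by []. Qed.

(** The restriction of b has in the chart of the boundary induced by c the same
    components as b in c, along tangent fields. *)
Lemma dform1_restr (b : F -> V -> R) p v w : smooth_form1 At setT b -> bd F p ->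
  dform1 AtK (restr_form1 b) p v w =
  chart_d b (pref At p) p (wall v) (wall w).
Proof.
move=> bS pb; rewrite bd_dform1E /chart_d; have cp := pref_cdom p.
set c := pref At p in cp *.
have E t z : deriv_in (bd_region c) (bd_rep (restr_form1 b) c z) (unwall (coord c p)) t =
    deriv_in (region c) (rep b c (wall z)) (coord c p) (wall t).
  have [g bg] := form_extends (wall z) bS cp.
  rewrite -[in RHS](wall_coord cp pb); apply: (deriv_in_wall (l := g)).
  - move=> y ry; have [cy yb] := bd_param ry.
    by rewrite /bd_rep restr_form1E// wall_bd_tvec.
  - exact: bd_region_coord.
  - by rewrite wall_coord.
have subE (A A' B B' : R) : A = A' -> B = B' -> A - B = A' - B' by move=> -> ->.
exact: subE (E v w) (E w v).
Qed.

Lemma restr_scalar (b : F -> V -> R) p : smooth_form1 At setT b -> bd F p ->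
  scalar (restr_form1 b p).
Proof.
by move=> [_ bl _] pb a x y; rewrite !restr_form1E// linearP bl.
Qed.

End BoundaryAtlas.

(** * Orientations *)

Section Orientation.
Context {R : realType} {n : nat} {F : domain R (n.*2).+1}.
Local Notation V := 'rV[R]_(n.*2).+2.
Local Notation VK := 'rV[R]_(n.*2).+1.
Local Notation At := (charts F).
Local Notation AtK := (bd_atlas F).
Implicit Types (p q : F).

Lemma contact_vol_restr (b : F -> V -> R) p (e : 'I_(n.*2).+1 -> VK) :
  smooth_form1 At setT b -> bd F p ->
  contact_vol AtK (restr_form1 b) p e =
  wedge (covec1 (b p)) (wedge_exp (chart_d b (pref At p) p) n) (fun i => wall (e i)).
Proof.
move=> bS pb; apply: wedge1_exp_congr => [i|i j]; first exact: restr_form1E.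
exact: dform1_restr.
Qed.

(** Let Om = u^2 omega = u db + b /\ du. Transvections along v replace the
    vectors wall (e j) by vectors on which du vanishes, so that Om is u db on
    them. Contracting with v, which turns Om^(n+1) into (n+1) (Om v) /\ Om^n, one
    can therefore divide by u^n. What remains, S, tends to the value at p of
    - du(v) b /\ db^n, because u tends to 0. *)
Lemma volume_limit (omega : F -> V -> V -> R) u b p (v : V) (e : 'I_(n.*2).+1 -> VK) :
  smooth_form2 At (Int F) omega -> liouville_pair omega u b -> bd F p ->
  v ord0 ord0 < 0 -> exists S : F -> R,
  [/\ S @ p --> - differential At u p v * contact_vol AtK (restr_form1 b) p e &
   \forall q \near p, Int F q -> exists2 k : R, 0 < k &
     wedge_exp (omega q) n.+1
       (fun i => tvec (pref At p) q (vcons v (fun j => wall (e j)) i)) = k * S q].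
Proof.
move=> oS P pb v0; set c := pref At p; have cp : cdom c p := pref_cdom p.
have [uB [bS _]] := P; have [uS u0 ubd _] := uB.
have [gu [al [nu [mu E]]]] := liouville_pair_expansion P cp.
have rx := region_coord cp; set x := coord c p in rx E.
have gux : gu x = 0.
  by rewrite -(nbhs_singleton (exp_u E) rx) coordK//; exact/ubd.
have cc : coord c @ p --> x by exact: coord_cvg.
pose f i := wall (e i).
(* The frame on which du vanishes at the point with coordinates y. *)
pose fx y i := f i + (- (nu y (f i) / nu y v)) *: v.
(* The contraction of Om with v, on vectors killed by du. *)
pose A y (w : V) := gu y * mu y v w - nu y v * al y w.
pose S0 y := wedge (covec1 (A y)) (wedge_exp (mu y) n) (fx y).
exists (fun q => S0 (coord c q)).
have nuv : nu x v < 0.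
  rewrite (exp_nu E) tvec_pref (differential_boundary v uB pb).
  by rewrite pmulr_llt0//; exact: differential_inward.
have nuf i : nu x (f i) = 0.
  by rewrite (exp_nu E) tvec_pref (differential_boundary _ uB pb) wall0 mul0r.
have fxx i : fx x i = f i by rewrite /fx nuf mul0r oppr0 scale0r addr0.
have Al y : scalar (A y).
  move=> k w1 w2; rewrite /A (exp_al_scalar E y) ((exp_mu_bilinear E y).1 v).
  move: (mu y v w1) (mu y v w2) (al y w1) (al y w2) => M1 M2 A1 A2; ring.
split.
  have muxE w w' : mu x w w' = chart_d b c p w w' by exact: exp_mu E _ _.
  have -> : - differential At u p v * contact_vol AtK (restr_form1 b) p e =
      wedge (covec1 (fun w => - nu x v * al x w)) (wedge_exp (mu x) n) f.
    rewrite wedge1Z contact_vol_restr// (exp_nu E) tvec_pref; congr (_ * _).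
    apply: wedge1_exp_congr => [i|i j]; last by rewrite muxE.
    by rewrite (exp_al E) tvec_pref.
  have nuvc : nu ^~ v @ x --> nu x v by exact: (exp_nu_cvg E (v := v)).
  have fxc i j : (fun y => fx y i ord0 j) @ x --> f i ord0 j.
    have nfc : nu ^~ (f i) @ x --> 0 by rewrite -(nuf i); exact: (exp_nu_cvg E (v := f i)).
    have quo : (fun y => - (nu y (f i) / nu y v)) @ x --> (0 : R).
      have vV : (fun y => (nu y v)^-1) @ x --> (nu x v)^-1.
        have nuv0 : nu x v != 0 by rewrite lt_eqF.
        exact: (cvgV nuv0 nuvc).
      rewrite -oppr0 -(mul0r (nu x v)^-1); exact: cvgN (cvgM nfc vV).
    have -> : (fun y => fx y i ord0 j) =
        fun y => f i ord0 j + - (nu y (f i) / nu y v) * v ord0 j.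
      by apply: funext => y; rewrite /fx !mxE.
    rewrite -[X in _ --> X]addr0 -(mul0r (v ord0 j)).
    exact: cvgD (cvg_cst _) (cvgM quo (cvg_cst _)).
  suff S0c : S0 @ x --> wedge (covec1 (fun w => - nu x v * al x w)) (wedge_exp (mu x) n) f.
    exact: (cvg_comp _ _ cc S0c).
  apply: (wedge1_exp_cvg (F := nbhs x) (a := A) (b := mu) (w := fx)) => [i|i j].
    apply: (scalar_cvg (G := nbhs x) (a := A) (A := fun w => - nu x v * al x w)
      (z := fun y => fx y i) (Z := f i)) => //.
      by move=> k w1 w2; rewrite (exp_al_scalar E x) mulrDr mulrCA.
    move=> w; rewrite -[X in _ --> X]add0r -(mul0r (mu x v w)) -gux mulNr.
    apply: cvgB; apply: cvgM.
    - exact: (exp_u_cvg E).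
    - exact: (exp_mu_cvg E (v := v) (w := w)).
    - exact: nuvc.
    - exact: (exp_al_cvg E (v := w)).
  apply: (bilinear_cvg (G := nbhs x) (b := mu) (B := mu x)
    (y := fun y => fx y i) (Y := f i) (z := fun y => fx y j) (Z := f j)) => //.
  - by move=> y; exact: exp_mu_bilinear E y.
  - exact: exp_mu_bilinear E x.
  - by move=> w w'; exact: (exp_mu_cvg E (v := w) (w := w')).
have nuv_near : \forall y \near x, nu y v != 0.
  have nuvc : nu ^~ v @ x --> nu x v by exact: (exp_nu_cvg E (v := v)).
  by apply: filterS (cvgr_lt _ nuvc _ nuv) => y ny; rewrite lt_eqF.
have Ey : \forall y \near x, nu y v != 0 /\ (region c y -> u (param c y) = gu y) /\
    (region c y -> Int F (param c y) -> forall v w,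
    gu y ^+ 2 * omega (param c y) (tvec c (param c y) v) (tvec c (param c y) w) =
    gu y * mu y v w + (al y v * nu y w - al y w * nu y v)).
  exact: filterI nuv_near (filterI (exp_u E) (exp_omega E)).
have Eq : \forall q \near p, _ := cc _ Ey.
apply: filterS2 Eq (near_cdom cp) => q; set y := coord c q => -[nuy [uE oE]] cq Iq.
have ry := region_coord cq; have pE : param c y = q by rewrite /y coordK.
rewrite pE in uE oE; have {}uE := uE ry; have {}oE := oE ry Iq.
have gu0 : 0 < gu y.
  rewrite -uE lt_neqAle u0 andbT eq_sym; apply/eqP => /ubd; exact: Iq.
(* omega = u^-2 Om, and (Om v) /\ Om^n = u^n S. *)
exists ((gu y ^+ 2) ^- n.+1 * (n.+1%:R * gu y ^+ n)).
  by rewrite mulr_gt0 ?invr_gt0 ?exprn_gt0// mulr_gt0 ?ltr0n ?exprn_gt0.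
pose Om w w' := gu y * mu y w w' + (al y w * nu y w' - al y w' * nu y w).
have OmA w w' : Om w w' = - Om w' w.
  rewrite /Om (exp_mu_anti E y w w').
  by move: (mu y w' w) (al y w) (nu y w) (al y w') (nu y w') => *; ring.
have Oml w : scalar (Om w).
  move=> k w1 w2; rewrite /Om (exp_al_scalar E y) (exp_nu_scalar E y).
  rewrite ((exp_mu_bilinear E y).1 w).
  by move: (mu y _ _) (mu y _ _) (al y _) (al y _) (al y _) (nu y _) (nu y _) (nu y _) => *; ring.
have Omb : bilinear Om.
  split=> // w k w1 w2; rewrite OmA Oml opprD -mulrN -!OmA.
  by [].
have -> : wedge_exp (omega q) n.+1 (fun i => tvec c q (vcons v f i)) =
    (gu y ^+ 2) ^- n.+1 * wedge_exp Om n.+1 (vcons v f).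
  rewrite -[LHS](mulKf (x := (gu y ^+ 2) ^+ n.+1)) ?expf_neq0 ?gt_eqF//.
  rewrite -wedge_expZ; congr (_ * _); apply: wedge_exp_congr => i j.
  by rewrite oE.
rewrite -mulrA; congr (_ * _).
pose cf (i : 'I_(n.*2).+2) : R :=
  if unlift ord0 i is Some j then - (nu y (f j) / nu y v) else 0.
have cf0 : cf ord0 = 0 by rewrite /cf unlift_none.
have fm := wedge_exp_multilinear (n := n.+1) Omb.
have fa : antisymmetric (wedge_exp Om n.+1) by exact: (@wedge_antisymmetric _ _ 2 n.*2).
rewrite -(transvection (vcons v f) fm fa cf0).
have -> : (fun i => vcons v f i + cf i *: vcons v f ord0) = vcons v (fx y).
  apply: funext => i; rewrite /cf /vcons unlift_none.
  by case: unlift => [j|]//; rewrite scale0r addr0.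
rewrite wedge_exp_cons// -mulrA; congr (_ * _).
rewrite -wedge1_expZ; apply: wedge1_exp_congr => [i|i j].
  rewrite /Om /A; have -> : nu y (fx y i) = 0.
    rewrite /fx (scalarD _ _ (exp_nu_scalar E y)) (scalarZ _ _ (exp_nu_scalar E y)).
    by rewrite mulNr divfK// subrr.
  by rewrite mulr0 sub0r [al y _ * _]mulrC.
have nfx k : nu y (fx y k) = 0.
  rewrite /fx (scalarD _ _ (exp_nu_scalar E y)) (scalarZ _ _ (exp_nu_scalar E y)).
  by rewrite mulNr divfK// subrr.
by rewrite /Om !nfx !mulr0 subrr addr0.
Qed.

End Orientation.

Section Positivity.
Context {R : realType} {n : nat} {F : domain R (n.*2).+1}.
Local Notation V := 'rV[R]_(n.*2).+2.
Local Notation VK := 'rV[R]_(n.*2).+1.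
Local Notation At := (charts F).
Local Notation AtK := (bd_atlas F).
Local Notation e0 := (delta_mx ord0 ord0 : V).
Implicit Types (p q : F) (c : chart At).

Lemma Int_adherent p (P : F -> Prop) : (\forall q \near p, P q) ->
  exists q, Int F q /\ P q.
Proof.
move=> Pp; have cp := pref_cdom p; have [yc yI] := inward_path (region_coord cp).
have Pt := yc _ (near_param cp Pp).
have reg : \forall t \near (0 : R)^'+, region (pref At p) (coord (pref At p) p + t *: e0).
  by apply: filterS yI => t [].
have [t [[rt It] Ptt]] := filter_ex (filterI yI Pt).
by exists (param (pref At p) (coord (pref At p) p + t *: e0)); split=> //; exact: Ptt.
Qed.

Lemma chart_d_bilinear (omega : F -> V -> V -> R) u b p : liouville_pair omega u b ->
  bilinear (chart_d b (pref At p) p).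
Proof.
move=> P; have [gu [al [nu [mu E]]]] := liouville_pair_expansion P (pref_cdom p).
have -> : chart_d b (pref At p) p = mu (coord (pref At p) p).
  by apply: funext => v; apply: funext => w; rewrite (exp_mu E).
exact: exp_mu_bilinear E _.
Qed.

Lemma dform1_restr_bilinear (omega : F -> V -> V -> R) u b p :
  liouville_pair omega u b -> bd F p ->
  bilinear (dform1 AtK (restr_form1 b) p).
Proof.
move=> P pb; have [uB [bS _]] := P; have [bl br] := chart_d_bilinear p P.
split=> v k w1 w2; rewrite !dform1_restr// linearP; first exact: bl.
exact: br.
Qed.

Lemma contact_vol_multilinear (a : F -> VK -> R) p :
  scalar (a p) -> bilinear (dform1 AtK a p) -> multilinear (contact_vol AtK a p).
Proof.
move=> al da; apply: (@wedge_multilinear R VK 1 n.*2); first exact: covec1_multilinear.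
exact: wedge_exp_multilinear.
Qed.

Lemma form2_bilinear (omega : F -> V -> V -> R) q :
  smooth_form2 At (Int F) omega -> Int F q -> bilinear (omega q).
Proof. by move=> [_ o1 o2 _] Iq; split; [exact: (o1 q Iq).1|exact: o2]. Qed.

(** By volume_limit, for v outward, omega^(n+1) on the frame (v, e) has near p the
    sign of the contact volume of e at p whenever this volume is not 0. If it is
    0 then e is dependent, because the contact volume is not identically 0 at p,
    and omega^(n+1) vanishes on (v, e). *)
Lemma contact_vol_positive (omega : F -> V -> V -> R) u b p (e : 'I_(n.*2).+1 -> VK) :
  smooth_form2 At (Int F) omega -> liouville_pair omega u b -> bd F p ->
  (exists e, contact_vol AtK (restr_form1 b) p e != 0) ->
  0 < contact_vol AtK (restr_form1 b) p e <-> positive_boundary_frame omega p e.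
Proof.
move=> oS P pb [e1 be1]; have [uB [bS _]] := P.
have cp := pref_cdom p.
have frameE v : (fun i => if unlift ord0 i is Some j then tincl p (e j) else v) =
    vcons v (fun j => wall (e j)).
  by apply: funext => i; rewrite /vcons; case: unlift => // j; rewrite tinclE.
have du0 (v : V) : v ord0 ord0 < 0 -> 0 < - differential At u p v.
  move=> v0; rewrite oppr_gt0 (differential_boundary v uB pb) pmulr_llt0//.
  exact: differential_inward.
split=> [be|pos].
  move=> v v0; rewrite frameE.
  have [S [Sc SW]] := volume_limit e oS P pb v0.
  have Spos : \forall q \near p, 0 < S q.
    by apply: (cvgr_gt _ Sc); rewrite mulr_gt0// du0.
  apply: filterS2 Spos SW => q Sq SWq Iq; have [k k0 ->] := SWq Iq.
  by rewrite mulr_gt0.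
have v0 : (- e0) ord0 ord0 < 0 by rewrite !mxE !eqxx oppr_lt0 ltr01.
have {}pos := pos _ v0; rewrite frameE in pos.
have [S [Sc SW]] := volume_limit e oS P pb v0.
rewrite ltNge le_eqVlt; apply/negP => /predU1P[be0|be0].
  have [espan|[c [i0 ci0] ce0]] := span_or_dependent e.
    move: be1; apply/negP/negPn/eqP.
    apply: (top_form_eq0 (e := e)) => //; last exact: (@wedge_antisymmetric _ _ 1 n.*2).
    apply: contact_vol_multilinear; first exact: restr_scalar.
    exact: dform1_restr_bilinear P pb.
  have [q [Iq [Wq cq]]] := Int_adherent (filterI pos (near_cdom cp)).
  have om : multilinear (wedge_exp (omega q) n.+1).
    by apply: wedge_exp_multilinear; exact: form2_bilinear oS Iq.
  have oa : antisymmetric (wedge_exp (omega q) n.+1).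
    exact: (@wedge_antisymmetric _ _ 2 n.*2).
  have c'0 : (vcons 0 c : 'I_(n.*2).+2 -> R) (lift ord0 i0) != 0 by rewrite vconsS.
  have sum0 : \sum_i vcons 0 c i *:
      tvec (pref At p) q (vcons (- e0) (fun j => wall (e j)) i) = 0.
    rewrite big_ord_recl vcons0 scale0r add0r.
    under eq_bigr do rewrite !vconsS.
    have wl : linear (fun w => tvec (pref At p) q (wall w)).
      by move=> a x y; rewrite linearP (tvec_linear cq).
    pose tL : {linear VK -> V} := HB.pack (fun w => tvec (pref At p) q (wall w))
      (GRing.isLinear.Build _ _ _ _ _ wl).
    rewrite (eq_bigr (fun i => tL (c i *: e i))); last by move=> i _; rewrite linearZ.
    by rewrite -linear_sum ce0 linear0.
  by have := Wq Iq; rewrite (dependent_eq0 om oa c'0 sum0) ltxx.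
have Sneg : \forall q \near p, S q < 0.
  by apply: (cvgr_lt _ Sc); rewrite pmulr_rlt0// du0.
have [q [Iq [Wq [Sq SWq]]]] := Int_adherent (filterI pos (filterI Sneg SW)).
have [k k0 Wk] := SWq Iq; have := Wq Iq.
by rewrite Wk pmulr_rgt0// ltNge (ltW Sq).
Qed.

(** * Equations of the same cooriented contact structure *)

Lemma bd_form_smooth (U : set F) (a : F -> VK -> R) c p w : open U ->
  smooth_form1 AtK (bd F `&` U) a -> cdom c p -> bd F p -> U p ->
  exists U' (g : VK -> R), [/\ open U', U' (unwall (coord c p)), forall k, Ck k U' g &
    forall y, U' y -> bd_region c y ->
      (bd F `&` U) (param c (wall y)) /\ bd_rep a c w y = g y].
Proof.
move=> oU [_ _ aS] cp pb Up; have rK := bd_region_coord cp pb.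
have nU : \forall y \near unwall (coord c p), bd_region c y -> U (param c (wall y)).
  have nU := near_param cp (open_near oU Up).
  have nU' : \forall y \near unwall (coord c p), region c (wall y) -> U (param c (wall y)).
    by rewrite -(wall_coord cp pb) in nU; exact: (wall_cvg nU).
  by apply: filterS nU' => y h /bd_regionE.
have ximg : (@coord R F _ AtK c @` (@cdom R F _ AtK c `&` (bd F `&` U))) (unwall (coord c p)).
  by exists p.
have [U' [g [oU' Ux gC ag]]] := smooth_on_shrink (aS c w) ximg nU.
exists U', g; split=> // y Uy ry; have [/(_ ry) Uq agy] := ag y Uy.
have [cq qb] := bd_param ry; split=> //; apply: agy.
exists (param c (wall y)); first by [].
have ry' : region c (wall y) by apply/bd_regionE.
by rewrite /= paramK//; exact: wallK.
Qed.

Lemma bd_rep_extends (U : set F) (a : F -> VK -> R) c p w : open U ->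
  smooth_form1 AtK (bd F `&` U) a -> cdom c p -> bd F p -> U p ->
  exists g, extends_at (bd_region c) (bd_rep a c w) (unwall (coord c p)) g.
Proof.
move=> oU aS cp pb Up; have [U' [g [oU' Ux gC ag]]] := bd_form_smooth w oU aS cp pb Up.
exists g; apply: smooth_extends oU' Ux gC _; first exact: bd_region_coord.
by move=> y Uy ry; have [] := ag y Uy ry.
Qed.

Lemma bd_tvec_linear c p : cdom c p -> bd F p -> linear (@tvec R F _ AtK c p).
Proof.
move=> cp pb a x y; rewrite !bd_tvecE//.
have -> : tvec c p (wall (a *: x + y)) = a *: tvec c p (wall x) + tvec c p (wall y).
  by rewrite linearP; exact: tvec_linear.
exact: linearP.
Qed.

Lemma bd_dform1_bilinear (U : set F) (a : F -> VK -> R) p : open U ->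
  smooth_form1 AtK (bd F `&` U) a -> bd F p -> U p -> bilinear (dform1 AtK a p).
Proof.
move=> oU aS pb Up; have cp := pref_cdom p; have [_ al _] := aS.
set c := pref At p in cp *; have rK := bd_region_coord cp pb.
have tK := bd_region_thick rK.
pose D w v := deriv_in (bd_region c) (bd_rep a c w) (unwall (coord c p)) v.
have Dl w : scalar (D w).
  have [g ag] := bd_rep_extends w oU aS cp pb Up.
  exact: deriv_in_scalar tK ag.
have Dr v : scalar (D ^~ v).
  move=> k w1 w2; have [U1 [g1 [oU1 Ux1 gC1 ag1]]] := bd_form_smooth w1 oU aS cp pb Up.
  have [U2 [g2 [oU2 Ux2 gC2 ag2]]] := bd_form_smooth w2 oU aS cp pb Up.
  have d1 : differentiable g1 (unwall (coord c p)) by have [gd _] := gC1 1; exact: gd.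
  have d2 : differentiable g2 (unwall (coord c p)) by have [gd _] := gC2 1; exact: gd.
  have ext1 : extends_at (bd_region c) (bd_rep a c w1) (unwall (coord c p)) g1.
    by apply: smooth_extends oU1 Ux1 gC1 _ => // y Uy ry; have [] := ag1 y Uy ry.
  have ext2 : extends_at (bd_region c) (bd_rep a c w2) (unwall (coord c p)) g2.
    by apply: smooth_extends oU2 Ux2 gC2 _ => // y Uy ry; have [] := ag2 y Uy ry.
  have ext : extends_at (bd_region c) (bd_rep a c (k *: w1 + w2)) (unwall (coord c p))
      (k *: g1 + g2).
    split=> //; last by apply: differentiableD => //; exact: differentiableZ.
    apply: filterS2 (open_near oU1 Ux1) (open_near oU2 Ux2) => y Uy1 Uy2 ry.
    have [Sq E1] := ag1 y Uy1 ry; have [_ E2] := ag2 y Uy2 ry.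
    have [cq qb] := bd_param ry.
    rewrite -[RHS]/(k * g1 y + g2 y) -E1 -E2 /bd_rep bd_tvec_linear//.
    exact: al.
  have e := congr1 (fun d : VK -> R => d v) (diffD (differentiableZ k d1) d2).
  have e' := congr1 (fun d : VK -> R => d v) (diffZ k d1).
  have E1 : D w1 v = 'd g1 (unwall (coord c p)) v by exact: deriv_inE.
  have E2 : D w2 v = 'd g2 (unwall (coord c p)) v by exact: deriv_inE.
  apply: etrans (deriv_inE v tK ext) _; apply: etrans e _; rewrite E1 E2.
  have addE (A B C : R) : A = B -> A + C = B + C by move->.
  exact: addE e'.
have dE v w : dform1 AtK a p v w = D w v - D v w by [].
clearbody D; split=> v k w1 w2; rewrite !dE.
  by rewrite (Dr v k w1 w2) (Dl v k w1 w2) mulrBr opprD addrACA.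
by rewrite (Dl v k w1 w2) (Dr v k w1 w2) mulrBr opprD addrACA.
Qed.

End Positivity.

Section ProductRule.
Context {R : realType} {m : nat}.
Local Notation V := 'rV[R]_m.+1.

(** The product rule at a common zero of f1 and f4. It gives the derivative of
    f1 = (f3 / f2) f4 when nothing is known on the derivative of f3 / f2. *)
Lemma deriv_in_cross (A : set V) (f1 f2 f3 f4 g1 g2 g3 g4 : V -> R) x v :
  (\forall y \near x, A y) -> extends_at A f1 x g1 -> extends_at A f2 x g2 ->
  extends_at A f3 x g3 -> extends_at A f4 x g4 ->
  (forall y, A y -> f1 y * f2 y = f3 y * f4 y) -> f1 x = 0 -> f4 x = 0 ->
  deriv_in A f1 x v * f2 x = f3 x * deriv_in A f4 x v.
Proof.
move=> Ax E1 E2 E3 E4 fE f10 f40; have tA := open_thick Ax; have xA := nbhs_singleton Ax.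
have [_ N1 d1] := E1; have [_ N2 d2] := E2; have [_ N3 d3] := E3; have [_ N4 d4] := E4.
have gE : \forall y \near x, (g1 * g2) y = (g3 * g4) y.
  have N12 : \forall y \near x, (A y -> f1 y = g1 y) /\ (A y -> f2 y = g2 y).
    exact: filterI N1 N2.
  have N34 : \forall y \near x, (A y -> f3 y = g3 y) /\ (A y -> f4 y = g4 y).
    exact: filterI N3 N4.
  apply: filterS3 Ax N12 N34 => y Ay [e1 e2] [e3 e4].
  rewrite -[LHS]/(g1 y * g2 y) -[RHS]/(g3 y * g4 y).
  by rewrite -e1// -e2// -e3// -e4//; exact: fE.
have D1 : deriv_in A f1 x v = 'D_v g1 x.
  by apply: etrans (deriv_inE v tA E1) _; exact: esym (deriveE v d1).
have D4 : deriv_in A f4 x v = 'D_v g4 x.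
  by apply: etrans (deriv_inE v tA E4) _; exact: esym (deriveE v d4).
have M12 := deriveM (diff_derivable (v := v) d1) (diff_derivable (v := v) d2).
have M34 := deriveM (diff_derivable (v := v) d3) (diff_derivable (v := v) d4).
have M : g1 x *: 'D_v g2 x + g2 x *: 'D_v g1 x = g3 x *: 'D_v g4 x + g4 x *: 'D_v g3 x.
  apply: etrans (esym M12) _; apply: etrans _ M34.
  exact: near_eq_derive.
rewrite D1 D4.
have := nbhs_singleton N1 xA; have := nbhs_singleton N4 xA.
have := nbhs_singleton N2 xA; have := nbhs_singleton N3 xA.
rewrite f10 f40 => -> -> z4 z1.
move: M; rewrite -z1 -z4 !scale0r add0r addr0 mulrC.
exact.
Qed.

End ProductRule.

Section Equations.
Context {R : realType} {n : nat} {F : domain R (n.*2).+1}.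
Local Notation V := 'rV[R]_(n.*2).+2.
Local Notation VK := 'rV[R]_(n.*2).+1.
Local Notation At := (charts F).
Local Notation AtK := (bd_atlas F).
Implicit Types (p q : F) (c : chart At).

Lemma same_kernel (a a' : VK -> R) Z : scalar a -> scalar a' ->
  [set v | a v = 0] = [set v | a' v = 0] -> [set v | 0 < a v] = [set v | 0 < a' v] ->
  0 < a Z -> 0 < a' Z /\ forall v, a' v = a' Z / a Z * a v.
Proof.
move=> al al' ker pos aZ; split=> [|v]; first by have : [set v | 0 < a' v] Z by rewrite -pos.
have : [set v | a' v = 0] (- (a v / a Z) *: Z + v).
  by rewrite -ker /= al mulNr divfK ?gt_eqF// addNr.
rewrite /= al' mulNr => /eqP; rewrite addrC subr_eq0 => /eqP ->.
by rewrite mulrAC [RHS]mulrAC [a v * _]mulrC.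
Qed.

Lemma bd_tvec_pref p (v : VK) : bd F p -> @tvec R F _ AtK (pref At p) p v = v.
Proof. by move=> pb; rewrite bd_tvecE ?tvec_pref ?wallK//; exact: pref_cdom. Qed.

(** If a' = g a then da' = dg /\ a + g da, and dg /\ a vanishes on the kernel
    of a. *)
Lemma dform1_scale (U U' : set F) (a a' : F -> VK -> R) p v w Z g :
  open U -> open U' -> smooth_form1 AtK (bd F `&` U) a ->
  smooth_form1 AtK (bd F `&` U') a' -> bd F p -> U p -> U' p ->
  (forall q, bd F q -> U q -> U' q -> forall x y, a' q x * a q y = a' q y * a q x) ->
  0 < a p Z -> a' p Z = g * a p Z -> a p v = 0 -> a p w = 0 ->
  dform1 AtK a' p v w = g * dform1 AtK a p v w.
Proof.
move=> oU oU' aS aS' pb Up Up' cross aZ gE av aw; have cp := pref_cdom p.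
set c := pref At p in cp *; set y0 := unwall (coord c p).
have rK := bd_region_coord cp pb; have pE : param c (wall y0) = p.
  by rewrite /y0 wall_coord// coordK.
have a'0 x : a p x = 0 -> a' p x = 0.
  move=> ax; have := cross p pb Up Up' x Z; rewrite ax mulr0 => /eqP.
  by rewrite mulf_eq0 (gt_eqF aZ) orbF => /eqP.
have near_dom : \forall y \near y0, bd_region c y /\ U (param c (wall y)) /\
    U' (param c (wall y)).
  have [V1 [h1 [oV1 Vy1 _ H1]]] := bd_form_smooth 0 oU aS cp pb Up.
  have [V2 [h2 [oV2 Vy2 _ H2]]] := bd_form_smooth 0 oU' aS' cp pb Up'.
  apply: filterS3 (near_bd_region rK) (open_near oV1 Vy1) (open_near oV2 Vy2).
  by move=> y ry Vy Vy'; have [[_ ?] _] := H1 y Vy ry; have [[_ ?] _] := H2 y Vy' ry.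
pose A : set VK := [set y | bd_region c y /\ U (param c (wall y)) /\ U' (param c (wall y))].
have Ay0 : A y0 by split=> //; rewrite pE.
have repE f x : bd_rep f c x y0 = f p x.
  by rewrite /bd_rep pE bd_tvec_pref.
have tK := bd_region_thick rK; have tA := open_thick near_dom.
have D x t : a p x = 0 ->
    deriv_in (bd_region c) (bd_rep a' c x) y0 t * a p Z =
    a' p Z * deriv_in (bd_region c) (bd_rep a c x) y0 t.
  move=> ax; have [g1 E1] := bd_rep_extends x oU' aS' cp pb Up'.
  have [g2 E2] := bd_rep_extends Z oU aS cp pb Up.
  have [g3 E3] := bd_rep_extends Z oU' aS' cp pb Up'.
  have [g4 E4] := bd_rep_extends x oU aS cp pb Up.
  have sub (f h : VK -> R) : extends_at (bd_region c) f y0 h -> extends_at A f y0 h.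
    move=> [_ N d]; split=> //; apply: filterS N => y Ny [ry _]; exact: Ny.
  have F1 := sub _ _ E1; have F2 := sub _ _ E2; have F3 := sub _ _ E3; have F4 := sub _ _ E4.
  have C := deriv_in_cross t near_dom F1 F2 F3 F4.
  rewrite -!(repE _ Z) (deriv_inE t tK E1) (deriv_inE t tK E4).
  rewrite -(deriv_inE t tA F1) -(deriv_inE t tA F4); apply: C.
  - move=> y [ry [Uy Uy']]; have [_ qb] := bd_param ry.
    exact: cross qb Uy Uy' _ _.
  - by rewrite repE; exact: a'0.
  - by rewrite repE.
have De x t : a p x = 0 -> deriv_in (bd_region c) (bd_rep a' c x) y0 t =
    g * deriv_in (bd_region c) (bd_rep a c x) y0 t.
  move=> ax; apply: (@mulIf _ (a p Z)); first by rewrite gt_eqF.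
  by apply: etrans (D x t ax) _; rewrite gE mulrAC.
have subE (P P' Q Q' : R) : P = g * P' -> Q = g * Q' -> P - Q = g * (P' - Q').
  by move=> -> ->; rewrite mulrBr.
exact: subE (De w v aw) (De v w av).
Qed.

Lemma contact_vol_scale (U U' : set F) (a a' : F -> VK -> R) xi p :
  open U -> open U' -> smooth_form1 AtK (bd F `&` U) a ->
  smooth_form1 AtK (bd F `&` U') a' ->
  cooriented_kernel (bd F `&` U) a xi -> cooriented_kernel (bd F `&` U') a' xi ->
  bd F p -> U p -> U' p -> (exists Z, 0 < a p Z) ->
  exists2 g : R, 0 < g & forall e, contact_vol AtK a' p e = g ^+ n.+1 * contact_vol AtK a p e.
Proof.
move=> oU oU' aS aS' xa xa' pb Up Up' [Z aZ].
have [_ al _] := aS; have [_ al' _] := aS'.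
have ker q : bd F q -> U q -> U' q -> [set v | a q v = 0] = [set v | a' q v = 0] /\
    [set v | 0 < a q v] = [set v | 0 < a' q v].
  move=> qb Uq Uq'; have [k1 s1] := xa q (conj qb Uq).
  by have [k2 s2] := xa' q (conj qb Uq'); rewrite -k1 -s1 -k2 -s2.
have cross q : bd F q -> U q -> U' q -> forall x y, a' q x * a q y = a' q y * a q x.
  move=> qb Uq Uq' x y; have [kq sq] := ker q qb Uq Uq'.
  have l1 := al q (conj qb Uq); have l2 := al' q (conj qb Uq').
  have [[Y aY]|noY] := pselect (exists Y, 0 < a q Y).
    have [_ h] := same_kernel l1 l2 kq sq aY.
    by rewrite (h x) (h y) mulrAC.
  have a0 z : a q z = 0.
    apply/eqP; rewrite eq_le; apply/andP; split; rewrite leNgt; apply/negP => az.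
      by apply: noY; exists z.
    by apply: noY; exists (-1 *: z); rewrite scalarZ// mulN1r oppr_gt0.
  by rewrite !a0 !mulr0.
have [kp sp] := ker p pb Up Up'.
have lp := al p (conj pb Up); have lp' := al' p (conj pb Up').
have [a'Z aE] := same_kernel lp lp' kp sp aZ.
exists (a' p Z / a p Z) => [|e]; first exact: divr_gt0.
have bl := bd_dform1_bilinear oU aS pb Up.
have bl' := bd_dform1_bilinear oU' aS' pb Up'.
apply: wedge1_exp_scale => // x y ax ay.
apply: (dform1_scale oU oU' aS aS' pb Up Up' cross aZ) => //.
Qed.

End Equations.

(** * Equations of the contact structure and conormal sections *)

Section SmoothAt.
Context {R : realType} {m : nat}.
Local Notation V := 'rV[R]_m.+1.

Definition smooth_at (A : set V) (f : V -> R) x := exists U (g : V -> R),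
  [/\ open U, U x, forall k, Ck k U g & forall y, U y -> A y -> f y = g y].

Lemma smooth_at_mul (A : set V) (f h : V -> R) x :
  smooth_at A f x -> smooth_at A h x -> smooth_at A (fun y => f y * h y) x.
Proof.
move=> [U1 [g1 [oU1 Ux1 gC1 fg1]]] [U2 [g2 [oU2 Ux2 gC2 fg2]]].
exists (U1 `&` U2), (fun y => g1 y * g2 y); split.
- exact: openI.
- by split.
- move=> k; apply: CkM; first exact: openI.
    by apply: Ck_subset (gC1 k) => y [].
  by apply: Ck_subset (gC2 k) => y [].
- by move=> y [Uy1 Uy2] Ay; rewrite fg1// fg2.
Qed.

Lemma smooth_at_eq (A : set V) (f f' : V -> R) x :
  (forall y, A y -> f y = f' y) -> smooth_at A f' x -> smooth_at A f x.
Proof.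
move=> ff' [U [g [oU Ux gC fg]]]; exists U, g; split=> // y Uy Ay.
by rewrite ff'// fg.
Qed.

Lemma smooth_at_quotient (A : set V) (r f h : V -> R) x : A x ->
  smooth_at A f x -> smooth_at A h x -> h x != 0 ->
  (forall y, A y -> f y = r y * h y) -> smooth_at A r x.
Proof.
move=> Ax [U1 [g1 [oU1 Ux1 gC1 fg1]]] [U2 [g2 [oU2 Ux2 gC2 fg2]]] hx frh.
have gx : g2 x != 0 by rewrite -fg2.
have g2c : g2 @ x --> g2 x by exact: (gC2 0 x Ux2).
pose P y := [/\ U1 y, U2 y & g2 y != 0].
have Px : \forall y \near x, P y.
  have g2n : \forall y \near x, g2 y != 0.
    have n0 : nbhs (g2 x) [set z | z != 0].
      by apply: open_nbhs_nbhs; split => //; exact: open_neq.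
    exact: (g2c _ n0).
  by apply: filterS3 (open_near oU1 Ux1) (open_near oU2 Ux2) g2n => y.
exists P^°, (fun y => g1 y / g2 y); split.
- exact: open_interior.
- exact: Px.
- move=> k; apply: CkM; first exact: open_interior.
    by apply: Ck_subset (gC1 k) => y /nbhs_singleton[].
  apply: CkV; first exact: open_interior.
    by move=> y /nbhs_singleton[].
  by apply: Ck_subset (gC2 k) => y /nbhs_singleton[].
- move=> y /nbhs_singleton[Uy1 Uy2 gy] Ay.
  by rewrite -fg1// frh// -fg2// mulfK// fg2.
Qed.

End SmoothAt.

Section Correspondence.
Context {R : realType} {n : nat} {F : domain R (n.*2).+1}.
Local Notation V := 'rV[R]_(n.*2).+2.
Local Notation VK := 'rV[R]_(n.*2).+1.
Local Notation At := (charts F).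
Local Notation AtK := (bd_atlas F).
Local Notation K := (bd F).
Local Notation e0 := (delta_mx ord0 ord0 : V).
Implicit Types (p q : F) (c : chart At).

Lemma bd_form_smooth_at (a : F -> VK -> R) c p w : smooth_form1 AtK K a ->
  cdom c p -> bd F p -> smooth_at (bd_region c) (bd_rep a c w) (unwall (coord c p)).
Proof.
move=> aS cp pb; have aS' : smooth_form1 AtK (K `&` setT) a by rewrite setIT.
have [U [g [oU Ux gC ag]]] := bd_form_smooth w openT aS' cp pb I.
by exists U, g; split=> // y Uy ry; have [] := ag y Uy ry.
Qed.

Lemma differential_smooth_at (u : F -> R) c p v : smooth_fun At setT u ->
  cdom c p -> bd F p ->
  smooth_at (bd_region c) (fun y => differential At u (param c (wall y))
    (tvec c (param c (wall y)) v)) (unwall (coord c p)).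
Proof.
move=> uS cp pb; have [U [g [oU Ux gC ug]]] := fun_smooth uS cp.
have wc := linear_rV_continuous (f := @wall R (n.*2).+1).
exists (@wall R (n.*2).+1 @^-1` U), ('D_v g \o @wall R (n.*2).+1); split.
- by apply: open_comp => // y _; exact: wc.
- by rewrite /= wall_coord.
- by move=> k; apply: Ck_comp_linear => //; have [_] := gC k.+1; apply.
- move=> y Uy ry; have [cq qb] := bd_param ry.
  have ry' : region c (wall y) by apply/bd_regionE.
  rewrite differential_tvec// paramK//.
  have gd : differentiable g (wall y) by have [gd _] := gC 1; exact: gd.
  apply: etrans (deriv_inE v (region_thick ry') _) _; last exact: esym (deriveE v gd).
  exact: smooth_extends ry' oU Uy gC ug.
Qed.

Lemma bd_tvec_surj c p (z : VK) : cdom c p -> bd F p ->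
  exists z', @tvec R F _ AtK c p z' = z.
Proof.
move=> cp pb; have cp' := pref_cdom p.
exists (unwall (map_deriv id (pref At p) c p (wall z))).
rewrite bd_tvecE// unwallK; last first.
  by apply: map_deriv_tangent smooth_id _ cp' cp pb _ => //; exact: wall0.
by rewrite tvecE change_chartK// wallK.
Qed.

(** Otherwise e0 would be tangent to the boundary in the chart c. *)
Lemma tvec_transverse c p : cdom c p -> bd F p -> tvec c p e0 ord0 ord0 != 0.
Proof.
move=> cp pb; have cp' := pref_cdom p; apply/eqP => t0.
have := map_deriv_tangent smooth_id (fun q qb => qb) cp' cp pb t0.
rewrite tvecE change_chartK// mxE !eqxx => /eqP.
by rewrite oner_eq0.
Qed.

(** The factor is a quotient of components along a field with constant
    coefficients in c, chosen so that b does not vanish on it at p. *)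
Lemma factor_smooth_at (a b : F -> VK -> R) (r : F -> R) c p :
  smooth_form1 AtK K a -> smooth_form1 AtK K b ->
  (forall q, bd F q -> forall v, a q v = r q * b q v) ->
  cdom c p -> bd F p -> (exists Z, 0 < b p Z) ->
  smooth_at (bd_region c) (fun y => r (param c (wall y))) (unwall (coord c p)).
Proof.
move=> aS bS arb cp pb [Z bZ]; have [Z' ZE] := bd_tvec_surj Z cp pb.
apply: (smooth_at_quotient (bd_region_coord cp pb) (bd_form_smooth_at Z' aS cp pb)
  (bd_form_smooth_at Z' bS cp pb)).
  by rewrite /bd_rep wall_coord// coordK// ZE gt_eqF.
by move=> y ry; have [_ qb] := bd_param ry; exact: arb.
Qed.

Lemma smooth_on_bd (f : VK -> R) c :
  (forall p, cdom c p -> bd F p -> smooth_at (bd_region c) f (unwall (coord c p))) ->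
  smooth_on (bd_region c) f.
Proof.
move=> fs y ry; have [cq qb] := bd_param ry.
have ry' : region c (wall y) by apply/bd_regionE.
by have := fs _ cq qb; rewrite paramK// wallK.
Qed.

(** Some vector on which b p is positive; ratioE shows that the choice does not
    matter. *)
Definition positive_vector (b : F -> VK -> R) p : VK := xget 0 [set Z | 0 < b p Z].

Definition ratio (b a : F -> VK -> R) p : R :=
  a p (positive_vector b p) / b p (positive_vector b p).

(** For a = g b, this is the conormal section g du. *)
Definition equation_section (b : F -> VK -> R) (u : F -> R) (a : F -> VK -> R) :
    F -> V -> R :=
  fun p v => if `[< bd F p >] then ratio b a p * differential At u p v else 0.

Lemma positive_vectorP (b : F -> VK -> R) p : (exists Z, 0 < b p Z) ->
  0 < b p (positive_vector b p).
Proof. by move=> ex; have /= := @xgetPex _ (0 : VK) [set Z | 0 < b p Z] ex. Qed.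

Section Fixed.
Context {xi : cohyp R F n} {u : F -> R} {b : F -> VK -> R}.
Context (uB : boundary_function u) (b_eq : positive_equation K AtK xi b)
  (b_pos : forall p, bd F p -> exists Z, 0 < b p Z).

Lemma ratioE (g : R) a p : bd F p -> (forall v, a p v = g * b p v) -> ratio b a p = g.
Proof.
move=> pb agb; rewrite /ratio agb mulfK// gt_eqF//.
exact: positive_vectorP (b_pos pb).
Qed.

Lemma ratioP a p : positive_equation K AtK xi a -> bd F p ->
  0 < ratio b a p /\ forall v, a p v = ratio b a p * b p v.
Proof.
move=> [[_ al _] ak] pb; have [[_ bl _] bk] := b_eq.
have [ka sa] := ak p pb; have [kb sb] := bk p pb.
have bZ := positive_vectorP (b_pos pb).
have [aZ aE] := same_kernel (bl p pb) (al p pb) (etrans (esym kb) ka) (etrans (esym sb) sa) bZ.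
by split=> //; rewrite /ratio divr_gt0.
Qed.

Lemma equation_section_negative a : positive_equation K AtK xi a ->
  negative_section (equation_section b u a).
Proof.
move=> aE; have [uS _ _ _] := uB; have [aS _] := aE; have [bS _] := b_eq.
have EE p v : bd F p -> equation_section b u a p v = ratio b a p * differential At u p v.
  by rewrite /equation_section; case: asboolP.
split.
  split.
  - move=> p pb; apply: funext => v; rewrite /equation_section.
    by case: asboolP.
  - move=> p pb k v w; rewrite !EE// (differential_scalar p uS) mulrDr.
    by rewrite mulrCA.
  - move=> p pb v; rewrite EE// tinclE// (differential_boundary _ uB pb) wall0.
    by rewrite mul0r mulr0.
  - move=> c v; apply: smooth_on_bd => p cp pb.
    apply: (@smooth_at_eq _ _ _ _ (fun y => ratio b a (param c (wall y)) *
      differential At u (param c (wall y)) (tvec c (param c (wall y)) v))).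
      by move=> y ry; have [_ qb] := bd_param ry; exact: EE (param c (wall y)) _ qb.
    apply: smooth_at_mul; last exact: differential_smooth_at.
    apply: (factor_smooth_at aS bS) => //; last exact: b_pos.
    by move=> q qb w; have [_ ->] := ratioP aE qb.
move=> p pb v v0; rewrite EE// (differential_boundary _ uB pb).
have [r0 _] := ratioP aE pb; rewrite pmulr_rlt0// pmulr_llt0//.
exact: differential_inward.
Qed.

Lemma equation_section_inj a a' : positive_equation K AtK xi a ->
  positive_equation K AtK xi a' ->
  equation_section b u a = equation_section b u a' -> a = a'.
Proof.
move=> aE aE' EE; apply: funext => p; have [pb|npb] := pselect (bd F p).
  have := congr1 (fun s => s p e0) EE; rewrite /equation_section.
  case: asboolP => // _ /mulIf h; have {}h : ratio b a p = ratio b a' p.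
    by apply: h; rewrite gt_eqF// differential_inward.
  by apply: funext => v; rewrite (ratioP aE pb).2 (ratioP aE' pb).2 h.
have [[a0 _ _] _] := aE; have [[a0' _ _] _] := aE'.
by rewrite a0// a0'.
Qed.

Lemma conormal_boundary (s : F -> V -> R) p v : conormal_section s -> bd F p ->
  s p v = v ord0 ord0 * s p e0.
Proof.
move=> [_ sl st _] pb; have -> : v = v ord0 ord0 *: e0 + (v - v ord0 ord0 *: e0).
  by rewrite addrC subrK.
have -> : v - v ord0 ord0 *: e0 = tincl p (unwall (v - v ord0 ord0 *: e0)).
  by rewrite tinclE// unwallK// !mxE !eqxx mulr1 subrr.
rewrite sl// st// addr0 tinclE// !mxE !eqxx mulr1 unlift_none addr0.
by [].
Qed.

(** A section s vanishes on tangent vectors, as du does, so that s = h du with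
    h = s(e0) / du(e0), which is positive because - e0 is outward; then h b is the
    equation sought. *)
Lemma equation_section_surj (s : F -> V -> R) : negative_section s ->
  exists2 a, positive_equation K AtK xi a & equation_section b u a = s.
Proof.
move=> [sC sN]; have [uS _ _ _] := uB; have [[_ bl _] bk] := b_eq; have [bS _] := b_eq.
have [s0 sl _ sS] := sC.
pose h p := s p e0 / differential At u p e0.
have h0 p : bd F p -> 0 < h p.
  move=> pb; rewrite divr_gt0 ?differential_inward//.
  have : s p (- e0) < 0 by apply: sN => //; rewrite /outward !mxE !eqxx oppr_lt0 ltr01.
  by rewrite conormal_boundary// !mxE !eqxx mulN1r oppr_lt0.
have sh p v : bd F p -> s p v = h p * differential At u p v.
  move=> pb; rewrite conormal_boundary// (differential_boundary v uB pb) mulrCA.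
  by rewrite divfK// gt_eqF// differential_inward.
pose a p v := if `[< bd F p >] then h p * b p v else 0.
have aE p v : bd F p -> a p v = h p * b p v by rewrite /a; case: asboolP.
have hs c p : cdom c p -> bd F p ->
    smooth_at (bd_region c) (fun y => h (param c (wall y))) (unwall (coord c p)).
  move=> cp pb.
  have ss : smooth_at (bd_region c) (fun y => s (param c (wall y))
      (tvec c (param c (wall y)) e0)) (unwall (coord c p)).
    exact: sS (bd_region_coord cp pb).
  apply: (smooth_at_quotient (bd_region_coord cp pb) ss
    (differential_smooth_at e0 uS cp pb)).
    rewrite wall_coord// coordK// (differential_boundary _ uB pb) mulf_neq0//.
      exact: tvec_transverse.
    by rewrite gt_eqF// differential_inward.
  by move=> y ry; have [_ qb] := bd_param ry; exact: sh.
exists a.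
  split.
    split.
    - by move=> p pb; apply: funext => v; rewrite /a; case: asboolP.
    - move=> p pb k v w; rewrite !aE// bl// mulrDr.
      by rewrite mulrCA.
    - move=> c v.
      have imgE : (@coord R F _ AtK c @` (@cdom R F _ AtK c `&` K)) = bd_region c.
        apply/seteqP; split=> y [q [cq qb] <-]; first by exists q.
        by exists q.
      have repE y : bd_region c y ->
          bd_rep a c v y = h (@param R F _ At c (wall y)) * bd_rep b c v y.
        by move=> ry; have [_ qb] := bd_param ry; exact: aE (@param R F _ At c (wall y)) _ qb.
      rewrite imgE; apply: (@smooth_on_bd (bd_rep a c v) c) => p cp pb.
      apply: (smooth_at_eq repE).
      by apply: smooth_at_mul; [exact: hs|exact: bd_form_smooth_at].
  move=> p pb; have [kb sb] := bk p pb; rewrite kb sb.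
  split; apply/seteqP; split=> v /=; rewrite aE//.
  - by move=> ->; rewrite mulr0.
  - by move/eqP; rewrite mulf_eq0 gt_eqF ?h0//= => /eqP.
  - by move=> bv; rewrite mulr_gt0// h0.
  - by rewrite pmulr_rgt0// h0.
apply: funext => p; apply: funext => v; rewrite /equation_section.
case: asboolP => [pb|npb]; last by rewrite s0.
by rewrite (ratioE (g := h p))// -?sh// => w; rewrite aE.
Qed.

End Fixed.
End Correspondence.

(** * The contact structure of an ideal Liouville domain *)

Section ContactStructure.
Context {R : realType} {n : nat} {F : domain R (n.*2).+1}.
Local Notation V := 'rV[R]_(n.*2).+2.
Local Notation VK := 'rV[R]_(n.*2).+1.
Local Notation At := (charts F).
Local Notation AtK := (bd_atlas F).
Local Notation K := (bd F).
Implicit Types (p q : F) (omega : F -> V -> V -> R).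

Lemma liouville_data_pair omega l u b : liouville_data omega l u b ->
  liouville_pair omega u b.
Proof. by move=> [[lS lw] uB bS bul _]; split=> //; split=> //; exists l. Qed.

Lemma contact_form_positive (a : F -> VK -> R) p : contact_form AtK K a -> bd F p ->
  exists Z, 0 < a p Z.
Proof.
move=> [[_ al _] avol] pb; have [e /eqP ve] := avol p pb.
have lp := al p pb; apply: contrapT => noZ; apply: ve.
have a0 z : a p z = 0.
  apply/eqP; rewrite eq_le; apply/andP; split; rewrite leNgt; apply/negP => az.
    by apply: noZ; exists z.
  by apply: noZ; exists (-1 *: z); rewrite scalarZ// mulN1r oppr_gt0.
rewrite /contact_vol /wedge big1 ?mulr0// => s _.
by rewrite {1}/covec1 a0 mulr0 mul0r.
Qed.

(** Empty outside the boundary, as contact_structure requires. *)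
Definition kernel_cohyp (a : F -> VK -> R) : cohyp R F n :=
  Cohyp (fun p => [set v | bd F p /\ a p v = 0]) (fun p => [set v | bd F p /\ 0 < a p v]).

Lemma kernel_cohypP a : cooriented_kernel K a (kernel_cohyp a).
Proof.
move=> p pb; split; apply/seteqP; split=> v /=; first by case.
- by split.
- by case.
- by split.
Qed.

Lemma kernel_cohyp_contact a : contact_form AtK K a ->
  contact_structure K AtK (kernel_cohyp a).
Proof.
move=> aC; split=> [p npb|p pb].
  by split; apply/seteqP; split=> v //= -[/npb].
exists setT, a; rewrite setIT; split=> //; first exact: openT.
exact: kernel_cohypP.
Qed.

Lemma cohyp_eq (a : F -> VK -> R) xi xi' : contact_structure K AtK xi ->
  contact_structure K AtK xi' -> cooriented_kernel K a xi ->
  cooriented_kernel K a xi' -> xi = xi'.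
Proof.
case: xi xi' => [h s] [h' s'] [out _] [out' _] k k'; congr Cohyp; apply: funext => p;
  have [pb|npb] := pselect (bd F p).
- by have [/= -> _] := k p pb; have [/= -> _] := k' p pb.
- by have [/= -> _] := out p npb; have [/= -> _] := out' p npb.
- by have [/= _ ->] := k p pb; have [/= _ ->] := k' p pb.
- by have [/= _ ->] := out p npb; have [/= _ ->] := out' p npb.
Qed.

Lemma diffeomorphism_id : diffeomorphism (id : F -> F).
Proof. by split; [exact: smooth_id|exists id; split=> //; exact: smooth_id]. Qed.

Lemma tmap_id p v : tmap At At id p v = v.
Proof. by rewrite tmapE; apply: map_deriv_id; exact: pref_cdom. Qed.

Lemma preserves_id omega : preserves omega id.
Proof.
split=> [|p _ v1 v2]; last by rewrite !tmap_id.
by rewrite image_id.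
Qed.

(** This is comparison for the identity. *)
Lemma liouville_data_ratio omega l u b l' u' b' p :
  liouville_data omega l u b -> liouville_data omega l' u' b' -> bd F p ->
  exists2 h : R, 0 < h &
    (forall w, restr_form1 b' p w = h * restr_form1 b p w) /\
    (forall v, differential At u' p v = h * differential At u p v).
Proof.
move=> D D' pb; have [h h0 [hb hu]] := comparison (liouville_data_pair D)
  (liouville_data_pair D') diffeomorphism_id (preserves_id omega) pb.
exists h => //; split=> [w|v].
  by rewrite !restr_form1E// -hb ?wall0// tmap_id.
by rewrite -hu tmap_id.
Qed.

Lemma cooriented_kernel_scale (a a' : F -> VK -> R) xi : cooriented_kernel K a xi ->
  (forall p, bd F p -> exists2 h : R, 0 < h & forall w, a' p w = h * a p w) ->
  cooriented_kernel K a' xi.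
Proof.
move=> ak aa' p pb; have [-> ->] := ak p pb; have [h h0 hE] := aa' p pb.
split; apply/seteqP; split=> v /=; rewrite hE.
- by move=> ->; rewrite mulr0.
- by move/eqP; rewrite mulf_eq0 gt_eqF//= => /eqP.
- by move=> av; rewrite mulr_gt0.
- by rewrite pmulr_rgt0.
Qed.

Lemma preserves_bd_inv omega f g : preserves omega f -> cancel g f ->
  forall q, bd F q -> bd F (g q).
Proof.
move=> fP gK q qb; apply: contrapT => Ig.
by have := preserves_Int fP (Ig : Int F (g q)); rewrite gK; apply.
Qed.

(** By comparison, f multiplies b by a positive function on the boundary; the
    inverse of f gives the converse inclusions. *)
Lemma kernel_invariant omega l u b f : liouville_data omega l u b ->
  diffeomorphism f -> preserves omega f ->
  leaves_invariant f (kernel_cohyp (restr_form1 b)).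
Proof.
move=> D fD fP p pb; have [fS [g [gS fK gK]]] := fD.
have fb q : bd F q -> bd F (f q) by move=> qb; exact: preserves_bd fD fP qb.
have gb := preserves_bd_inv fP gK.
have P := liouville_data_pair D; have [h h0 [hb _]] := comparison P P fD fP pb.
have fpb := fb p pb.
have fE v : restr_form1 b (f p) (tmap AtK AtK f p v) = h * restr_form1 b p v.
  by rewrite !restr_form1E// wall_bd_tmap// hb ?wall0.
have surj w : exists v, tmap AtK AtK f p v = w.
  exists (tmap AtK AtK g (f p) w); apply: (can_inj (@wallK R _)).
  rewrite wall_bd_tmap// wall_bd_tmap//.
  by have := tmapK (f p) (wall w) fS gS gK; rewrite fK.
split=> //; apply/seteqP; split=> w /=.
- by move=> [v [_ bv] <-]; split=> //; rewrite fE bv mulr0.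
- move=> [_ bw]; have [v vE] := surj w; exists v => //; split=> //.
  move: bw; rewrite -vE fE => /eqP; rewrite mulf_eq0 gt_eqF//= => /eqP.
  exact.
- by move=> [v [_ bv] <-]; split=> //; rewrite fE mulr_gt0.
- move=> [_ bw]; have [v vE] := surj w; exists v => //; split=> //.
  by move: bw; rewrite -vE fE pmulr_rgt0.
Qed.

Lemma kernel_positive omega l u b : smooth_form2 At (Int F) omega ->
  liouville_data omega l u b ->
  positive_contact_structure omega (kernel_cohyp (restr_form1 b)).
Proof.
move=> oS D; have P := liouville_data_pair D; have [_ _ _ _ bC] := D.
split; first exact: kernel_cohyp_contact.
move=> U a oU [aS avol] ak p pb Up e.
have bS : smooth_form1 AtK (K `&` setT) (restr_form1 b) by rewrite setIT; have [] := bC.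
have bk : cooriented_kernel (K `&` setT) (restr_form1 b) (kernel_cohyp (restr_form1 b)).
  by rewrite setIT; exact: kernel_cohypP.
have [g g0 gE] := contact_vol_scale openT oU bS aS bk ak pb I Up
  (contact_form_positive bC pb).
rewrite gE pmulr_rgt0 ?exprn_gt0//.
by apply: (contact_vol_positive e oS P pb); have [_ /(_ p pb)] := bC.
Qed.

End ContactStructure.

Theorem proposition3 (R : realType) (n : nat) (F : domain R (n.*2).+1)
    (omega : F -> 'rV[R]_(n.*2).+2 -> 'rV[R]_(n.*2).+2 -> R)
    (omega_ideal : ideal_liouville omega) :
  exists xi : cohyp R F n,
    [/\ positive_contact_structure omega xi,
        unique (fun xi' : cohyp R F n =>
          contact_structure (bd F) (bd_atlas F) xi' /\
          forall l u b, liouville_data omega l u b ->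
            positive_equation (bd F) (bd_atlas F) xi' (restr_form1 b)) xi,
        forall f : F -> F, diffeomorphism f -> preserves omega f ->
          leaves_invariant f xi &
        exists Phi : (F -> 'rV[R]_(n.*2).+1 -> R)
                     -> (F -> 'rV[R]_(n.*2).+2 -> R),
          set_bij [set a | positive_equation (bd F) (bd_atlas F) xi a]
                  [set s | negative_section s] Phi
          /\ forall l u b, liouville_data omega l u b ->
               Phi (restr_form1 b) = conormal_differential u].
Proof.
have [oS _ [l0 [u0 [b0 D0]]]] := omega_ideal.
have [_ uB _ _ bC] := D0; have [bS _] := bC.
pose xi := kernel_cohyp (restr_form1 b0).
have xi_eq l u b : liouville_data omega l u b ->
    positive_equation (bd F) (bd_atlas F) xi (restr_form1 b).
  move=> D; have [_ _ _ _ [aS _]] := D; split=> //.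
  apply: (cooriented_kernel_scale (kernel_cohypP (restr_form1 b0))) => p pb.
  by have [h h0 [hb _]] := liouville_data_ratio D0 D pb; exists h.
have b_eq := xi_eq _ _ _ D0.
have b_pos p : bd F p -> exists Z, 0 < restr_form1 b0 p Z.
  exact: contact_form_positive bC.
exists xi; split.
- exact: kernel_positive oS D0.
- split; first by split=> //; exact: kernel_cohyp_contact.
  move=> xi' [xiC xiD]; have [_ k'] := xiD _ _ _ D0.
  by apply: cohyp_eq k'; [exact: kernel_cohyp_contact|exact: xiC|exact: kernel_cohypP].
- by move=> f fD fP; exact: kernel_invariant D0 fD fP.
- exists (equation_section (restr_form1 b0) u0); split.
    split.
    + by move=> a aE; exact: equation_section_negative uB b_eq b_pos a aE.
    + by move=> a a' /set_mem aE /set_mem aE'; exact: equation_section_inj uB b_eq b_pos a a' aE aE'.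
    + move=> s sN; have [a aE <-] := equation_section_surj uB b_eq b_pos sN.
      by exists a.
  move=> l u b D; apply: funext => p; apply: funext => v.
  rewrite /equation_section /conormal_differential; case: asboolP => // pb.
  have [h h0 [hb hu]] := liouville_data_ratio D0 D pb.
  by rewrite (ratioE b_pos pb hb) hu.
Qed.
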